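(* Let $A$ be a Fréchet-Arens-Michael algebra. The following conditions are equivalent: (i) $A$ is amenable; (ii) for each Banach $A$-bimodule $X$, every continuous derivation from $A$ to $X^*$ is inner; (iii) for each Fréchet $A$-bimodule $X$, every continuous derivation from $A$ to $X^*$ is inner.
   Context: All spaces are over $\mathbb C$. A Fréchet-Arens-Michael algebra is a Fréchet algebra whose topology is given by a family of submultiplicative seminorms. A Fréchet (Banach) $A$-bimodule is a Fréchet (Banach) space with an $A$-bimodule structure whose left and right actions are jointly continuous. $X^*$ is the dual of $X$ with the strong topology and the $A$-bimodule structure $\langle f\cdot a,x\rangle=\langle f,a\cdot x\rangle$, $\langle a\cdot f,x\rangle=\langle f,x\cdot a\rangle$. A derivation $D\colon A\to X^*$ is a linear map with $D(ab)=a\cdot D(b)+D(a)\cdot b$; it is inner if there is $f\in X^*$ with $D(a)=a\cdot f-f\cdot a$ for all $a\in A$. $A_+$ is the unitization of $A$ (an identity is always adjoined), $\widehat\otimes$ the completed projective tensor product, $A^e=A_+\mathbin{\widehat\otimes}A_+^{\mathrm{op}}$. For a Fréchet algebra $R$, a Fréchet $R$-module is a Fréchet space with a jointly continuous $R$-module structure. For a right Fréchet $R$-module $Y$ and a left Fréchet $R$-module $X$, $Y\mathbin{\widehat\otimes}_R X=(Y\mathbin{\widehat\otimes}X)/N$, where $N$ is the closed linear span of all $y\cdot r\otimes x-y\otimes r\cdot x$. A left Fréchet $R$-module $X$ is flat if $(\,\cdot\,)\mathbin{\widehat\otimes}_R X$ takes every algebraically exact sequence $0\to Y_1\to Y_2\to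 Y_3\to0$ of right Fréchet $R$-modules (with continuous module maps) that splits as a sequence of Fréchet spaces (by continuous linear maps) to an exact sequence of vector spaces. A Fréchet $A$-bimodule is flat if it is flat as a left Fréchet $A^e$-module via $(a\otimes b)\cdot x=a\cdot x\cdot b$. $A$ is amenable if $A_+$ is a flat Fréchet $A$-bimodule. *)

(* Defs.v *)
From HB Require Import structures.
From mathcomp Require Import all_boot all_order all_algebra.
From mathcomp Require Import all_classical all_reals all_analysis.
From mathcomp Require Export complex.

Set Implicit Arguments.
Unset Strict Implicit.
Unset Printing Implicit Defensive.

Import Order.TTheory GRing.Theory Num.Theory.
Import numFieldNormedType.Exports.

Local Open Scope classical_set_scope.
Local Open Scope ring_scope.

(* Everything is stated over a numFieldType K and used with K := R[i]. *)

Section Spaces.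
Context {K : numFieldType}.

(* A tvsType also carries a uniformity, which need not be translation
   invariant.  Metrizability and completeness are therefore expressed with the
   neighbourhoods of 0, i.e. for the canonical uniformity of the additive
   group. *)
Definition tvs_cauchy (V : tvsType K) (F : set_system V) : Prop :=
  forall U : set V, nbhs 0 U ->
    exists2 B, F B & forall x y, B x -> B y -> U (x - y).

Definition frechet_space (V : tvsType K) : Prop :=
  [/\ hausdorff_space V,
      exists B : nat -> set V, (forall n, nbhs 0 (B n)) /\
        (forall U : set V, nbhs 0 U -> exists n, B n `<=` U)
    & forall F : set_system V, ProperFilter F -> tvs_cauchy F ->
        exists x : V, F --> x].

Definition bilinear_map (U V W : lmodType K) (b : U -> V -> W) : Prop :=
  (forall u, linear (b u)) /\ (forall v, linear (b^~ v)).

Definition jointly_continuous (U V W : topologicalType) (b : U -> V -> W) :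
    Prop :=
  continuous (fun z : U * V => b z.1 z.2).

Definition linear_span (V : lmodType K) (S : set V) : set V :=
  [set v | exists n (c : 'I_n -> K) (w : 'I_n -> V),
     (forall i, S (w i)) /\ v = \sum_(i < n) c i *: w i].

Definition tvs_bounded (V : tvsType K) (B : set V) : Prop :=
  forall U : set V, nbhs 0 U -> exists2 r : K, 0 < r &
    forall t : K, r <= `|t| -> B `<=` [set t *: u | u in U].

Definition dual (X : tvsType K) : set (X -> K^o) :=
  [set f | linear f /\ continuous f].

(* Uniform convergence on bounded sets; the strong dual of X is the subspace
   dual X of this function space. *)
Definition strong_space (X : tvsType K) :=
  {family @tvs_bounded X, X -> K^o}.

End Spaces.

Arguments dual {K} X _.
Arguments strong_space {K} X.

Section Algebras.
Context {K : numFieldType}.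

Definition frechet_algebra (A : tvsType K) (mul : A -> A -> A) : Prop :=
  [/\ frechet_space A, bilinear_map mul, associative mul
    & jointly_continuous mul].

Definition submultiplicative_seminorm (A : lmodType K) (mul : A -> A -> A)
    (p : A -> K) : Prop :=
  [/\ forall x, 0 <= p x,
      forall x y, p (x + y) <= p x + p y,
      forall (t : K) x, p (t *: x) = `|t| * p x
    & forall x y, p (mul x y) <= p x * p y].

Definition frechet_arens_michael (A : tvsType K) (mul : A -> A -> A) : Prop :=
  frechet_algebra mul /\
  exists (I : Type) (p : I -> A -> K),
    (forall i, submultiplicative_seminorm mul (p i)) /\
    (forall U : set A, nbhs 0 U <->
       exists (J : set I) (e : K), [/\ finite_set J, 0 < e
         & [set x | forall i, J i -> p i x < e] `<=` U]).

Definition left_frechet_module (R : tvsType K) (mul : R -> R -> R)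
    (X : tvsType K) (l : R -> X -> X) : Prop :=
  [/\ frechet_space X, bilinear_map l,
      forall a b x, l (mul a b) x = l a (l b x)
    & jointly_continuous l].

Definition right_frechet_module (R : tvsType K) (mul : R -> R -> R)
    (X : tvsType K) (r : X -> R -> X) : Prop :=
  [/\ frechet_space X, bilinear_map r,
      forall x a b, r x (mul a b) = r (r x a) b
    & jointly_continuous r].

Definition topological_bimodule (A : tvsType K) (mul : A -> A -> A)
    (X : tvsType K) (l : A -> X -> X) (r : X -> A -> X) : Prop :=
  [/\ bilinear_map l /\ bilinear_map r,
      forall a b x, l (mul a b) x = l a (l b x),
      forall x a b, r x (mul a b) = r (r x a) b,
      forall a x b, r (l a x) b = l a (r x b)
    & jointly_continuous l /\ jointly_continuous r].

Definition frechet_bimodule (A : tvsType K) (mul : A -> A -> A)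
    (X : tvsType K) (l : A -> X -> X) (r : X -> A -> X) : Prop :=
  frechet_space X /\ topological_bimodule mul l r.

End Algebras.

Section Derivations.
Context {K : numFieldType} (A : tvsType K) (mul : A -> A -> A).
Context (X : tvsType K) (l : A -> X -> X) (r : X -> A -> X).

Definition dual_lact (a : A) (f : X -> K^o) : X -> K^o := fun x => f (r x a).
Definition dual_ract (f : X -> K^o) (a : A) : X -> K^o := fun x => f (l a x).

Definition derivation_to_dual (D : A -> (X -> K^o)) : Prop :=
  [/\ forall a, dual X (D a),
      linear D
    & forall a b, D (mul a b) = dual_lact a (D b) + dual_ract (D a) b].

Definition inner_derivation (D : A -> (X -> K^o)) : Prop :=
  exists2 f, dual X f & forall a, D a = dual_lact a f - dual_ract f a.

Definition continuous_derivations_inner : Prop :=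
  forall D : A -> (X -> K^o), derivation_to_dual D ->
    continuous (D : A -> strong_space X) -> inner_derivation D.

End Derivations.

Section Flatness.
Context {K : numFieldType}.

(* T, with tau x y in the role of the elementary tensor of x and y, is the
   completed projective tensor product of E and F: the Fréchet space
   representing the jointly continuous bilinear maps from E x F to Fréchet
   spaces.  It is determined up to a unique topological isomorphism
   compatible with tau. *)
Definition projective_tensor (E F T : tvsType K) (tau : E -> F -> T) : Prop :=
  [/\ frechet_space T, bilinear_map tau, jointly_continuous tau
    & forall (G : tvsType K) (b : E -> F -> G), frechet_space G ->
        bilinear_map b -> jointly_continuous b ->
        exists! phi : T -> G, [/\ linear phi, continuous phi
          & forall x y, phi (tau x y) = b x y]].

(* The subspace N by which T is divided to form the tensor product over R. *)
Definition balancing_subspace (R Y X T : tvsType K) (r : Y -> R -> Y)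
    (l : R -> X -> X) (tau : Y -> X -> T) : set T :=
  closure (linear_span
    [set v | exists y a x, v = tau (r y a) x - tau y (l a x)]).

Definition short_exact (Y1 Y2 Y3 : lmodType K) (f : Y1 -> Y2) (g : Y2 -> Y3) :
    Prop :=
  [/\ injective f, forall y, g y = 0 <-> exists x, f x = y
    & forall z, exists y, g y = z].

(* Exactness of 0 -> T1/N1 -> T2/N2 -> T3/N3 -> 0 with the maps induced by
   F and G. *)
Definition short_exact_mod (T1 T2 T3 : lmodType K)
    (N1 : set T1) (N2 : set T2) (N3 : set T3) (F : T1 -> T2) (G : T2 -> T3) :
    Prop :=
  [/\ forall u, N2 (F u) <-> N1 u,
      forall v, N3 (G v) <-> exists u, N2 (v - F u)
    & forall w, exists v, N3 (w - G v)].

Definition continuous_split (Y1 Y2 Y3 : tvsType K)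
    (f : Y1 -> Y2) (g : Y2 -> Y3) : Prop :=
  exists (p : Y2 -> Y1) (s : Y3 -> Y2),
    [/\ linear p /\ continuous p, linear s /\ continuous s,
        forall x, p (f x) = x, forall z, g (s z) = z
      & forall y, f (p y) + s (g y) = y].

Definition right_module_map (R Y Z : tvsType K)
    (rY : Y -> R -> Y) (rZ : Z -> R -> Z) (f : Y -> Z) : Prop :=
  [/\ linear f, continuous f & forall y a, f (rY y a) = rZ (f y) a].

(* F and G below are the maps obtained from f and g by tensoring with the
   identity of X. *)
Definition flat_module (R : tvsType K) (mul : R -> R -> R)
    (X : tvsType K) (l : R -> X -> X) : Prop :=
  forall (Y1 Y2 Y3 : tvsType K)
    (r1 : Y1 -> R -> Y1) (r2 : Y2 -> R -> Y2) (r3 : Y3 -> R -> Y3)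
    (f : Y1 -> Y2) (g : Y2 -> Y3),
    right_frechet_module mul r1 -> right_frechet_module mul r2 ->
    right_frechet_module mul r3 ->
    right_module_map r1 r2 f -> right_module_map r2 r3 g ->
    short_exact f g -> continuous_split f g ->
  forall (T1 T2 T3 : tvsType K) (tau1 : Y1 -> X -> T1) (tau2 : Y2 -> X -> T2)
    (tau3 : Y3 -> X -> T3) (F : T1 -> T2) (G : T2 -> T3),
    projective_tensor tau1 -> projective_tensor tau2 ->
    projective_tensor tau3 ->
    [/\ linear F, continuous F & forall y x, F (tau1 y x) = tau2 (f y) x] ->
    [/\ linear G, continuous G & forall y x, G (tau2 y x) = tau3 (g y) x] ->
    short_exact_mod (balancing_subspace r1 l tau1)
      (balancing_subspace r2 l tau2) (balancing_subspace r3 l tau3) F G.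

End Flatness.

Section Amenability.
Context {K : numFieldType} (A : tvsType K) (mul : A -> A -> A).

Definition unitization : tvsType K := (A * K^o)%type.

Definition unitization_mul (u v : unitization) : unitization :=
  (mul u.1 v.1 + u.2 *: v.1 + v.2 *: u.1, u.2 * v.2).

Definition unitization_lact (X : tvsType K) (l : A -> X -> X)
    (u : unitization) (x : X) : X := l u.1 x + u.2 *: x.

Definition unitization_ract (X : tvsType K) (r : X -> A -> X)
    (x : X) (u : unitization) : X := r x u.1 + u.2 *: x.

(* E is the projective tensor product of the unitization and its opposite,
   hence the reversed product in the second factor. *)
Definition enveloping_algebra (E : tvsType K)
    (tau : unitization -> unitization -> E) (mulE : E -> E -> E) : Prop :=
  [/\ projective_tensor tau, frechet_algebra mulE
    & forall a b c d, mulE (tau a b) (tau c d) =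
        tau (unitization_mul a c) (unitization_mul d b)].

Definition flat_bimodule (X : tvsType K) (l : A -> X -> X) (r : X -> A -> X) :
    Prop :=
  forall (E : tvsType K) (tau : unitization -> unitization -> E)
    (mulE : E -> E -> E) (act : E -> X -> X),
    enveloping_algebra tau mulE -> left_frechet_module mulE act ->
    (forall a b x, act (tau a b) x =
       unitization_ract r (unitization_lact l a x) b) ->
    flat_module mulE act.

Definition amenable : Prop :=
  flat_bimodule (X := unitization)
    (fun a u => unitization_mul (a, 0) u)
    (fun u a => unitization_mul u (a, 0)).

End Amenability.

(* Main.v *)
(* For a right A^e-module Y, i.e. an A-bimodule, the functionals on
   Y (x)_{A^e} A_+ are the central functionals h on Y, h(ya) = h(ay).  By
   Hahn-Banach, uniform boundedness and the open mapping theorem, flatness of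
   A_+ therefore means that central functionals extend along the embedding
   Y1 -> Y2 of every split extension 0 -> Y1 -> Y2 -> Y3 -> 0 of bimodules.

   (iii) => (i): extending h by means of the splitting destroys centrality by a
   derivation A -> Y3^*; subtracting a functional that implements it restores
   centrality.

   (i) => (ii): D : A -> X^* twists the sum of X and of Y1 = (A_+, p)^*, the
   Banach dual of A_+ for a submultiplicative seminorm p, into an extension of X
   by Y1.  Evaluation at 1 is central on Y1, and the restriction to X of a
   central extension implements D.

   (ii) => (iii): a derivation into X^* is jointly bounded, |D(a)x| <= p(a) q(x),
   and since the topology of A is given by submultiplicative seminorms, q may be
   chosen compatible with the action.  Then D acts on the Banach bimodule
   (X, q)^**. *)
From HB Require Import structures.
Require Import Defs.
From mathcomp Require Import all_boot all_order all_algebra.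
From mathcomp Require Import all_classical all_reals all_analysis.
From mathcomp Require Import ring lra zify.

Set Implicit Arguments.
Unset Strict Implicit.
Unset Printing Implicit Defensive.

Import Order.TTheory GRing.Theory Num.Theory.
Import numFieldNormedType.Exports.

Local Open Scope classical_set_scope.
Local Open Scope complex_scope.
Local Open Scope ring_scope.

(** Flatness speaks of quotients of completed tensor products, derivations only of functionals on
    them, and the work lies in passing between the two. That functionals extend gives injectivity on
    the quotients; exactness in the middle needs a closed range as well, which uniform boundedness
    supplies. Conversely, exactness gives a closed range, and the open mapping theorem has to turn
    it into an embedding before Hahn-Banach can extend anything. The quotients themselves are never
    formed: seminorms and functionals relative to a subspace replace them.

    Flatness quantifies over all realizations of the tensor products and of the enveloping algebra.
    Proving amenability means handling arbitrary ones through their universal property; using it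
    means constructing some.

    In (ii) => (iii) the seminormed space (X, q) need be neither Hausdorff nor complete. Duals are
    both, and the bidual receives a bimodule map from X along which an implementing functional can
    be pulled back. *)

Section ComplexModulus.
Variable R : realType.
Implicit Types z t : R[i].

(** The norm of [R[i]] has values in [R[i]]; estimates are carried out in the ordered field [R],
    where infima exist and linear arithmetic applies. *)
Definition cabs z : R := complex.Re `|z|.

Lemma cabsE z : `|z| = (cabs z)%:C.
Proof. by rewrite /cabs normc_def. Qed.

Lemma cabs_ge0 z : 0 <= cabs z.
Proof. by rewrite -ler0c -cabsE. Qed.

Lemma cabsM z t : cabs (z * t) = cabs z * cabs t.
Proof. by apply: complexI; rewrite rmorphM /= -!cabsE normrM. Qed.

Lemma cabsD z t : cabs (z + t) <= cabs z + cabs t.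
Proof. by rewrite -lecR rmorphD /= -!cabsE ler_normD. Qed.

Lemma cabsN z : cabs (- z) = cabs z.
Proof. by rewrite /cabs normrN. Qed.

Lemma cabs0 : cabs 0 = 0.
Proof. by rewrite /cabs normr0. Qed.

Lemma cabs1 : cabs 1 = 1.
Proof. by rewrite /cabs normr1. Qed.

Lemma cabs0_eq0 z : cabs z = 0 -> z = 0.
Proof. by move=> z0; apply/eqP; rewrite -normr_eq0 cabsE z0. Qed.

Lemma cabs_gt0 z : (0 < cabs z) = (z != 0).
Proof.
rewrite lt_neqAle cabs_ge0 andbT eq_sym; congr (~~ _).
by apply/eqP/eqP => [/cabs0_eq0|->]; rewrite ?cabs0.
Qed.

Lemma cabs_real (x : R) : 0 <= x -> cabs x%:C = x.
Proof. by move=> x0; apply: complexI; rewrite -cabsE ger0_norm // ler0c. Qed.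

Lemma cabsV z : cabs z^-1 = (cabs z)^-1.
Proof. by apply: complexI; rewrite fmorphV /= -!cabsE normfV. Qed.

Lemma ler_Re_cabs z : complex.Re z <= cabs z.
Proof.
by rewrite -lecR -cabsE; apply: le_trans (normc_ge_Re z); rewrite lecR ler_norm.
Qed.

Lemma ltcR_cabs z (e : R) : (`|z| < e%:C) = (cabs z < e).
Proof. by rewrite cabsE ltcR. Qed.

Lemma gt0c_real (e : R[i]) : 0 < e -> exists2 r : R, 0 < r & e = r%:C.
Proof.
move=> e0; have er : e \is Num.real by rewrite realE ltW.
by exists (complex.Re e); rewrite -?ltcR RRe_real.
Qed.

End ComplexModulus.

(** * Unbundled linear maps *)

Section LinearPredicate.
Variables (K : pzRingType) (U V : lmodType K) (f : U -> V).
Hypothesis lf : linear f.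

Lemma lin0 : f 0 = 0.
Proof. by have := lf (-1) 0 0; rewrite scaler0 addr0 scaleN1r addNr. Qed.

Lemma linD x y : f (x + y) = f x + f y.
Proof. by rewrite -{1}[x]scale1r lf scale1r. Qed.

Lemma linZ a x : f (a *: x) = a *: f x.
Proof. by rewrite -{1}[a *: x]addr0 lf lin0 addr0. Qed.

Lemma linN x : f (- x) = - f x.
Proof. by rewrite -scaleN1r linZ scaleN1r. Qed.

Lemma linB x y : f (x - y) = f x - f y.
Proof. by rewrite linD linN. Qed.

Lemma lin_sum n (F : 'I_n -> U) : f (\sum_(i < n) F i) = \sum_(i < n) f (F i).
Proof.
by elim: n F => [|n ih] F; rewrite ?big_ord0 ?lin0 // !big_ord_recr /= linD ih.
Qed.

End LinearPredicate.

Lemma linearP_DZ (K : pzRingType) (U V : lmodType K) (f : U -> V) :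
  (forall x y, f (x + y) = f x + f y) -> (forall a x, f (a *: x) = a *: f x) ->
  linear f.
Proof. by move=> fD fZ a x y; rewrite fD fZ. Qed.

(** * Seminorms *)

Section Seminorms.
Variables (R : realType) (V : lmodType R[i]).

Definition seminorm (p : V -> R) : Prop :=
  (forall x y, p (x + y) <= p x + p y) /\
  (forall t x, p (t *: x) = cabs t * p x).

Variable p : V -> R.
Hypothesis hp : seminorm p.

Lemma seminorm0 : p 0 = 0.
Proof. by rewrite -(scale0r (0 : V)) hp.2 cabs0 mul0r. Qed.

Lemma seminormN x : p (- x) = p x.
Proof. by rewrite -scaleN1r hp.2 cabsN cabs1 mul1r. Qed.

Lemma seminorm_ge0 x : 0 <= p x.
Proof.
have := hp.1 x (- x); rewrite subrr seminorm0 seminormN; lra.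
Qed.

Lemma seminormB x y : p (x - y) <= p x + p y.
Proof. by rewrite -(seminormN y); exact: hp.1. Qed.

Lemma seminorm_distC x y : p (x - y) = p (y - x).
Proof. by rewrite -seminormN opprB. Qed.

Lemma seminorm_dist_trans z x y : p (x - y) <= p (x - z) + p (z - y).
Proof. by rewrite -[x - y](subrKA z); exact: hp.1. Qed.

Lemma seminorm_scale_real (a : R) x : 0 <= a -> p (a%:C *: x) = a * p x.
Proof. by move=> a0; rewrite hp.2 cabs_real. Qed.

Lemma seminorm_sum n (F : 'I_n -> V) : p (\sum_(i < n) F i) <= \sum_(i < n) p (F i).
Proof.
elim: n F => [|n ih] F; first by rewrite !big_ord0 seminorm0.
by rewrite !big_ord_recr /=; apply: le_trans (hp.1 _ _) _; rewrite lerD2r.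
Qed.

End Seminorms.

Section SeminormConstructions.
Variables (R : realType) (V W : lmodType R[i]).

Lemma seminorm_comp (q : W -> R) (f : V -> W) :
  seminorm q -> linear f -> seminorm (q \o f).
Proof.
by move=> [qD qZ] lf; split=> [x y|t x] /=; rewrite ?(linD lf) ?(linZ lf).
Qed.

Lemma seminormD (p q : V -> R) :
  seminorm p -> seminorm q -> seminorm (fun x => p x + q x).
Proof.
move=> [pD pZ] [qD qZ]; split=> [x y|t x]; last by rewrite pZ qZ mulrDr.
by rewrite addrACA lerD.
Qed.

Lemma seminormZ (c : R) (p : V -> R) :
  0 <= c -> seminorm p -> seminorm (fun x => c * p x).
Proof.
move=> c0 [pD pZ]; split=> [x y|t x]; last by rewrite pZ mulrCA.
by rewrite -mulrDr ler_wpM2l.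
Qed.

(** The reverse inequality is the hypothesis for [t^-1] at [t *: x]. Seminorms defined by infima
    naturally come with one inequality only. *)
Lemma seminorm_subhomogeneous (p : V -> R) :
  (forall x, 0 <= p x) -> (forall x y, p (x + y) <= p x + p y) ->
  (forall t x, p (t *: x) <= cabs t * p x) -> seminorm p.
Proof.
move=> p_ge0 pD pZ; split=> // t x; apply/eqP; rewrite eq_le pZ /=.
have [->|t0] := eqVneq t 0; first by rewrite cabs0 mul0r.
have := pZ t^-1 (t *: x); rewrite scalerA mulVf// scale1r cabsV.
by rewrite -ler_pdivrMl ?invrK// invr_gt0 cabs_gt0.
Qed.

(** If [q x < p x], then [x] divided by [p x] has [q]-value below 1 but [p]-value 1. *)
Lemma seminorm_le_scale (p q : V -> R) :
    seminorm p -> seminorm q -> (forall x, q x < 1 -> p x < 1) ->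
  forall x, p x <= q x.
Proof.
move=> hp hq pq x; rewrite leNgt; apply/negP => lt_qp.
have p0 : 0 < p x by apply: le_lt_trans lt_qp; exact: seminorm_ge0.
have := pq ((p x)^-1%:C *: x).
rewrite !seminorm_scale_real ?invr_ge0 ?(ltW p0)// mulVf ?gt_eqF// ltxx.
by rewrite mulrC ltr_pdivrMr// mul1r => /(_ lt_qp).
Qed.

End SeminormConstructions.

Lemma seminorm_cabs (R : realType) : seminorm (@cabs R : R[i]^o -> R).
Proof. by split; [exact: cabsD | exact: cabsM]. Qed.

Lemma cabs_nbhs0 (R : realType) (e : R) : 0 < e ->
  nbhs (0 : R[i]^o) [set z | cabs z < e].
Proof.
move=> e0; apply/nbhs_ballP; exists e%:C; first by rewrite /= ltcR.
by move=> z; rewrite /ball /= sub0r normrN ltcR_cabs.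
Qed.

Lemma nbhs0_cabs (R : realType) (U : set R[i]^o) : nbhs (0 : R[i]^o) U ->
  exists2 e, 0 < e & forall z, cabs z < e -> U z.
Proof.
move=> /nbhs_ballP[e0 /= /gt0c_real[e e_gt0 ->] eU]; exists e => // z ze.
by apply: eU; rewrite /ball /= sub0r normrN ltcR_cabs.
Qed.

(** * Continuous seminorms as a description of the topology *)

Section ContinuousSeminorms.
Variables (R : realType) (V : tvsType R[i]).
Implicit Types (p q : V -> R) (U : set V).

(* [csn] stands for continuous seminorm. *)
Definition csn p := seminorm p /\ forall e, 0 < e -> nbhs 0 [set x | p x < e].

Lemma csn_seminorm p : csn p -> seminorm p. Proof. by case. Qed.

Lemma csnD p q : csn p -> csn q -> csn (fun x => p x + q x).
Proof.
move=> [sp np] [sq nq]; split=> [|e e0]; first exact: seminormD.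
have e20 : 0 < e / 2 by rewrite divr_gt0.
apply: filterS (filterI (np _ e20) (nq _ e20)) => x [/= px qx]; lra.
Qed.

Lemma csnZ (c : R) p : 0 <= c -> csn p -> csn (fun x => c * p x).
Proof.
move=> c0 [sp np]; split=> [|e e0]; first exact: seminormZ.
have c1 : 0 < c + 1 by lra.
apply: filterS (np _ (divr_gt0 e0 c1)) => x /=; rewrite ltr_pdivlMr// => pe.
have := seminorm_ge0 sp x; nra.
Qed.

Lemma csn_le p q : seminorm p -> csn q -> (forall x, p x <= q x) -> csn p.
Proof.
move=> sp [_ nq] pq; split=> // e e0; apply: filterS (nq _ e0) => x.
exact: le_lt_trans.
Qed.

Lemma csn0 : csn (fun=> 0).
Proof.
split; first by split=> [x y|t x]; rewrite ?addr0 ?mulr0.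
by move=> e e0; apply: filterS filterT.
Qed.

Lemma csn_sum (q : nat -> V -> R) n : (forall i, csn (q i)) ->
  csn (fun x => \sum_(i < n) q i x).
Proof.
move=> cq; elim: n => [|n ih].
  by under eq_fun do rewrite big_ord0; exact: csn0.
by under eq_fun do rewrite big_ord_recr /=; exact: csnD.
Qed.

Lemma convex_set_real (U : set V) (a : R) x y : convex_set U -> U x -> U y ->
  0 <= a -> a <= 1 -> U (a%:C *: x + (1 - a)%:C *: y).
Proof.
move=> cU Ux Uy a0 a1.
have a0' : 0 <= a%:C :> R[i] by rewrite lecR.
have a1' : a%:C <= 1 :> R[i] by rewrite -(lecR a 1) in a1.
have := cU x y (Itv01 a0' a1') (mem_set Ux) (mem_set Uy).
by move=> /set_mem; rewrite rmorphB rmorph1.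
Qed.

(* The gauge of the circled core of a convex neighbourhood inside [U]. *)
Lemma csn_gauge U : nbhs 0 U -> exists2 p, csn p & forall x, p x < 1 -> U x.
Proof.
move=> U0.
have [B cB [oB bB]] := @locally_convex R[i] V.
have [N [BN N0] NU] := bB 0 U U0.
have {}cB : convex_set N by apply: cB; rewrite inE.
have {}N0 : nbhs 0 N by apply: open_nbhs_nbhs; split => //; exact: oB.
pose W : set V := [set x | forall t, cabs t <= 1 -> N (t *: x)].
have WN x : W x -> N x by move=> /(_ 1); rewrite cabs1 scale1r; exact.
have Wbal t x : cabs t <= 1 -> W x -> W (t *: x).
  move=> t1 Wx s s1; rewrite scalerA; apply: Wx; rewrite cabsM.
  by rewrite mulr_ile1 // cabs_ge0.
have Wcvx a x y : W x -> W y -> 0 <= a -> a <= 1 ->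
    W (a%:C *: x + (1 - a)%:C *: y).
  move=> Wx Wy a0 a1 t t1; rewrite scalerDr !scalerA ![t * _]mulrC -!scalerA.
  by apply: convex_set_real => //; [exact: Wx|exact: Wy].
(* Continuity of scaling at (0, 0) gives a disc of radius [d] and a neighbourhood [M] whose product
   lies in [N]; then the multiple of [M] by [d / 2] lies in [W]. *)
have W0 : nbhs 0 W.
  have := @scale_continuous _ V (0, 0) N; rewrite /= scaler0 => /(_ N0).
  move=> [[S M] /= [S0 M0] SM].
  have [d d0 dS] := nbhs0_cabs S0.
  have d20 : (d / 2)%:C != 0 :> R[i].
    by apply/eqP => /complexI; lra.
  apply: filterS (nbhs0Z d20 M0) => x [m Mm <-] t t1; rewrite scalerA.
  apply: (SM (_, _)); split => //=; apply: dS.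
  rewrite cabsM cabs_real; last lra.
  have := cabs_ge0 t; nra.
pose S x := [set s : R | 0 < s /\ W (s^-1%:C *: x)].
pose p x := inf (S x).
have lbS x : has_lbound (S x) by exists 0 => s [/ltW].
have absorb x : S x !=set0.
  have := @scale_continuous _ V (0, x) W; rewrite /= scale0r => /(_ W0).
  move=> [[A M] /= [A0 M0] AM].
  have [d d0 dA] := nbhs0_cabs A0.
  exists (d / 2)^-1; split; first by rewrite invr_gt0 divr_gt0.
  rewrite invrK; apply: (AM (_, _)); split => /=; last exact: nbhs_singleton.
  by apply: dA; rewrite cabs_real; lra.
have Sup x s s' : S x s -> s <= s' -> S x s'.
  move=> [s0 Ws] ss'; have s'0 : 0 < s' by exact: lt_le_trans ss'.
  split=> //; have -> : s'^-1%:C *: x = (s / s')%:C *: (s^-1%:C *: x).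
    by rewrite scalerA -rmorphM mulrAC divff ?gt_eqF// mul1r.
  apply: Wbal => //; rewrite cabs_real; last by rewrite divr_ge0 // ltW.
  by rewrite ler_pdivrMr// mul1r.
have p_lt x e : p x < e -> S x e.
  by move=> /(inf_lt (absorb x))[s Ss /ltW]; exact: Sup.
have p_le x s : S x s -> p x <= s by move=> Ss; exact: ge_inf.
have p_ge0 x : 0 <= p x by apply: lb_le_inf => // s [/ltW].
have pD x y : p (x + y) <= p x + p y.
  apply/ler_addgt0Pr => e e0.
  have /p_lt[s0 Ws] : p x < p x + e / 2 by lra.
  have /p_lt[t0 Wt] : p y < p y + e / 2 by lra.
  set s := p x + e / 2 in s0 Ws; set t := p y + e / 2 in t0 Wt.
  have -> : p x + p y + e = s + t by rewrite /s /t; field.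
  have st0 : 0 < s + t by lra.
  apply: p_le; split=> //.
  have -> : (s + t)^-1%:C *: (x + y) = (s / (s + t))%:C *: (s^-1%:C *: x) +
      (1 - s / (s + t))%:C *: (t^-1%:C *: y).
    rewrite scalerDr !scalerA -!rmorphM; congr (_%:C *: _ + _%:C *: _); field;
    by rewrite !gt_eqF.
  apply: Wcvx => //; first by rewrite divr_ge0 // ltW.
  by rewrite ler_pdivrMr// mul1r; lra.
have pZle t x : p (t *: x) <= cabs t * p x.
  apply/ler_addgt0Pr => e e0.
  have t1 : 0 < cabs t + 1 by have := cabs_ge0 t; lra.
  have d0 : 0 < e / (cabs t + 1) by rewrite divr_gt0.
  have /p_lt[s0 Ws] : p x < p x + e / (cabs t + 1) by lra.
  set s := p x + _ in s0 Ws.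
  have sE : cabs t * s <= cabs t * p x + e.
    rewrite /s mulrDr lerD2l mulrCA ger_pMr// ler_pdivrMr// mul1r; lra.
  have [->|tn0] := eqVneq t 0.
    rewrite cabs0 mul0r add0r; apply: p_le; split=> //; rewrite scale0r scaler0.
    exact: nbhs_singleton.
  have ct0 : 0 < cabs t by rewrite cabs_gt0.
  apply: le_trans sE; apply: p_le; split; first exact: mulr_gt0.
  have -> : (cabs t * s)^-1%:C *: (t *: x) = (t / (cabs t)%:C) *: (s^-1%:C *: x).
    by rewrite !scalerA invfM rmorphM !fmorphV /= mulrAC (mulrC t).
  apply: Wbal => //; rewrite cabsM -fmorphV cabs_real ?invr_ge0 ?cabs_ge0//.
  by rewrite divff // gt_eqF.
have sp : seminorm p by exact: seminorm_subhomogeneous.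
exists p; last first.
  move=> x /p_lt[_]; rewrite invr1 scale1r => /WN; exact: NU.
split=> // e e0.
have e20 : (e / 2)%:C != 0 :> R[i] by apply/eqP => /complexI; lra.
apply: filterS (nbhs0Z e20 W0) => _ [y Wy <-] /=.
rewrite (seminorm_scale_real sp); last lra.
suff : p y <= 1 by nra.
by apply: p_le; split=> //; rewrite invr1 scale1r.
Qed.

Lemma nbhs_csn x U : nbhs x U <->
  exists2 p, csn p & forall y, p (y - x) < 1 -> U y.
Proof.
split=> [Ux|[p [sp np] pU]].
  have := nbhsB (- x) Ux; rewrite addNr => /csn_gauge[p cp pU].
  by exists p => // y /pU[z Uz]; rewrite addrC => /addIr <-.
have := nbhsT x (np 1 ltr01); apply: filterS => y [z /= pz <-].
by apply: pU; rewrite addrC addKr.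
Qed.

End ContinuousSeminorms.

(** Since [p1 x] or [p2 y] may vanish, [x] and [y] are divided by slightly larger numbers, which
    then decrease to [p1 x] and [p2 y]. *)
Lemma bilinear_seminorm_scale (R : realType) (U V W : lmodType R[i])
    (b : U -> V -> W) (p1 : U -> R) (p2 : V -> R) (q : W -> R) :
  bilinear_map b -> seminorm p1 -> seminorm p2 -> seminorm q ->
  (forall x y, p1 x < 1 -> p2 y < 1 -> q (b x y) <= 1) ->
  forall x y, q (b x y) <= p1 x * p2 y.
Proof.
move=> [lb lb'] s1 s2 sq hb x y.
have key d e : p1 x < d -> p2 y < e -> q (b x y) <= d * e.
  move=> d1 e2.
  have d0 : 0 < d by apply: le_lt_trans d1; exact: seminorm_ge0.
  have e0 : 0 < e by apply: le_lt_trans e2; exact: seminorm_ge0.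
  have : q (b (d^-1%:C *: x) (e^-1%:C *: y)) <= 1.
    apply: hb.
      rewrite (seminorm_scale_real s1) ?invr_ge0 ?ltW//.
      by rewrite mulrC ltr_pdivrMr// mul1r.
    rewrite (seminorm_scale_real s2) ?invr_ge0 ?ltW//.
    by rewrite mulrC ltr_pdivrMr// mul1r.
  rewrite (linZ (lb _)) (linZ (lb' _)).
  rewrite !(seminorm_scale_real sq) ?invr_ge0 ?(ltW d0) ?(ltW e0)//.
  by rewrite mulrA -invfM mulrC ler_pdivrMr ?mulr_gt0// mul1r mulrC.
have p10 := seminorm_ge0 s1 x; have p20 := seminorm_ge0 s2 y.
apply/ler_addgt0Pr => e e0.
set M := p1 x + p2 y + 1.
have M0 : 0 < M by rewrite /M; lra.
(* From [d <= 1] and [d * M <= e], the product of [p1 x + d] and [p2 y + d] exceeds [p1 x * p2 y] by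
   at most [d * M <= e]. *)
pose d := Num.min 1 (e / M).
have d0 : 0 < d by rewrite lt_min ltr01 divr_gt0.
apply: le_trans (key (p1 x + d) (p2 y + d) _ _) _; try lra.
have d1 : d <= 1 by rewrite /d ge_min lexx.
have dM : d * M <= e by rewrite -ler_pdivlMr// /d ge_min lexx orbT.
rewrite /M in dM; nra.
Qed.

Section SeminormContinuity.
Variables (R : realType) (U V W : tvsType R[i]).

Lemma csn_comp (q : W -> R) (f : V -> W) :
  csn q -> linear f -> continuous f -> csn (q \o f).
Proof.
move=> [sq nq] lf cf; split=> [|e e0]; first exact: seminorm_comp.
by have := cf 0 [set y | q y < e]; rewrite (lin0 lf); apply; exact: nq.
Qed.

Lemma linear_continuous_csn (f : V -> W) : linear f ->
  (forall q, csn q -> exists2 p, csn p & forall x, q (f x) <= p x) ->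
  continuous f.
Proof.
move=> lf qf x A /nbhs_csn[q cq qA].
have [p cp qp] := qf q cq.
apply/nbhs_csn; exists p => // y py; apply: qA; rewrite -(linB lf).
exact: le_lt_trans py.
Qed.

Lemma bilinear_csn (b : U -> V -> W) : bilinear_map b -> jointly_continuous b ->
  forall q, csn q -> exists p1 p2, [/\ csn p1, csn p2
    & forall x y, q (b x y) <= p1 x * p2 y].
Proof.
move=> bb cb q [sq nq]; have [lb _] := bb.
have := cb (0, 0) [set z | q z < 1]; rewrite /= (lin0 (lb 0)) => /(_ (nq _ ltr01)).
move=> [[A B] /= [/csn_gauge[p1 c1 p1A] /csn_gauge[p2 c2 p2B]] AB].
exists p1, p2; split=> //; apply: bilinear_seminorm_scale => // [||x y px py].
- exact: csn_seminorm c1.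
- exact: csn_seminorm c2.
by apply/ltW/(AB (x, y)); split=> /=; [exact: p1A | exact: p2B].
Qed.

Lemma bilinear_continuous_csn (b : U -> V -> W) : bilinear_map b ->
  (forall q, csn q -> exists p1 p2, [/\ csn p1, csn p2
     & forall x y, q (b x y) <= p1 x * p2 y]) -> jointly_continuous b.
Proof.
move=> [lb lb'] hb [x0 y0] A /= /nbhs_csn[q cq qA].
have [p1 [p2 [c1 c2 qb]]] := hb q cq.
have s1 := csn_seminorm c1; have s2 := csn_seminorm c2.
have sq := csn_seminorm cq.
(* For [a] and [c] below [M^-1], where [M >= 1], the three error terms [a * c], [a * p2 y0] and
   [p1 x0 * c] add up to less than 1. *)
set M := p1 x0 + p2 y0 + 1.
have p10 := seminorm_ge0 s1 x0; have p20 := seminorm_ge0 s2 y0.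
have M0 : 0 < M by rewrite /M; lra.
exists ([set x | M * p1 (x - x0) < 1], [set y | M * p2 (y - y0) < 1]).
  split; apply/nbhs_csn.
    by exists (fun x => M * p1 x) => //; apply: csnZ => //; exact: ltW.
  by exists (fun x => M * p2 x) => //; apply: csnZ => //; exact: ltW.
move=> [x y] /= [xx0 yy0]; apply: qA.
have -> : b x y - b x0 y0 = b (x - x0) (y - y0) + (b (x - x0) y0 + b x0 (y - y0)).
  rewrite !(linB (lb _)) !(linB (lb' _)).
  by rewrite !subrKA.
apply: le_lt_trans (sq.1 _ _) _.
have := sq.1 (b (x - x0) y0) (b x0 (y - y0)).
have := qb (x - x0) (y - y0); have := qb (x - x0) y0; have := qb x0 (y - y0).
have := seminorm_ge0 s1 (x - x0); have := seminorm_ge0 s2 (y - y0).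
move: (p1 (x - x0)) (p2 (y - y0)) xx0 yy0 => a c Ma Mc c0 a0 h1 h2 h3 h4.
apply: le_lt_trans (_ : _ <= a * c + (a * p2 y0 + p1 x0 * c)) _; first lra.
rewrite /M in Ma Mc *; nra.
Qed.

Lemma bilinear_linear_l (b : U -> V -> W) x : bilinear_map b -> linear (b x).
Proof. by case. Qed.

Lemma bilinear_linear_r (b : U -> V -> W) y : bilinear_map b -> linear (b^~ y).
Proof. by case. Qed.

Lemma bilinear_continuous_l (b : U -> V -> W) x :
  jointly_continuous b -> continuous (b x).
Proof.
move=> cb y; apply: (@continuous_comp _ _ _ (fun y => (x, y)) (fun z => b z.1 z.2)).
  by apply: cvg_pair => /=; [exact: cvg_cst|exact: cvg_id].
exact: cb.
Qed.

Lemma bilinear_continuous_r (b : U -> V -> W) y :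
  jointly_continuous b -> continuous (b^~ y).
Proof.
move=> cb x; apply: (@continuous_comp _ _ _ (fun x => (x, y)) (fun z => b z.1 z.2)).
  by apply: cvg_pair => /=; [exact: cvg_id|exact: cvg_cst].
exact: cb.
Qed.

End SeminormContinuity.

Section DualFunctionals.
Variables (R : realType) (V : tvsType R[i]).

Lemma csn_cabs : csn (@cabs R : R[i]^o -> R).
Proof. by split=> [|e e0]; [exact: seminorm_cabs|exact: cabs_nbhs0]. Qed.

Lemma csn_scalar (q : R[i]^o -> R) : csn q -> forall z, q z = q 1 * cabs z.
Proof. by move=> [[_ qZ] _] z; rewrite mulrC -qZ /GRing.scale /= mulr1. Qed.

Lemma dual_csn (f : V -> R[i]^o) : dual V f -> csn (fun x => cabs (f x)).
Proof. by move=> [lf cf]; exact: (csn_comp csn_cabs). Qed.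

Lemma csn_dual (f : V -> R[i]^o) (p : V -> R) : linear f -> csn p ->
  (forall x, cabs (f x) <= p x) -> dual V f.
Proof.
move=> lf cp fp; split=> //; apply: linear_continuous_csn => // q cq.
have q1 : 0 <= q 1 by exact: seminorm_ge0 (csn_seminorm cq) _.
exists (fun x => q 1 * p x); first exact: csnZ.
by move=> x; rewrite (csn_scalar cq) ler_wpM2l.
Qed.

End DualFunctionals.

(** * Subspaces and their closures *)

Section Subspaces.
Variables (R : realType) (V : lmodType R[i]).
Implicit Types (S N : set V).

Definition subspace N := N 0 /\ forall a x y, N x -> N y -> N (a *: x + y).

Lemma subspaceD N x y : subspace N -> N x -> N y -> N (x + y).
Proof. by move=> sN Nx Ny; rewrite -[x]scale1r; exact: sN.2. Qed.

Lemma subspaceZ N a x : subspace N -> N x -> N (a *: x).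
Proof. by move=> sN Nx; rewrite -[_ *: _]addr0; apply: sN.2 => //; exact: sN.1. Qed.

Lemma subspaceN N x : subspace N -> N x -> N (- x).
Proof. by move=> sN Nx; rewrite -scaleN1r; exact: subspaceZ. Qed.

Lemma subspaceB N x y : subspace N -> N x -> N y -> N (x - y).
Proof. by move=> sN Nx Ny; apply: subspaceD => //; exact: subspaceN. Qed.

Lemma subspace_sum N n (F : 'I_n -> V) :
  subspace N -> (forall i, N (F i)) -> N (\sum_(i < n) F i).
Proof.
move=> sN; elim: n F => [|n ih] F NF; first by rewrite big_ord0; exact: sN.1.
by rewrite big_ord_recr /=; apply: subspaceD => //; exact: ih.
Qed.

Lemma subspace_linear_span S : subspace (linear_span S).
Proof.
split=> [|a x y [n [c [w [Sw ->]]]] [m [d [v [Sv ->]]]]].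
  by exists 0%N, (fun=> 0), (fun=> 0); split=> [[]|]; rewrite ?big_ord0.
exists (n + m)%N, (fun i => match fintype.split i with inl j => a * c j | inr j => d j end),
  (fun i => match fintype.split i with inl j => w j | inr j => v j end); split.
  by move=> i; case: (fintype.split i).
rewrite big_split_ord scaler_sumr; congr (_ + _); apply: eq_bigr => i _ /=.
  by rewrite (unsplitK (inl i)) scalerA.
by rewrite (unsplitK (inr i)).
Qed.

Lemma sub_linear_span S : S `<=` linear_span S.
Proof.
move=> x Sx; exists 1%N, (fun=> 1), (fun=> x).
by rewrite big_ord1 scale1r.
Qed.

Lemma linear_span_min S N : subspace N -> S `<=` N -> linear_span S `<=` N.
Proof.
move=> sN SN x [n [c [w [Sw ->]]]]; apply: subspace_sum => // i.
by apply: subspaceZ => //; exact: SN.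
Qed.

End Subspaces.

Section Closures.
Variables (R : realType) (V : tvsType R[i]).
Implicit Types (S N : set V).

Lemma closure_csn S x : closure S x <->
  forall p e, csn p -> 0 < e -> exists2 y, S y & p (x - y) < e.
Proof.
split=> [clS p e cp e0|h B /nbhs_csn[p cp pB]].
  have /clS[y [Sy py]] : nbhs x [set y | e^-1 * p (y - x) < 1].
    apply/nbhs_csn; exists (fun y => e^-1 * p y) => //.
    by apply: csnZ => //; rewrite invr_ge0 ltW.
  exists y => //; rewrite (seminorm_distC (csn_seminorm cp)).
  by move: py; rewrite /= mulrC ltr_pdivrMr// mul1r.
have [y Sy py] := h p 1 cp ltr01; exists y; split=> //; apply: pB.
by rewrite (seminorm_distC (csn_seminorm cp)).
Qed.

Lemma hausdorff_csnP : hausdorff_space V <->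
  forall x : V, (forall p, csn p -> p x = 0) -> x = 0.
Proof.
split=> [hV x px|h x y clxy].
  apply/esym/hV => A B A0 /nbhs_csn[p cp pB]; exists 0; split.
    exact: nbhs_singleton.
  by apply: pB; rewrite sub0r (seminormN (csn_seminorm cp)) px.
apply/eqP; rewrite -subr_eq0; apply/eqP/h => p cp.
have sp := csn_seminorm cp.
apply/eqP; rewrite eq_le seminorm_ge0// andbT; apply/ler_addgt0Pr => e e0; rewrite add0r.
have cp2 : csn (fun z => (e / 2)^-1 * p z).
  by apply: csnZ => //; rewrite invr_ge0 divr_ge0 // ltW.
have [||z [/= xz yz]] := clxy [set z | (e / 2)^-1 * p (z - x) < 1]
    [set z | (e / 2)^-1 * p (z - y) < 1].
- by apply/nbhs_csn; exists (fun z => (e / 2)^-1 * p z).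
- by apply/nbhs_csn; exists (fun z => (e / 2)^-1 * p z).
have e20 : 0 < e / 2 by rewrite divr_gt0.
move: xz yz; rewrite !(mulrC (e / 2)^-1) !ltr_pdivrMr// mul1r => xz yz.
have := seminorm_dist_trans sp z x y; rewrite (seminorm_distC sp x z); lra.
Qed.

Lemma subspace_closure N : subspace N -> subspace (closure N).
Proof.
move=> sN; split=> [|a x y /closure_csn cx /closure_csn cy].
  by apply: subset_closure; exact: sN.1.
apply/closure_csn => p e cp e0; have sp := csn_seminorm cp.
have a0 := cabs_ge0 a.
have [||x' Nx' px] := cx p (e / 2 / (cabs a + 1)) => //.
  by rewrite !divr_gt0 //; lra.
have [||y' Ny' py] := cy p (e / 2) => //; first by rewrite divr_gt0.
exists (a *: x' + y'); first exact: sN.2.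
rewrite opprD addrACA -scalerBr; apply: le_lt_trans (sp.1 _ _) _.
rewrite sp.2; suff : cabs a * p (x - x') <= e / 2 by lra.
move: px; rewrite ltr_pdivlMr; last lra.
have := seminorm_ge0 sp (x - x'); nra.
Qed.

Lemma closure_min_dual N (f : V -> R[i]^o) x : dual V f ->
  (forall y, N y -> f y = 0) -> closure N x -> f x = 0.
Proof.
move=> df fN /closure_csn clx; apply/cabs0_eq0/eqP.
rewrite eq_le cabs_ge0 andbT; apply/ler_addgt0Pr => e e0; rewrite add0r.
have [y Ny] := clx _ _ (dual_csn df) e0.
by rewrite (linB df.1) (fN y) // subr0 => /ltW.
Qed.

End Closures.

(** * The Hahn-Banach theorem *)

Section HahnBanach.
Variables (R : realType) (V : lmodType R[i]) (p : V -> R).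
Hypothesis sp : seminorm p.
Implicit Types g : set (V * R).

(* Graphs of real-linear functionals on real subspaces of [V], dominated by [p]. *)
Definition dominated_graph g :=
  (forall a b x r y s, g (x, r) -> g (y, s) ->
     g (a%:C *: x + b%:C *: y, a * r + b * s)) /\
  (forall x r, g (x, r) -> r <= p x).

Lemma dominated_graph_fun g x r s :
  dominated_graph g -> g (x, r) -> g (x, s) -> r = s.
Proof.
move=> [gl gp] xr xs.
have := gp _ _ (gl 1 (-1) _ _ _ _ xr xs); have := gp _ _ (gl (-1) 1 _ _ _ _ xr xs).
rewrite !rmorphN !rmorph1 !scaleN1r !scale1r subrr addNr (seminorm0 sp); lra.
Qed.

(** The value [c] at [x0] has to lie above all [r - p (x - x0)] and below all [p (y + x0) - s], for
    [(x, r)] and [(y, s)] in [g]. The triangle inequality separates the two families, and [c] is the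
    supremum of the first. *)
Lemma dominated_graph_extend g x0 : dominated_graph g -> g (0, 0) ->
  exists2 h, dominated_graph h & g `<=` h /\ exists c, h (x0, c).
Proof.
move=> [gl gp] g0.
pose L := [set l : R | exists x r, g (x, r) /\ l = r - p (x - x0)].
have Lub y s : g (y, s) -> ubound L (p (y + x0) - s).
  move=> gys _ [x [r [gxr ->]]].
  have := gp _ _ (gl 1 1 _ _ _ _ gxr gys); rewrite !rmorph1 !scale1r !mul1r.
  have := sp.1 (x - x0) (y + x0); rewrite addrACA addNr addr0; lra.
have L0 : L !=set0 by exists (0 - p (0 - x0)), 0, 0.
have Lsup : has_sup L by split=> //; exists (p (0 + x0) - 0); exact: Lub.
set c := sup L.
have c_ge x r : g (x, r) -> r - p (x - x0) <= c.
  by move=> gxr; apply: sup_upper_bound => //; exists x, r.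
have c_le y s : g (y, s) -> c <= p (y + x0) - s.
  by move=> gys; apply: ge_sup => //; exact: Lub.
have gZ a x r : g (x, r) -> g (a%:C *: x, a * r).
  by move=> gxr; have := gl a 0 _ _ _ _ gxr g0; rewrite scaler0 mulr0 !addr0.
exists [set z | exists x r t, [/\ g (x, r), z.1 = x + t%:C *: x0 & z.2 = r + t * c]].
  split=> [a b x r y s|z w].
    move=> [x1 [r1 [t1 [g1 /= -> ->]]]] [x2 [r2 [t2 [g2 /= -> ->]]]].
    exists (a%:C *: x1 + b%:C *: x2), (a * r1 + b * r2), (a * t1 + b * t2).
    split; [exact: gl| |by ring].
    by rewrite /= !scalerDr !scalerA -!rmorphM addrACA -scalerDl -rmorphD.
  move=> [x [r [t [gxr /= -> ->]]]].
  have [t0|t0|->] := ltgtP t 0; last by rewrite scale0r mul0r !addr0; exact: gp.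
    have tN : 0 < - t by lra.
    have := c_ge _ _ (gZ (- t)^-1 _ _ gxr).
    have -> : (- t)^-1%:C *: x - x0 = (- t)^-1%:C *: (x + t%:C *: x0).
      rewrite scalerDr scalerA -rmorphM invrN mulNr mulVf ?lt_eqF//.
      by congr (_ + _); rewrite rmorphN rmorph1 scaleN1r.
    rewrite (seminorm_scale_real sp); last by rewrite invr_ge0 ltW.
    by rewrite -mulrBr mulrC ler_pdivrMr//; nra.
  have := c_le _ _ (gZ t^-1 _ _ gxr).
  have -> : t^-1%:C *: x + x0 = t^-1%:C *: (x + t%:C *: x0).
    by rewrite scalerDr scalerA -rmorphM mulVf ?gt_eqF// scale1r.
  rewrite (seminorm_scale_real sp); last by rewrite invr_ge0 ltW.
  by rewrite -mulrBr mulrC ler_pdivlMr//; nra.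
split; first by move=> [x r] gxr; exists x, r, 0; rewrite scale0r mul0r !addr0.
by exists c, 0, 0, 1; rewrite scale1r mul1r !add0r.
Qed.

Lemma dominated_graph_total g0 : dominated_graph g0 -> g0 (0, 0) ->
  exists2 u : V -> R, (forall a b x y, u (a%:C *: x + b%:C *: y) = a * u x + b * u y)
    & (forall x, u x <= p x) /\ forall x r, g0 (x, r) -> u x = r.
Proof.
move=> dg0 g00.
(* Adjoining [g0] inside the predicate makes the empty chain admissible and forces the maximal graph
   to extend [g0]. *)
have [F FP Ftot|A [dA maxA]] :=
    @Zorn_bigcup (V * R)%type [set g | dominated_graph (g0 `|` g)].
  split=> [a b x r y s|x r]; last first.
    by move=> [g0x|[g Fg gx]]; [exact: dg0.2|apply: (FP g Fg).2; right].
  have sub g z : F g -> (g0 `|` g) z -> (g0 `|` \bigcup_(X in F) X) z.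
    by move=> Fg [g0z|gz]; [left|right; exists g].
  move=> [g0x|[g Fg gx]] [g0y|[h Fh hy]].
  - by left; exact: dg0.1.
  - by apply: (sub _ _ Fh); apply: (FP h Fh).1; [left|right].
  - by apply: (sub _ _ Fg); apply: (FP g Fg).1; [right|left].
  - have [gh|hg] := Ftot _ _ Fg Fh.
      by apply: (sub _ _ Fh); apply: (FP h Fh).1; right => //; exact: gh.
    by apply: (sub _ _ Fg); apply: (FP g Fg).1; right => //; exact: hg.
pose G := g0 `|` A.
have tot x : exists c, G (x, c).
  have [||h dh [Gh [c hc]]] := @dominated_graph_extend G x => //; first by left.
  apply: contrapT => /forallNP nG; apply: (maxA h) => /=.
    split; last by move=> hA; apply: (nG c); right; exact: hA.
    by move=> z Az; apply: Gh; right.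
  by rewrite (_ : _ `|` _ = h) //; apply/setUidPr => z g0z; apply: Gh; left.
have {}dA : dominated_graph G := dA.
have [u uG] := choice tot.
exists u => [a b x y|].
  by apply: (dominated_graph_fun dA (uG _)); exact: dA.1.
split=> [x|x r g0x]; first exact: dA.2.
by apply: (dominated_graph_fun dA (uG _)); left.
Qed.

(** The subspace is given as the range of [S], which may fail to be injective: the bound by [p \o S]
    makes [H] factor through that range. The real part [u] is extended first, and f x = u x - i u (i
    x) recovers the complex functional. *)
Theorem hahn_banach (T : lmodType R[i]) (S : T -> V) (H : T -> R[i]^o) :
  linear S -> linear H -> (forall v, cabs (H v) <= p (S v)) ->
  exists f : V -> R[i]^o,
    [/\ linear f, forall x, cabs (f x) <= p x & forall v, f (S v) = H v].
Proof.
move=> lS lH HS.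
have ReZ (a : R) (z : R[i]) : complex.Re (a%:C * z) = a * complex.Re z.
  by case: z => x y /=; rewrite mul0r subr0.
have ReD (z w : R[i]) : complex.Re (z + w) = complex.Re z + complex.Re w.
  by case: z w => [? ?] [? ?].
pose g0 := [set z : V * R | exists v, z = (S v, complex.Re (H v))].
have dg0 : dominated_graph g0.
  split=> [a b x r y s [v [-> ->]] [w [-> ->]]|x r [v [-> ->]]].
    exists (a%:C *: v + b%:C *: w).
    by rewrite !(linD lS, linD lH, linZ lS, linZ lH) ReD !ReZ.
  by apply: le_trans (HS v); exact: ler_Re_cabs.
have g00 : g0 (0, 0) by exists 0; rewrite (lin0 lS) (lin0 lH).
have [u ulin [up ug0]] := dominated_graph_total dg0 g00.
have uD x y : u (x + y) = u x + u y.
  by have := ulin 1 1 x y; rewrite rmorph1 !scale1r !mul1r.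
have uZ a x : u (a%:C *: x) = a * u x.
  by have := ulin a 0 x x; rewrite rmorph0 scale0r mul0r !addr0.
pose f x : R[i]^o := (u x +i* (- u ('i *: x)))%C.
have fD x y : f (x + y) = f x + f y.
  by rewrite /f scalerDr !uD opprD.
have fZr (a : R) x : f (a%:C *: x) = a%:C *: f x.
  rewrite /f scalerA [_ * a%:C]mulrC -scalerA !uZ.
  by rewrite /GRing.scale /=; apply/eqP; rewrite eq_complex /=; apply/andP; split;
    apply/eqP; ring.
have fi x : f ('i *: x) = 'i * f x.
  rewrite /f scalerA -expr2 sqr_i scaleN1r.
  have -> : u (- x) = - u x by have := uZ (-1) x; rewrite rmorphN rmorph1 scaleN1r mulN1r.
  by rewrite opprK; apply/eqP; rewrite eq_complex /=; apply/andP; split;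
    apply/eqP; ring.
have lf : linear f.
  apply: linearP_DZ => // a x.
  rewrite [a]complexE scalerDl fD fZr [in LHS]mulrC -scalerA !fZr fi.
  rewrite /GRing.scale /= mulrDl mulrA; congr (_ + _ * _); exact: mulrC.
exists f; split=> // [x|v].
  have [->|fx0] := eqVneq (f x) 0.
    by rewrite cabs0 seminorm_ge0.
  (* Rotating [x] by this unimodular scalar makes the value of [f] real, so that the bound on its
     real part applies. *)
  pose t := (cabs (f x))%:C / f x.
  have t1 : cabs t = 1.
    by rewrite cabsM cabsV cabs_real ?cabs_ge0// divff// gt_eqF// cabs_gt0.
  have ftx : f (t *: x) = (cabs (f x))%:C.
    by rewrite (linZ lf) /GRing.scale /= /t divfK.
  have -> : cabs (f x) = u (t *: x) by have := congr1 (@complex.Re R) ftx.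
  by apply: le_trans (up _) _; rewrite sp.2 t1 mul1r.
have uS w : u (S w) = complex.Re (H w) by apply: ug0; exists w.
rewrite /f -(linZ lS) !uS (linZ lH) /GRing.scale /=.
by case: (H v) => a b /=; rewrite mul0r mul1r sub0r opprK.
Qed.

End HahnBanach.

Lemma hahn_banach_point (R : realType) (V : lmodType R[i]) (p : V -> R) x :
  seminorm p -> exists f : V -> R[i]^o,
    [/\ linear f, forall y, cabs (f y) <= p y & f x = (p x)%:C].
Proof.
move=> sp.
have [|||f [lf fp fx]] := @hahn_banach _ _ _ sp R[i]^o (fun c => c *: x)
    (fun c => c * (p x)%:C).
- by move=> a c d; rewrite scalerDl scalerA.
- by move=> a c d; rewrite /GRing.scale /= mulrDl mulrA.
- by move=> c; rewrite sp.2 cabsM cabs_real // seminorm_ge0.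
by exists f; split=> //; have := fx 1; rewrite scale1r mul1r.
Qed.

(** * Baire's theorem and open mappings in Fréchet spaces *)

Section QuotientSeminorm.
Variables (R : realType) (V : lmodType R[i]) (p : V -> R) (N : set V).
Hypotheses (sp : seminorm p) (N0 : N 0)
  (NL : forall a x y, N x -> N y -> N (a *: x + y)).

(** Kept as a seminorm on [V] itself, in place of one on the quotient of [V] by [N]. *)
Definition quotient_seminorm x : R := inf [set p (x + n) | n in N].

Let lb x : has_lbound [set p (x + n) | n in N].
Proof. by exists 0 => _ [n _ <-]; exact: seminorm_ge0. Qed.

Let ne x : [set p (x + n) | n in N] !=set0.
Proof. by exists (p (x + 0)), 0. Qed.

Lemma quotient_seminorm_le x n : N n -> quotient_seminorm x <= p (x + n).
Proof. by move=> Nn; apply: ge_inf => //; exists n. Qed.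

Lemma quotient_seminorm_lt x e :
  quotient_seminorm x < e -> exists2 n, N n & p (x + n) < e.
Proof. by move=> /(inf_lt (ne x))[_ [n Nn <-] pe]; exists n. Qed.

Lemma quotient_seminorm_ge x e :
  (forall n, N n -> e <= p (x + n)) -> e <= quotient_seminorm x.
Proof. by move=> h; apply: lb_le_inf => // _ [n Nn <-]; exact: h. Qed.

Lemma quotient_seminorm_ge0 x : 0 <= quotient_seminorm x.
Proof. by apply: quotient_seminorm_ge => n _; exact: seminorm_ge0. Qed.

Lemma quotient_seminorm_sub x : N x -> quotient_seminorm x = 0.
Proof.
move=> Nx; apply/eqP; rewrite eq_le quotient_seminorm_ge0 andbT.
have := @quotient_seminorm_le x (- x); rewrite subrr (seminorm0 sp); apply.
by rewrite -scaleN1r -[_ *: _]addr0; exact: NL.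
Qed.

Lemma seminorm_quotient : seminorm quotient_seminorm.
Proof.
have Zle t x : quotient_seminorm (t *: x) <= cabs t * quotient_seminorm x.
  apply/ler_addgt0Pr => e e0; have ct := cabs_ge0 t.
  have [|n Nn pn] := @quotient_seminorm_lt x
      (quotient_seminorm x + e / (cabs t + 1)).
    by rewrite ltrDl divr_gt0 //; lra.
  apply: le_trans (quotient_seminorm_le _ (_ : N (t *: n))) _.
    by rewrite -[_ *: _]addr0; exact: NL.
  rewrite -scalerDr sp.2.
  have : cabs t * (e / (cabs t + 1)) <= e.
    by rewrite mulrCA ger_pMr// ler_pdivrMr ?mul1r; lra.
  nra.
apply: seminorm_subhomogeneous Zle => [|x y]; first exact: quotient_seminorm_ge0.
apply/ler_addgt0Pr => e e0.
have e20 : 0 < e / 2 by rewrite divr_gt0.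
have [|n Nn pn] := @quotient_seminorm_lt x (quotient_seminorm x + e / 2).
  lra.
have [|m Nm pm] := @quotient_seminorm_lt y (quotient_seminorm y + e / 2).
  lra.
apply: le_trans (quotient_seminorm_le _ (_ : N (n + m))) _.
  by rewrite -[n]scale1r; exact: NL.
rewrite addrACA; apply: le_trans (sp.1 _ _) _; lra.
Qed.

End QuotientSeminorm.

Section DualSeparation.
Variables (R : realType) (V : tvsType R[i]).

Lemma csn_quotient (p : V -> R) (N : set V) :
  csn p -> subspace N -> csn (quotient_seminorm p N).
Proof.
move=> cp [N0 NL]; have sp := csn_seminorm cp.
apply: (csn_le (seminorm_quotient sp N0 NL) cp) => x.
by have := quotient_seminorm_le sp x N0; rewrite addr0.
Qed.

(** A functional that is dominated by the quotient seminorm and attains it at [x] kills [N], hence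
    [x]; so [x] has distance 0 from [N] for every continuous seminorm. *)
Lemma closure_dualP (N : set V) x : subspace N ->
  (forall f, dual V f -> (forall y, N y -> f y = 0) -> f x = 0) -> closure N x.
Proof.
move=> sN hf; apply/closure_csn => p e cp e0; have sp := csn_seminorm cp.
have cq := csn_quotient cp sN.
have [f [lf fq fx]] := hahn_banach_point x (csn_seminorm cq).
have df : dual V f by exact: csn_dual cq fq.
have fN y : N y -> f y = 0.
  move=> Ny; apply/cabs0_eq0/eqP; rewrite eq_le cabs_ge0 andbT.
  by apply: le_trans (fq _) _; rewrite (quotient_seminorm_sub sp sN.1 sN.2 Ny).
have := hf f df fN; rewrite fx => /(@complexI R) q0.
have [|n Nn pn] := @quotient_seminorm_lt _ _ p N sN.1 x e.
  by rewrite q0.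
by exists (- n); [exact: subspaceN | rewrite opprK].
Qed.

Lemma dual_separates x : hausdorff_space V ->
  (forall f, dual V f -> f x = 0) -> x = 0.
Proof.
move=> /hausdorff_csnP hV hf; apply: hV => p cp.
have [f [lf fp fx]] := hahn_banach_point x (csn_seminorm cp).
by have := hf f (csn_dual lf cp fp); rewrite fx => /(@complexI R).
Qed.

End DualSeparation.

Lemma expr_half_lt (R : realType) (e : R) : 0 < e -> exists n, (2^-1) ^+ n < e.
Proof.
move=> e0; exists (Num.bound e^-1).
rewrite exprVn -[ltRHS]invrK ltf_pV2 ?posrE ?invr_gt0 ?exprn_gt0//.
apply: lt_le_trans (archi_boundP _) _; first by rewrite invr_ge0 ltW.
by rewrite -natrX ler_nat ltnW // ltn_expl.
Qed.

Lemma expr_half_gt0 (R : realType) n : 0 < (2^-1 : R) ^+ n.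
Proof. by rewrite exprn_gt0 // invr_gt0. Qed.

Section FrechetSequences.
Variables (R : realType) (V : tvsType R[i]).
Hypothesis fV : frechet_space V.
Implicit Types (u : nat -> V) (x : V).

Definition seminorm_cvg u x := forall p e, csn p -> 0 < e ->
  exists N, forall i, (N <= i)%N -> p (u i - x) < e.

Definition seminorm_cauchy u := forall p e, csn p -> 0 < e ->
  exists N, forall i j, (N <= i)%N -> (N <= j)%N -> p (u i - u j) < e.

(** The domination holds with constant 1: the unit ball of [p] contains some [B n], and therefore
    the unit ball of the gauge chosen inside [B n]. *)
Lemma frechet_basis : exists q : nat -> V -> R, [/\ forall n, csn (q n),
  forall n m, (n <= m)%N -> forall x, q n x <= q m x
  & forall p, csn p -> exists n, forall x, p x <= q n x].
Proof.
have [_ [B [B0 hB]] _] := fV.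
have /choice[p hp] : forall n, exists p, csn p /\ forall x, p x < 1 -> B n x.
  by move=> n; have [p ? ?] := csn_gauge (B0 n); exists p.
have sp n : seminorm (p n) by exact: (csn_seminorm (hp n).1).
exists (fun n x => \sum_(i < n.+1) p i x); split=> [n|n m nm x|r cr].
- by apply: csn_sum => i; exact: (hp i).1.
- rewrite -!(big_mkord xpredT (fun i => p i x)) /=.
  rewrite (@big_cat_nat _ _ _ n.+1 0 m.+1) //=.
  by rewrite lerDl; apply: sumr_ge0 => i _; exact: seminorm_ge0.
have [n Bn] := hB _ (cr.2 1 ltr01); exists n => x.
have := @seminorm_le_scale _ _ r (p n) (csn_seminorm cr) (sp n).
have pr y : p n y < 1 -> r y < 1 by move=> /((hp n).2 y) /Bn.
move=> /(_ pr x) /le_trans; apply.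
by rewrite big_ord_recr /= lerDr; apply: sumr_ge0 => i _; exact: seminorm_ge0.
Qed.

Lemma frechet_cauchy_cvg u : seminorm_cauchy u -> exists x, seminorm_cvg u x.
Proof.
move=> cu; have [_ _ cplt] := fV.
have [|x ux] := cplt (u @ \oo) _.
  move=> U /csn_gauge[p cp pU]; have [N uN] := cu p 1 cp ltr01.
  exists [set u i | i in [set i | (N <= i)%N]].
    by exists N => // i Ni; exists i.
  by move=> _ _ [i Ni <-] [j Nj <-]; apply: pU; exact: uN.
exists x => p e cp e0.
have /ux : nbhs x [set y | e^-1 * p (y - x) < 1].
  apply/nbhs_csn; exists (fun y => e^-1 * p y) => //.
  by apply: csnZ => //; rewrite invr_ge0 ltW.
move=> [N _ uN]; exists N => i Ni; have := uN i Ni.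
by rewrite /= mulrC ltr_pdivrMr// mul1r.
Qed.

Lemma seminorm_cvg_le u x p M : csn p -> seminorm_cvg u x ->
  (exists N, forall i, (N <= i)%N -> p (u i) <= M) -> p x <= M.
Proof.
move=> cp ux [N uM]; apply/ler_addgt0Pr => e e0.
have sp := csn_seminorm cp.
have [N' uN'] := ux p e cp e0.
have /uM h1 := leq_maxl N N'; have /uN' h2 := leq_maxr N N'.
have := sp.1 (x - u (maxn N N')) (u (maxn N N')).
rewrite subrK (seminorm_distC sp x); lra.
Qed.

Lemma seminorm_cvg_closure (S : set V) u x :
  seminorm_cvg u x -> (forall n, S (u n)) -> closure S x.
Proof.
move=> ux Su; apply/closure_csn => p e cp e0; have [N uN] := ux p e cp e0.
by exists (u N) => //; rewrite (seminorm_distC (csn_seminorm cp)); exact: uN.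
Qed.

Lemma seminorm_cvgB u x y : seminorm_cvg u x -> seminorm_cvg (fun n => u n - y) (x - y).
Proof.
move=> ux p e cp e0; have [N uN] := ux p e cp e0; exists N => i /uN.
by rewrite opprB subrKA.
Qed.

Lemma seminorm_cauchy_series (q : nat -> V -> R) (v : nat -> V) :
  (forall n, csn (q n)) ->
  (forall n m, (n <= m)%N -> forall x, q n x <= q m x) ->
  (forall p, csn p -> exists n, forall x, p x <= q n x) ->
  (forall n, q n (v n) <= (2^-1) ^+ n) ->
  seminorm_cauchy (fun n => \sum_(i < n) v i).
Proof.
move=> cq mq dq qv p e cp e0.
have [n0 pq] := dq p cp.
have [n1 n1e] : exists n, (2^-1 : R) ^+ n < e / 4.
  by apply: expr_half_lt; rewrite divr_gt0.
have tail N k : (n0 <= N)%N ->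
    p (\sum_(i < N + k) v i - \sum_(i < N) v i) <=
      2 * (2^-1) ^+ N - 2 * (2^-1) ^+ (N + k).
  move=> n0N; elim: k => [|k ih].
    by rewrite addn0 subrr (seminorm0 (csn_seminorm cp)) subrr.
  rewrite addnS big_ord_recr /= addrAC.
  apply: le_trans ((csn_seminorm cp).1 _ _) _.
  have : p (v (N + k)%N) <= (2^-1) ^+ (N + k).
    apply: le_trans (qv _); apply: le_trans (pq _) _; apply: mq.
    exact: leq_trans (leq_addr _ _).
  rewrite exprS; lra.
exists (maxn n0 n1).
have near i : (maxn n0 n1 <= i)%N ->
    p (\sum_(k < i) v k - \sum_(k < maxn n0 n1) v k) < e / 2.
  move=> /subnKC <-; apply: le_lt_trans (tail _ _ (leq_maxl _ _)) _.
  have := expr_half_gt0 R (maxn n0 n1 + (i - maxn n0 n1)).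
  have : (2^-1 : R) ^+ maxn n0 n1 <= (2^-1) ^+ n1.
    by apply: ler_wiXn2l; rewrite ?leq_maxr //; lra.
  lra.
move=> i j /near hi /near hj.
apply: le_lt_trans
  (seminorm_dist_trans (csn_seminorm cp) (\sum_(k < maxn n0 n1) v k) _ _) _.
rewrite (seminorm_distC (csn_seminorm cp) (\sum_(k < maxn n0 n1) v k)); lra.
Qed.

(** Stated relative to a closed set [W], to be applied to the closed range of a map as well as to a
    whole space. If no [closure (C j)] had interior points in [W], there would be nested balls
    centred in [W], the j-th step avoiding [C j]; the limit of the centres would lie in [W] but in
    no [C j]. *)
Lemma frechet_baire (W : set V) (C : nat -> set V) x0 :
  closure W `<=` W -> W x0 -> W `<=` \bigcup_j C j ->
  exists j x p e, [/\ csn p, 0 < e, W x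
    & forall w, W w -> p (w - x) < e -> closure (C j) w].
Proof.
move=> clW Wx0 WC.
have [q [cq mq dq]] := frechet_basis.
have sq n : seminorm (q n) by exact: csn_seminorm.
apply: contrapT => noball.
pose St := (V * nat * R)%type.
pose ball (s : St) := [set y | q s.1.2 (y - s.1.1) <= s.2].
pose good (s : St) := W s.1.1 /\ 0 < s.2.
(* A state consists of a centre, the index of the seminorm that measures the ball, and a radius. The
   index has to grow while the radius is halved: only then are the centres Cauchy for every
   seminorm. *)
have /choice[f fP] : forall z : nat * St, exists s : St, good z.2 ->
    [/\ good s, (z.2.1.2 < s.1.2)%N, s.2 <= z.2.2 / 2, ball s `<=` ball z.2
      & forall y, ball s y -> ~ C z.1 y].
  move=> [j [[x m] e]] /=; have [[/= Wx e0]|] := pselect (good (x, m, e)); last first.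
    by move=> ng; exists (x, m, e).
  have [w Ww [wx nw]] : exists2 w, W w & q m (w - x) < e / 2 /\ ~ closure (C j) w.
    apply: contrapT => nw; apply: noball; exists j, x, (q m), (e / 2).
    split=> // [|w Ww wx]; first by rewrite divr_gt0.
    by apply: contrapT => nc; apply: nw; exists w.
  have [p [e' [cp e'0 pe']]] : exists p e', [/\ csn p, 0 < e'
      & forall y, C j y -> e' <= p (w - y)].
    apply: contrapT => np; apply: nw; apply/closure_csn => p e' cp e'0.
    apply: contrapT => ny; apply: np; exists p, e'; split=> // y Cy.
    by rewrite leNgt; apply/negP => lt; apply: ny; exists y.
  have [k pk] := dq p cp.
  (* The half of [e'] keeps the new ball away from [C j], the half of [e] keeps it inside the old
     ball. *)
  have e''0 : 0 < Num.min (e' / 2) (e / 2) by rewrite lt_min !divr_gt0.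
  exists (w, maxn m.+1 k, Num.min (e' / 2) (e / 2)) => _; split=> //=.
  - by rewrite leq_maxl.
  - by rewrite ge_min lexx orbT.
  - move=> y; rewrite /ball /= => yw.
    apply: le_trans (seminorm_dist_trans (sq m) w y x) _.
    have : q m (y - w) <= q (maxn m.+1 k) (y - w).
      by apply: mq; rewrite leq_max leqnSn.
    have : Num.min (e' / 2) (e / 2) <= e / 2 by rewrite ge_min lexx orbT.
    lra.
  move=> y; rewrite /ball /= => yw /pe'.
  rewrite (seminorm_distC (csn_seminorm cp)).
  have := pk (y - w).
  have : q k (y - w) <= q (maxn m.+1 k) (y - w) by apply: mq; rewrite leq_maxr.
  have : Num.min (e' / 2) (e / 2) <= e' / 2 by rewrite ge_min lexx.
  lra.
pose fix s n : St := if n is k.+1 then f (k, s k) else (x0, 0%N, 1).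
have sG n : good (s n).
  by elim: n => [|n ih]; [split=> //=; exact: ltr01 | have [] := fP (n, s n) ih].
have sS n := fP (n, s n) (sG n).
have s_m n : (n <= (s n).1.2)%N.
  by elim: n => // n ih; have [_ h _ _ _] := sS n; exact: leq_ltn_trans h.
have s_e n : (s n).2 <= (2^-1) ^+ n.
  elim: n => // n ih; have [_ _ h _ _] := sS n.
  by apply: le_trans h _; rewrite exprS /=; lra.
have s_ball n k : ball (s (n + k)%N) `<=` ball (s n).
  elim: k => [|k ih]; first by rewrite addn0.
  have [_ _ _ h _] := sS (n + k)%N; rewrite addnS.
  exact: subset_trans ih.
have s_in n k : (n <= k)%N -> ball (s n) (s k).1.1.
  move=> /subnKC <-; apply: (s_ball n (k - n)%N).
  by rewrite /ball /= subrr (seminorm0 (sq _)); exact: ltW (sG _).2.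
have cs : seminorm_cauchy (fun n => (s n).1.1).
  move=> p e cp e0; have [n0 pn] := dq p cp.
  have [n1 ne] : exists n, (2^-1 : R) ^+ n < e / 2.
    by apply: expr_half_lt; rewrite divr_gt0.
  have near i : (maxn n0 n1 <= i)%N ->
      p ((s i).1.1 - (s (maxn n0 n1)).1.1) < e / 2.
    move=> /s_in; rewrite /ball /= => h.
    apply: le_lt_trans (pn _) _.
    apply: le_lt_trans (_ : _ <= q (s (maxn n0 n1)).1.2 _) _.
      by apply: mq; apply: leq_trans (s_m _); exact: leq_maxl.
    apply: le_lt_trans h _; apply: le_lt_trans (s_e _) _; apply: le_lt_trans ne.
    by apply: ler_wiXn2l; rewrite ?leq_maxr //; lra.
  exists (maxn n0 n1) => i j /near hi /near hj.
  apply: le_lt_trans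
    (seminorm_dist_trans (csn_seminorm cp) (s (maxn n0 n1)).1.1 _ _) _.
  rewrite (seminorm_distC (csn_seminorm cp) (s (maxn n0 n1)).1.1); lra.
have [x sx] := frechet_cauchy_cvg cs.
have xb n : ball (s n) x.
  rewrite /ball /=; apply: (seminorm_cvg_le (cq _) (seminorm_cvgB _ sx)).
  by exists n => i; exact: s_in.
have Wx : W x by apply/clW/(seminorm_cvg_closure sx) => n; exact: (sG n).1.
have [j _ Cx] := WC x Wx.
by have [_ _ _ _ h] := sS j; exact: (h x (xb j.+1)).
Qed.

End FrechetSequences.

Section OpenMapping.
Variables (R : realType) (T1 T2 : tvsType R[i]) (F : T1 -> T2) (N : set T2).
Hypotheses (fT1 : frechet_space T1) (fT2 : frechet_space T2).
Hypotheses (lF : linear F) (cF : continuous F).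
Hypotheses (sN : subspace N) (clN : closure N `<=` N).

Let W : set T2 := [set w | exists u m, N m /\ w = F u + m].
Hypothesis clW : closure W `<=` W.

Let sW : subspace W.
Proof.
split=> [|a x y [u [m [Nm ->]]] [v [n [Nn ->]]]].
  by exists 0, 0; split; [exact: sN.1 | rewrite (lin0 lF) addr0].
exists (a *: u + v), (a *: m + n); split; first exact: sN.2.
by rewrite lF scalerDr addrACA.
Qed.

(** The sets [C j] cover the closed set [W], so by Baire one of them is dense in a ball of [W].
    Subtracting approximants at the centre moves the ball to 0. *)
Let almost_open (p1 : T1 -> R) (p2 : T2 -> R) : csn p1 -> csn p2 ->
  exists2 q : T2 -> R, csn q & forall w, W w -> q w < 1 ->
    forall p e, csn p -> 0 < e -> exists u m,
      [/\ p1 u <= 1, p2 m <= 1, N m & p (w - (F u + m)) < e].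
Proof.
move=> c1 c2; have s1 := csn_seminorm c1; have s2 := csn_seminorm c2.
pose C (j : nat) := [set w | exists u m,
  [/\ p1 u <= j%:R, p2 m <= j%:R, N m & w = F u + m]].
have [|j [x [p [e [cp e0 Wx ball]]]]] := frechet_baire (C := C) fT2 clW sW.1.
  move=> _ [u [m [Nm ->]]].
  exists (Num.bound (p1 u + p2 m)) => //; exists u, m.
  have : p1 u + p2 m < (Num.bound (p1 u + p2 m))%:R.
    by apply: archi_boundP; rewrite addr_ge0 ?seminorm_ge0.
  have := seminorm_ge0 s1 u; have := seminorm_ge0 s2 m.
  by split=> //; lra.
have sp := csn_seminorm cp.
(* Differences of parameters from [C j] have [p1] and [p2] at most [2 * j%:R]; division by [K]
   brings them below 1, and the added 1 keeps [K] positive when [j] is 0. *)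
pose K : R := 2 * (j%:R + 1).
have j0 : (0 : R) <= j%:R by [].
have K0 : 0 < K by rewrite /K; lra.
exists (fun w => K / e * p w).
  by apply: csnZ => //; rewrite divr_ge0 // ltW.
move=> w Ww wK p' e' cp' e'0; have sp' := csn_seminorm cp'.
have Ke'0 : 0 < K * e' / 2 by rewrite divr_gt0 // mulr_gt0.
have WKw : W (K%:C *: w + x) by exact: sW.2.
have [|_ [u [m [pu pm Nm ->]]] h1] :=
    (closure_csn _ _).1 (ball _ WKw _) p' (K * e' / 2) cp' Ke'0.
  rewrite addrK (seminorm_scale_real sp) ?(ltW K0)//.
  by move: wK; rewrite mulrAC ltr_pdivrMr// mul1r.
have [|_ [v [n [pv pn Nn ->]]] h2] :=
    (closure_csn _ _).1 (ball _ Wx _) p' (K * e' / 2) cp' Ke'0.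
  by rewrite subrr (seminorm0 sp).
have Ki0 : 0 <= K^-1 by rewrite invr_ge0 ltW.
exists (K^-1%:C *: (u - v)), (K^-1%:C *: (m - n)); split.
- rewrite (seminorm_scale_real s1)// mulrC ler_pdivrMr// mul1r.
  have := seminormB s1 u v; rewrite /K; lra.
- rewrite (seminorm_scale_real s2)// mulrC ler_pdivrMr// mul1r.
  have := seminormB s2 m n; rewrite /K; lra.
- by apply: subspaceZ => //; exact: subspaceB.
have -> : w - (F (K^-1%:C *: (u - v)) + K^-1%:C *: (m - n)) =
    K^-1%:C *: ((K%:C *: w + x - (F u + m)) - (x - (F v + n))).
  rewrite (linZ lF) (linB lF) -scalerDr [in LHS]addrACA -opprD.
  rewrite -[w in LHS](scale1r w).
  have -> : (1 : R[i]) = K^-1%:C * K%:C.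
    by rewrite -rmorphM mulVf ?rmorph1// gt_eqF.
  rewrite -scalerA -scalerBr; congr (_ *: _).
  rewrite !opprB [in RHS](addrC (K%:C *: w)) -[in RHS](addrA x) [RHS]addrC subrKA.
  exact: addrCA.
rewrite (seminorm_scale_real sp')// mulrC ltr_pdivrMr//.
apply: le_lt_trans (seminormB sp' _ _) _; lra.
Qed.

(** The open mapping theorem for (u, m) |-> F u + m, in the form needed for functionals. Successive
    approximation rewrites a small F u + m as F U + M, where [U] is a series of terms on which [H]
    is bounded by powers of 1/2. As F (u - U) lies in [N], the values of [H] at [u] and [U]
    agree. *)
Lemma open_mapping_functional (H : T1 -> R[i]^o) : dual T1 H ->
  (forall u, N (F u) -> H u = 0) ->
  exists2 p : T2 -> R, csn p & forall u m, N m -> cabs (H u) <= p (F u + m).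
Proof.
move=> dH HN.
have [q1 [c1 m1 d1]] := frechet_basis fT1.
have [q2 [c2 m2 d2]] := frechet_basis fT2.
pose h u := cabs (H u).
have ch : csn h by exact: dual_csn.
have sh := csn_seminorm ch.
have s1 n := csn_seminorm (c1 n); have s2 n := csn_seminorm (c2 n).
have g0 n : 0 <= (2 : R) ^+ n by rewrite exprn_ge0.
have /choice[Q0 hQ0] : forall k : nat, exists Q : T2 -> R, csn Q /\
    forall w, W w -> Q w < 1 -> forall p e, csn p -> 0 < e -> exists u m,
      [/\ 2 ^+ k * (q1 k u + h u) <= 1, 2 ^+ k * q2 k m <= 1, N m
        & p (w - (F u + m)) < e].
  move=> k.
  have [Q cQ hQ] := almost_open (csnZ (g0 k) (csnD (c1 k) ch)) (csnZ (g0 k) (c2 k)).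
  by exists Q.
(* The added term forces the remainders [r n] of the approximation to tend to 0. *)
pose Q k w := Q0 k w + 2 ^+ k * q2 k w.
have cQ k : csn (Q k) by apply: csnD; [exact: (hQ0 k).1 | exact: csnZ].
have sQ k := csn_seminorm (cQ k).
have Q_ge k w : Q0 k w <= Q k w /\ 2 ^+ k * q2 k w <= Q k w.
  have := seminorm_ge0 (csn_seminorm (hQ0 k).1) w.
  have : 0 <= 2 ^+ k * q2 k w by rewrite mulr_ge0 // seminorm_ge0.
  by rewrite /Q => ? ?; split; lra.
have /choice[f fP] : forall z : nat * T2, exists um : T1 * T2,
    W z.2 -> Q z.1 z.2 < 1 ->
    [/\ 2 ^+ z.1 * (q1 z.1 um.1 + h um.1) <= 1, 2 ^+ z.1 * q2 z.1 um.2 <= 1, N um.2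
      & Q z.1.+1 (z.2 - (F um.1 + um.2)) < 1].
  move=> [k w] /=; have [[Ww Qw]|nw] := pselect (W w /\ Q k w < 1); last first.
    by exists (0, 0) => ? ?; case: nw.
  have [|u [m [? ? ? ?]]] := (hQ0 k).2 w Ww _ _ _ (cQ k.+1) (@ltr01 R).
    exact: le_lt_trans (Q_ge k w).1 Qw.
  by exists (u, m).
suff small u m : N m -> Q 0%N (F u + m) < 1 -> h u <= 2.
  exists (fun w => 2 * Q 0%N w); first by apply: csnZ.
  move=> u m Nm; rewrite leNgt; apply/negP => lt.
  (* Strictly between [Q 0%N (F u + m)] and [h u / 2]: dividing by [s] makes the former less than 1
     and [h u] greater than 2. *)
  pose s := (Q 0%N (F u + m) + h u / 2) / 2.
  have Q_ge0 := seminorm_ge0 (sQ 0%N) (F u + m).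
  have s0 : 0 < s by rewrite /s /h; lra.
  have si0 : 0 <= s^-1 by rewrite invr_ge0 ltW.
  have := small (s^-1%:C *: u) (s^-1%:C *: m) (subspaceZ _ sN Nm).
  rewrite (linZ lF) -scalerDr (seminorm_scale_real (sQ 0%N))//.
  rewrite (seminorm_scale_real sh)// ![s^-1 * _]mulrC.
  rewrite ltr_pdivrMr// ler_pdivrMr// mul1r => small'.
  have /small' : Q 0%N (F u + m) < s by rewrite /s /h; lra.
  rewrite /s /h; lra.
move=> Nm Qw; set w := F u + m in Qw.
have Ww : W w by exists u, m.
pose fix r n : T2 := if n is k.+1 then r k - (F (f (k, r k)).1 + (f (k, r k)).2) else w.
pose a n := (f (n, r n)).1; pose b n := (f (n, r n)).2.
have rG n : W (r n) /\ Q n (r n) < 1.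
  elim: n => [//|n [Wr Qr]]; have [_ _ Nb Qb] := fP (n, r n) Wr Qr.
  by split=> //=; apply: subspaceB => //; exists (a n), (b n).
have fr n := fP (n, r n) (rG n).1 (rG n).2.
have pow2 n (x : R) : 2 ^+ n * x <= 1 -> x <= (2^-1) ^+ n.
  by rewrite exprVn -ler_pdivlMl ?exprn_gt0// mulr1.
have ha n : q1 n (a n) <= (2^-1) ^+ n /\ h (a n) <= (2^-1) ^+ n.
  have [/pow2 /= + _ _ _] := fr n.
  have := seminorm_ge0 (s1 n) (a n); have := seminorm_ge0 sh (a n).
  by rewrite -/(a n) => ? ? ?; split; lra.
have hb n : q2 n (b n) <= (2^-1) ^+ n by have [_ /pow2 + _ _] := fr n.
have Nb n : N (b n) by have [] := fr n.
have [U aU] := frechet_cauchy_cvg fT1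
  (seminorm_cauchy_series c1 m1 d1 (fun n => (ha n).1)).
have [M bM] := frechet_cauchy_cvg fT2 (seminorm_cauchy_series c2 m2 d2 hb).
have NM : N M.
  by apply/clN/(seminorm_cvg_closure bM) => n; exact: subspace_sum.
have hU : h U <= 2.
  apply: (seminorm_cvg_le ch aU); exists 0%N => n _.
  apply: le_trans (seminorm_sum sh _) _.
  suff : \sum_(i < n) h (a i) <= 2 - 2 * (2^-1) ^+ n.
    by have := expr_half_gt0 R n; lra.
  elim: n => [|n ih]; first by rewrite big_ord0 expr0; lra.
  by rewrite big_ord_recr /= exprS; have := (ha n).2; lra.
have rE n : w = F (\sum_(i < n) a i) + \sum_(i < n) b i + r n.
  elim: n => [|n ih]; first by rewrite !big_ord0 (lin0 lF) !add0r.
  rewrite !big_ord_recr /= (linD lF) -/(a n) -/(b n).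
  rewrite [F _ + F _ + _]addrACA.
  by rewrite -(addrA (F _ + \sum_(i < n) b i)) (addrC (F (a n) + b n)) subrK.
have wE : w = F U + M.
  apply/eqP; rewrite -subr_eq0; apply/eqP/((hausdorff_csnP _).1); first by case: fT2.
  move=> p cp; have sp := csn_seminorm cp.
  apply/eqP; rewrite eq_le seminorm_ge0// andbT; apply/ler_addgt0Pr => e e0.
  rewrite add0r; have e30 : 0 < e / 3 by rewrite divr_gt0.
  have [n1 hn1] := aU _ _ (csn_comp cp lF cF) e30.
  have [n2 hn2] := bM _ _ cp e30.
  have [n3 pn3] := d2 p cp.
  have [n4 hn4] := expr_half_lt e30.
  pose n := maxn (maxn n1 n2) (maxn n3 n4).
  have [n1n n2n n3n n4n] : [/\ (n1 <= n)%N, (n2 <= n)%N, (n3 <= n)%N & (n4 <= n)%N].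
    by rewrite /n; split; lia.
  have := hn1 n n1n; have := hn2 n n2n; rewrite /= (linB lF) => h2 h1.
  have h3 : p (r n) <= (2^-1) ^+ n.
    apply: le_trans (pn3 _) _; apply: le_trans (m2 _ _ n3n _) _; apply: pow2.
    exact: le_trans (Q_ge _ _).2 (ltW (rG n).2).
  have h4 : (2^-1 : R) ^+ n <= (2^-1) ^+ n4 by apply: ler_wiXn2l => //; lra.
  rewrite [in leLHS](rE n).
  rewrite addrAC opprD addrACA.
  have := sp.1 (F (\sum_(i < n) a i) - F U + (\sum_(i < n) b i - M)) (r n).
  have := sp.1 (F (\sum_(i < n) a i) - F U) (\sum_(i < n) b i - M).
  lra.
(* Both represent [w], so [F (u - U)] equals [M - m], an element of [N], and [H] vanishes at
   [u - U]. *)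
have -> : h u = h U.
  rewrite /h; congr cabs; apply/eqP; rewrite -subr_eq0 -(linB dH.1); apply/eqP/HN.
  have -> : F (u - U) = M - m.
    rewrite (linB lF); apply/eqP; rewrite subr_eq addrAC eq_sym subr_eq.
    by rewrite addrC -wE.
  exact: subspaceB.
exact: hU.
Qed.

End OpenMapping.

Section FrechetCriterion.
Variables (R : realType) (V : tvsType R[i]) (q : nat -> V -> R).
Hypothesis cq : forall n, csn (q n).
Hypothesis nq : forall U : set V, nbhs 0 U ->
  exists n e, 0 < e /\ [set x | q n x < e] `<=` U.
Hypothesis q_sep : forall x, (forall n, q n x = 0) -> x = 0.
Hypothesis q_complete : forall u : nat -> V,
  (forall n e, 0 < e -> exists N, forall i j, (N <= i)%N -> (N <= j)%N ->
     q n (u i - u j) < e) ->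
  exists x, forall n e, 0 < e -> exists N, forall i, (N <= i)%N ->
     q n (u i - x) < e.

(** Sequential completeness suffices: points taken from decreasing members of a Cauchy filter, the
    n-th of [Q n]-diameter at most 2^-n, form a Cauchy sequence whose limit is a limit of the
    filter. The sums [Q n] make the family increasing. *)
Lemma frechet_space_seminorms : frechet_space V.
Proof.
have sq n := csn_seminorm (cq n).
pose Q n x := \sum_(k < n.+1) q k x.
have cQ n : csn (Q n) by exact: csn_sum.
have qQ k n x : (k <= n)%N -> q k x <= Q n x.
  move=> kn; have kn' : (k < n.+1)%N by [].
  rewrite /Q (bigD1 (Ordinal kn')) //= lerDl.
  by apply: sumr_ge0 => i _; exact: seminorm_ge0.
split.
- by apply/hausdorff_csnP => x h; apply: q_sep => n; exact: h.
- exists (fun n => [set x | Q n x < (2^-1) ^+ n]); split=> [n|U /nq[n [e [e0 qU]]]].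
    by apply: (cQ n).2; exact: expr_half_gt0.
  have [m me] := expr_half_lt e0.
  exists (maxn n m) => x /= Qx; apply: qU => /=.
  apply: le_lt_trans (qQ _ _ _ (leq_maxl n m)) _; apply: lt_trans Qx _.
  apply: le_lt_trans me.
  by apply: ler_wiXn2l; rewrite ?leq_maxr //; lra.
move=> F PF cF.
have /choice[B hB] : forall n, exists B, F B /\
    forall x y, B x -> B y -> Q n (x - y) < (2^-1) ^+ n.
  by move=> n; have [B FB hB] := cF _ ((cQ n).2 _ (expr_half_gt0 R n)); exists B.
pose fix C n := if n is k.+1 then C k `&` B k.+1 else B 0%N.
have FC n : F (C n).
  elim: n => [|n ih]; first exact: (hB 0%N).1.
  by apply: filterI => //; exact: (hB n.+1).1.
have CB n k : C (n + k)%N `<=` B n.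
  have CnB m : C m `<=` B m by case: m => // m x [].
  elim: k => [|k ih]; first by rewrite addn0.
  by rewrite addnS => x [/ih].
have /choice[u uC] : forall n, exists x, C n x.
  by move=> n; have /filter_ex[x] := FC n; exists x.
have uB n i : (n <= i)%N -> B n (u i).
  by move=> /subnKC <-; apply: CB; exact: uC.
have [n e e0|x ux] := @q_complete u.
  have [m me] := expr_half_lt e0.
  exists (maxn n m) => i j hi hj.
  apply: le_lt_trans (qQ _ _ _ (leq_maxl n m)) _.
  apply: lt_le_trans ((hB _).2 _ _ (uB _ _ hi) (uB _ _ hj)) _.
  apply: le_trans (ltW me).
  by apply: ler_wiXn2l; rewrite ?leq_maxr //; lra.
exists x => U /nbhs_csn[p cp pU].
have [n [e [e0 qp]]] := nq (cp.2 _ ltr01).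
have e20 : 0 < e / 2 by rewrite divr_gt0.
have [m me] := expr_half_lt e20.
have [N uN] := ux n _ e20.
pose M := maxn (maxn n m) N.
apply: filterS (hB (maxn n m)).1 => y By; apply: pU; apply: qp => /=.
have h1 := uN M (leq_maxr _ _).
have h2 : q n (y - u M) < e / 2.
  apply: le_lt_trans (qQ _ _ _ (leq_maxl n m)) _.
  apply: lt_le_trans ((hB _).2 _ _ By (uB _ _ (leq_maxl _ _))) _.
  apply: le_trans (ltW me).
  by apply: ler_wiXn2l; rewrite ?leq_maxr //; lra.
have := seminorm_dist_trans (sq n) (u M) y x; lra.
Qed.

End FrechetCriterion.

(** * Fréchet spaces: complete normed spaces, products, scalars *)

Section NormedSpaces.
Variables (R : realType) (V : normedModType R[i]).

Definition rnorm (x : V) : R := complex.Re `|x|.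

Lemma rnormE x : `|x| = (rnorm x)%:C.
Proof. by rewrite /rnorm RRe_real // normr_real. Qed.

Lemma seminorm_rnorm : seminorm rnorm.
Proof.
split=> [x y|t x]; first by rewrite -lecR rmorphD /= -!rnormE ler_normD.
by apply: complexI; rewrite rmorphM /= -rnormE normrZ rnormE cabsE.
Qed.

Lemma csn_rnorm : csn rnorm.
Proof.
split=> [|e e0]; first exact: seminorm_rnorm.
apply/nbhs_ballP; exists e%:C; first by rewrite /= ltcR.
by move=> x; rewrite -ball_normE /= sub0r normrN rnormE ltcR.
Qed.

Lemma nbhs0_rnorm (U : set V) : nbhs 0 U ->
  exists2 e, 0 < e & forall x, rnorm x < e -> U x.
Proof.
move=> /nbhs_ballP[e0 /= /gt0c_real[e e_gt0 ->] eU]; exists e => // x xe.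
by apply: eU; rewrite -ball_normE /= sub0r normrN rnormE ltcR.
Qed.

Lemma csn_le_rnorm p : csn p -> exists2 M, 0 < M & forall x, p x <= M * rnorm x.
Proof.
move=> [sp np]; have [e e0 eU] := nbhs0_rnorm (np _ ltr01).
exists e^-1 => [|x]; first by rewrite invr_gt0.
apply: (seminorm_le_scale sp (seminormZ _ seminorm_rnorm)) => [|y].
  by rewrite invr_ge0 ltW.
by rewrite mulrC ltr_pdivrMr// mul1r => /eU.
Qed.

End NormedSpaces.

Lemma frechet_complete_normed (R : realType) (V : completeNormedModType R[i]) :
  frechet_space V.
Proof.
apply: (@frechet_space_seminorms _ _ (fun=> @rnorm R V)) => [_|U U0|x x0|u cu].
- exact: csn_rnorm.
- by have [e e0 eU] := nbhs0_rnorm U0; exists 0%N, e; split.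
- by apply/eqP; rewrite -normr_eq0 rnormE (x0 0%N).
have /cauchy_cvg/cvg_ex[x ux] : cauchy (u @ \oo).
  apply/cauchyP => e /gt0c_real[r r0 ->].
  have [N uN] := cu 0%N r r0; exists (u N).
  exists N => // i Ni; rewrite /= -ball_normE /= rnormE ltcR; apply: uN => //.
exists x => _ e e0.
have /ux[N _ uN] : nbhs x [set y | rnorm (y - x) < e].
  apply/nbhs_ballP; exists e%:C; first by rewrite /= ltcR.
  by move=> y; rewrite -ball_normE /= distrC rnormE ltcR.
by exists N => i /uN.
Qed.

Section ProductSpaces.
Variables (R : realType) (V W : tvsType R[i]).

Lemma csn_fst (p : V -> R) : csn p -> csn (fun z : V * W => p z.1).
Proof.
move=> cp; apply: (csn_comp cp (f := fst)); first by [].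
by move=> z; exact: cvg_fst.
Qed.

Lemma csn_snd (p : W -> R) : csn p -> csn (fun z : V * W => p z.2).
Proof.
move=> cp; apply: (csn_comp cp (f := snd)); first by [].
by move=> z; exact: cvg_snd.
Qed.

Lemma csn_inl (p : V * W -> R) : csn p -> csn (fun x => p (x, 0)).
Proof.
move=> cp; apply: (csn_comp cp (f := fun x => (x, 0))).
  by move=> a x y; congr (_, _); rewrite /= scaler0 addr0.
by move=> x; apply: cvg_pair => /=; [exact: cvg_id|exact: cvg_cst].
Qed.

Lemma csn_inr (p : V * W -> R) : csn p -> csn (fun y => p (0, y)).
Proof.
move=> cp; apply: (csn_comp cp (f := fun y => (0, y))).
  by move=> a x y; congr (_, _); rewrite /= scaler0 addr0.
by move=> x; apply: cvg_pair => /=; [exact: cvg_cst|exact: cvg_id].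
Qed.

Lemma csn_prod_le (p : V * W -> R) : csn p ->
  exists p1 p2, [/\ csn p1, csn p2 & forall z, p z <= p1 z.1 + p2 z.2].
Proof.
move=> cp; have c1 := csn_inl cp; have c2 := csn_inr cp.
exists (fun x => p (x, 0)), (fun y => p (0, y)); split=> // -[x y] /=.
have -> : (x, y) = (x, 0) + (0, y) by congr (_, _); rewrite /= ?addr0 ?add0r.
exact: (csn_seminorm cp).1.
Qed.

Lemma frechet_prod :
  frechet_space V -> frechet_space W -> frechet_space (V * W)%type.
Proof.
move=> fV fW.
have [p [cp mp dp]] := frechet_basis fV.
have [q [cq mq dq]] := frechet_basis fW.
have sp n := csn_seminorm (cp n); have sq n := csn_seminorm (cq n).
apply: (@frechet_space_seminorms _ _ (fun n z => p n z.1 + q n z.2)).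
- by move=> n; apply: csnD; [exact: csn_fst | exact: csn_snd].
- move=> U /csn_gauge[r cr rU]; have [r1 [r2 [c1 c2 rle]]] := csn_prod_le cr.
  have [n1 h1] := dp _ c1; have [n2 h2] := dq _ c2.
  exists (maxn n1 n2), 1; split=> // z /= pq; apply: rU.
  have := rle z; have := h1 z.1; have := h2 z.2.
  have := mp _ _ (leq_maxl n1 n2) z.1; have := mq _ _ (leq_maxr n1 n2) z.2; lra.
- move=> [x y] /= xy0; congr (_, _).
    apply: ((hausdorff_csnP V).1 _ x); first by case: fV.
    move=> r cr; have [n rn] := dp r cr; apply/eqP.
    rewrite eq_le seminorm_ge0 ?andbT; last exact: csn_seminorm.
    have := xy0 n; have := rn x; have := seminorm_ge0 (sq n) y; lra.
  apply: ((hausdorff_csnP W).1 _ y); first by case: fW.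
  move=> r cr; have [n rn] := dq r cr; apply/eqP.
  rewrite eq_le seminorm_ge0 ?andbT; last exact: csn_seminorm.
  have := xy0 n; have := rn y; have := seminorm_ge0 (sp n) x; lra.
move=> u cu.
have [|x ux] := @frechet_cauchy_cvg _ _ fV (fun n => (u n).1).
  move=> r e cr e0; have [n rn] := dp r cr; have [N hN] := cu n e e0.
  exists N => i j Ni Nj; have /= := hN i j Ni Nj.
  have := rn ((u i).1 - (u j).1).
  have := seminorm_ge0 (sq n) ((u i).2 - (u j).2); lra.
have [|y uy] := @frechet_cauchy_cvg _ _ fW (fun n => (u n).2).
  move=> r e cr e0; have [n rn] := dq r cr; have [N hN] := cu n e e0.
  exists N => i j Ni Nj; have /= := hN i j Ni Nj.
  have := rn ((u i).2 - (u j).2).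
  have := seminorm_ge0 (sp n) ((u i).1 - (u j).1); lra.
exists (x, y) => n e e0; have e20 : 0 < e / 2 by rewrite divr_gt0.
have [N1 h1] := ux _ _ (cp n) e20; have [N2 h2] := uy _ _ (cq n) e20.
exists (maxn N1 N2) => i Ni /=.
have := h1 i (leq_trans (leq_maxl _ _) Ni).
have := h2 i (leq_trans (leq_maxr _ _) Ni); lra.
Qed.

End ProductSpaces.

(** Completeness is inherited from [R] through real and imaginary parts. *)
Lemma frechet_scalars (R : realType) : frechet_space (R[i]^o : tvsType R[i]).
Proof.
apply: (@frechet_space_seminorms R R[i]^o (fun=> @cabs R)) => [_|U U0|x x0|u cu].
- exact: csn_cabs.
- by have [e e0 eU] := nbhs0_cabs U0; exists 0%N, e; split.
- by apply: cabs0_eq0; exact: x0 0%N.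
have ReB (z w : R[i]) : complex.Re (z - w) = complex.Re z - complex.Re w.
  by case: z w => [? ?] [? ?].
have ImB (z w : R[i]) : complex.Im (z - w) = complex.Im z - complex.Im w.
  by case: z w => [? ?] [? ?].
have abs_re (z : R[i]) : `|complex.Re z| <= cabs z.
  by rewrite -lecR -cabsE normc_ge_Re.
have abs_im (z : R[i]) : `|complex.Im z| <= cabs z.
  have -> : cabs z = cabs (z * 'i) by rewrite cabsM /cabs normc_def /=
    expr0n expr1n add0r sqrtr1 mulr1.
  by rewrite -normrN -ReiNIm abs_re.
have conv (v : nat -> R) : (forall e, 0 < e -> exists N, forall i j,
    (N <= i)%N -> (N <= j)%N -> `|v i - v j| < e) ->
    exists x, forall e, 0 < e -> exists N, forall i, (N <= i)%N -> `|v i - x| < e.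
  move=> cv; have /cauchy_cvg/cvg_ex[x vx] : cauchy (v @ \oo).
    apply/cauchyP => e e0; have [N vN] := cv e e0; exists (v N).
    by exists N => // i Ni; rewrite /= -ball_normE /=; exact: vN.
  exists x => e e0; have /vx[N _ vN] : nbhs x [set y | `|y - x| < e].
    apply/nbhs_ballP; exists e => //= y.
    by rewrite -ball_normE /= distrC.
  by exists N => i /vN.
have [e e0|a ua] := conv (fun n => complex.Re (u n)).
  have [N uN] := cu 0%N e e0; exists N => i j Ni Nj.
  by rewrite -ReB; exact: le_lt_trans (abs_re _) (uN _ _ Ni Nj).
have [e e0|b ub] := conv (fun n => complex.Im (u n)).
  have [N uN] := cu 0%N e e0; exists N => i j Ni Nj.
  by rewrite -ImB; exact: le_lt_trans (abs_im _) (uN _ _ Ni Nj).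
exists (a +i* b)%C => _ e e0; have e20 : 0 < e / 2 by rewrite divr_gt0.
have [N1 h1] := ua _ e20; have [N2 h2] := ub _ e20.
exists (maxn N1 N2) => i Ni.
have := h1 i (leq_trans (leq_maxl _ _) Ni).
have := h2 i (leq_trans (leq_maxr _ _) Ni).
have abs_le (z : R[i]) : cabs z <= `|complex.Re z| + `|complex.Im z|.
  rewrite {1}[z]complexE; apply: le_trans (cabsD _ _) _.
  rewrite cabsM {2}/cabs normc_def /= expr0n expr1n add0r sqrtr1 mul1r.
  have cabsR (x : R) : cabs x%:C = `|x|.
    have [x0|x0] := leP 0 x; first by rewrite cabs_real // ger0_norm.
    rewrite -cabsN -rmorphN /= cabs_real ?ltr0_norm//; lra.
  by rewrite !cabsR.
have := abs_le (u i - (a +i* b)%C); rewrite ReB ImB /=; lra.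
Qed.

(** * Banach duals *)

Section BoundedDual.
Variables (R : realType) (V : lmodType R[i]) (q : V -> R).

(* The absolute value makes this meaningful for an arbitrary [q], so that no
   proof that [q] is a seminorm has to be carried by the type. *)
Definition q_bounded : {pred (V -> R[i]^o)} := fun f =>
  `[< linear f /\ exists M, forall x, cabs (f x) <= M * `|q x| >].

Fact q_bounded_submod_closed : submod_closed q_bounded.
Proof.
split=> [|a f g /asboolP[lf [M fM]] /asboolP[lg [M' gM]]]; apply/asboolP.
  split=> [b x y|]; first by rewrite scaler0 addr0.
  by exists 0 => x; rewrite cabs0 mul0r.
split=> [b x y|].
  rewrite !fctE /= lf lg !scalerDr addrACA; congr (_ + _ + _).
  by rewrite !scalerA mulrC.
exists (cabs a * M + M') => x; rewrite !fctE; apply: le_trans (cabsD _ _) _.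
rewrite mulrDl lerD // cabsM -mulrA ler_wpM2l ?cabs_ge0 //; exact: fM.
Qed.

HB.instance Definition _ := GRing.isSubmodClosed.Build R[i] (V -> R[i]^o)
  q_bounded q_bounded_submod_closed.

Record bdual := BDual { bdual_val :> V -> R[i]^o; _ : bdual_val \in q_bounded }.

HB.instance Definition _ := [isSub for bdual_val].
HB.instance Definition _ := [Choice of bdual by <:].
HB.instance Definition _ := [SubChoice_isSubLmodule of bdual by <:].

Implicit Types f g : bdual.

Lemma bdual_ext f g : (forall x, f x = g x) -> f = g.
Proof. by move=> fg; apply: val_inj; apply/funext. Qed.

Lemma bdualD f g x : (f + g) x = f x + g x. Proof. by []. Qed.

Lemma bdualZ a f x : (a *: f) x = a *: f x. Proof. by []. Qed.

Lemma bdualB f g x : (f - g) x = f x - g x. Proof. by []. Qed.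

Lemma bdual_linear f : linear f.
Proof. by have /asboolP[] := valP f. Qed.

Definition bdual_bounds f := [set M | 0 <= M /\ forall x, cabs (f x) <= M * `|q x|].

Definition bdual_rnorm f : R := inf (bdual_bounds f).

Let bounds_ne f : bdual_bounds f !=set0.
Proof.
have /asboolP[_ [M fM]] := valP f; exists `|M|; split=> //= x.
apply: le_trans (fM x) _; rewrite ler_wpM2r //; exact: ler_norm.
Qed.

Let bounds_lb f : has_lbound (bdual_bounds f).
Proof. by exists 0 => M []. Qed.

Lemma bdual_rnorm_le f M : 0 <= M -> (forall x, cabs (f x) <= M * `|q x|) ->
  bdual_rnorm f <= M.
Proof. by move=> M0 fM; apply: ge_inf. Qed.

Lemma bdual_rnormP f x : cabs (f x) <= bdual_rnorm f * `|q x|.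
Proof.
apply/ler_addgt0Pr => e e0.
have q1 : 0 < `|q x| + 1 by have := normr_ge0 (q x); lra.
have [|M [M0 fM] Mlt] := @inf_lt _ _ (bdual_rnorm f + e / (`|q x| + 1)) (bounds_ne f).
  by rewrite ltrDl divr_gt0.
apply: le_trans (fM x) _.
have : e / (`|q x| + 1) * `|q x| <= e.
  by rewrite mulrAC ler_pdivrMr //; nra.
have := normr_ge0 (q x); nra.
Qed.

Lemma bdual_rnorm_ge0 f : 0 <= bdual_rnorm f.
Proof. by apply: lb_le_inf => // M []. Qed.

Fact seminorm_bdual : seminorm bdual_rnorm.
Proof.
apply: seminorm_subhomogeneous => [|f g|a f]; first exact: bdual_rnorm_ge0.
  apply: bdual_rnorm_le => [|x]; first by rewrite addr_ge0 ?bdual_rnorm_ge0.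
  rewrite bdualD; apply: le_trans (cabsD _ _) _.
  by rewrite mulrDl lerD ?bdual_rnormP.
apply: bdual_rnorm_le => [|x]; first by rewrite mulr_ge0 ?cabs_ge0 ?bdual_rnorm_ge0.
by rewrite bdualZ cabsM -mulrA ler_wpM2l ?cabs_ge0 ?bdual_rnormP.
Qed.

Definition bdual_norm f : R[i] := (bdual_rnorm f)%:C.

Fact bdual_norm_triangle f g : bdual_norm (f + g) <= bdual_norm f + bdual_norm g.
Proof. by rewrite /bdual_norm -rmorphD lecR seminorm_bdual.1. Qed.

Fact bdual_normZ a f : bdual_norm (a *: f) = `|a| * bdual_norm f.
Proof. by rewrite /bdual_norm seminorm_bdual.2 rmorphM /= -cabsE. Qed.

Fact bdual_norm0 f : bdual_norm f = 0 -> f = 0.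
Proof.
move=> /(@complexI R) f0; apply: bdual_ext => x; apply: cabs0_eq0; apply/eqP.
rewrite eq_le cabs_ge0 andbT; apply: le_trans (bdual_rnormP _ _) _.
by rewrite f0 mul0r.
Qed.

HB.instance Definition _ := Lmodule_isNormed.Build R[i] bdual
  bdual_norm_triangle bdual_normZ bdual_norm0.

Lemma rnorm_bdual f : rnorm f = bdual_rnorm f.
Proof. by []. Qed.

(** Convergence to the pointwise limit [g] is uniform relative to [q], which passes linearity and
    boundedness on to [g]. *)
Lemma bdual_cauchy_cvg (u : nat -> bdual) :
  (forall e, 0 < e -> exists N, forall i j, (N <= i)%N -> (N <= j)%N ->
    bdual_rnorm (u i - u j) < e) ->
  exists f, forall e, 0 < e -> exists N, forall i, (N <= i)%N ->
    bdual_rnorm (u i - f) <= e.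
Proof.
move=> cu.
have pt x : exists z : R[i]^o, seminorm_cvg (fun n => u n x) z.
  apply: frechet_cauchy_cvg; first exact: frechet_scalars.
  move=> p e cp e0.
  pose c := p 1 * `|q x| + 1.
  have p1 := seminorm_ge0 (csn_seminorm cp) 1.
  have c0 : 0 < c by rewrite /c ltr_wpDl // mulr_ge0.
  have [N uN] := cu _ (divr_gt0 e0 c0); exists N => i j Ni Nj.
  rewrite (csn_scalar cp); apply: le_lt_trans (_ : _ <= p 1 * (e / c * `|q x|)) _.
    rewrite ler_wpM2l // -bdualB; apply: le_trans (bdual_rnormP _ _) _.
    by rewrite ler_wpM2r // ltW // uN.
  have ec : e / c * c = e by rewrite divfK // gt_eqF.
  have : 0 < e / c by rewrite divr_gt0.
  move: ec; set k := e / c => <-; rewrite /c; lra.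
have {pt} /choice[g gP] := pt.
have gN e : 0 < e -> exists N, forall i, (N <= i)%N -> forall x,
    cabs (u i x - g x) <= e * `|q x|.
  move=> e0; have [N uN] := cu e e0; exists N => i Ni x.
  have := seminorm_cvg_le (csn_cabs R) (seminorm_cvgB (u i x) (gP x)).
  rewrite (seminorm_distC (@seminorm_cabs R)); apply; exists N => j Nj.
  rewrite -bdualB; apply: le_trans (bdual_rnormP _ _) _.
  by rewrite ler_wpM2r // ltW // uN.
have lg : linear g.
  move=> a x y.
  apply/eqP; rewrite -subr_eq0; apply/eqP/cabs0_eq0/eqP.
  rewrite eq_le cabs_ge0 andbT; apply/ler_addgt0Pr => e e0; rewrite add0r.
  (* Replacing [g] by [u N] costs [e / c] times each of the first three summands; these errors add
     up to at most [e]. *)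
  pose c := `|q (a *: x + y)| + cabs a * `|q x| + `|q y| + 1.
  have c0 : 0 < c.
    by rewrite /c ltr_wpDl // !addr_ge0 // mulr_ge0 // cabs_ge0.
  have [N uN] := gN _ (divr_gt0 e0 c0).
  have h1 := uN N (leqnn _) (a *: x + y); have h2 := uN N (leqnn _) x.
  have h3 := uN N (leqnn _) y.
  have -> : g (a *: x + y) - (a *: g x + g y) = (a *: (u N x - g x) +
      (u N y - g y)) - (u N (a *: x + y) - g (a *: x + y)).
    rewrite (bdual_linear (u N)) scalerBr [in RHS]addrACA -[in RHS]opprD.
    by rewrite [in RHS]opprB [RHS]addrC subrKA.
  have ec : e / c * c = e by rewrite divfK // gt_eqF.
  have := mulr_ge0 (cabs_ge0 a) (normr_ge0 (q x)).
  have : cabs (a *: (u N x - g x)) <= cabs a * (e / c * `|q x|).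
    by rewrite cabsM ler_wpM2l ?cabs_ge0.
  have ec0 : 0 < e / c by rewrite divr_gt0.
  have := cabsD (a *: (u N x - g x) + (u N y - g y))
    (- (u N (a *: x + y) - g (a *: x + y))).
  have := cabsD (a *: (u N x - g x)) (u N y - g y).
  move: ec h1 h2 h3 ec0; set k := e / c => <- h1 h2 h3 ec0; rewrite cabsN /c; lra.
have [N0 uN0] := gN _ ltr01.
have gb : (g : V -> R[i]^o) \in q_bounded.
  apply/asboolP; split=> //; exists (bdual_rnorm (u N0) + 1) => x.
  rewrite -[g x](subKr (u N0 x)); apply: le_trans (cabsD _ _) _.
  by rewrite cabsN mulrDl lerD ?bdual_rnormP // uN0.
exists (BDual gb) => e e0; have [N uN] := gN _ e0; exists N => i Ni.
by apply: bdual_rnorm_le => [|x]; [exact: ltW | rewrite bdualB; exact: uN].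
Qed.

Lemma bdual_frechet : frechet_space bdual.
Proof.
apply: (@frechet_space_seminorms R bdual (fun=> @rnorm R bdual)) => [_|U U0|x x0|u cu].
- exact: csn_rnorm.
- by have [e e0 eU] := nbhs0_rnorm U0; exists 0%N, e; split.
- by apply/eqP; rewrite -normr_eq0 rnormE (x0 0%N).
have [f uf] := bdual_cauchy_cvg (cu 0%N).
exists f => _ e e0; have e20 : 0 < e / 2 by rewrite divr_gt0.
have [N uN] := uf _ e20; exists N => i Ni; rewrite rnorm_bdual.
by apply: le_lt_trans (uN i Ni) _; lra.
Qed.

Fact bdual_complete (F : set_system bdual) : ProperFilter F -> cauchy F -> cvg F.
Proof.
move=> PF cF; have [_ _ cplt] := bdual_frechet.
have [|f Ff] := cplt F PF; last by apply/cvg_ex; exists f.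
move=> U /nbhs0_rnorm[e e0 eU].
have /cauchy_ballP/(_ (e / 2)%:C) := cF; rewrite ltcR divr_gt0 // => /(_ isT).
move=> [[B1 B2] /= [F1 F2] B12]; exists (B1 `&` B2); first exact: filterI.
have ball_lt f g : B1 f -> B2 g -> rnorm (f - g) < e / 2.
  by move=> f1 g2; have := B12 (f, g) (conj f1 g2);
    rewrite /= -ball_normE /= rnormE ltcR.
move=> f g [f1 f2] [g1 g2]; apply: eU; apply: lt_trans (ball_lt _ _ f1 g2) _.
lra.
Qed.

HB.instance Definition _ := Uniform_isComplete.Build bdual bdual_complete.

End BoundedDual.

Arguments bdual {R V} q.

(** * Strong continuity and joint bounds *)

Section StrongContinuity.
Variables (R : realType) (A X : tvsType R[i]) (D : A -> (X -> R[i]^o)).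
Hypothesis lD : linear D.

Lemma linear_eval x : linear (fun a => D a x : R[i]^o).
Proof. by move=> c a b; rewrite lD. Qed.

Lemma continuous_strong (p : A -> R) (q : X -> R) : csn p -> csn q ->
  (forall a x, cabs (D a x) <= p a * q x) -> continuous (D : A -> strong_space X).
Proof.
move=> cp cq Dpq a; apply/fam_cvgP => B bB P /uniform_nbhs[E [entE EP]].
have : nbhs a [set a' | forall x, B x -> E (D a x, D a' x)]; last first.
  by apply: filterS => a' h; exact: EP.
move: entE; rewrite -entourage_ballE => -[e0 /= /gt0c_real[e e_gt0 ->] eE].
have [r0 /gt0c_real[r r_gt0 ->] rB] := bB _ (cq.2 _ (@ltr01 R)).
have rq x : B x -> q x <= r.
  have /rB h : r%:C <= `|r%:C| :> R[i] by rewrite cabsE cabs_real // ltW.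
  move=> /h[y /= y1 <-]; rewrite (seminorm_scale_real (csn_seminorm cq)) ?ltW//.
  nra.
apply/nbhs_csn; exists (fun a => r / e * p a).
  by apply: csnZ => //; rewrite divr_ge0 // ltW.
move=> a' a'p x Bx; apply: eE => /=; rewrite /ball /= -normrN opprB.
have -> : D a' x - D a x = D (a' - a) x by rewrite -(linB (linear_eval x)).
rewrite cabsE ltcR; apply: le_lt_trans (Dpq _ _) _.
have p0 := seminorm_ge0 (csn_seminorm cp) (a' - a).
apply: le_lt_trans (ler_wpM2l p0 (rq _ Bx)) _.
by move: a'p; rewrite mulrAC ltr_pdivrMr// mul1r mulrC.
Qed.

(** If every bound failed, there would be pairs (a_n, x_n), small for the n-th seminorms, with
    [D a_n x_n] of modulus above 1. The x_n form a bounded set and the a_n tend to 0, against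
    continuity at 0 for uniform convergence on bounded sets. *)
Lemma strong_continuous_bound : frechet_space A -> frechet_space X ->
  (forall a, linear (D a)) -> continuous (D : A -> strong_space X) ->
  exists p q, [/\ csn p, csn q & forall a x, cabs (D a x) <= p a * q x].
Proof.
move=> fA fX lDa cD.
have [p [cp mp dp]] := frechet_basis fA; have [q [cq mq dq]] := frechet_basis fX.
have sp n := csn_seminorm (cp n); have sq n := csn_seminorm (cq n).
suff [n hn] : exists n, forall a x, 2 ^+ n * p n a < 1 -> q n x < 1 ->
    cabs (D a x) <= 1.
  have c2 : csn (fun a => 2 ^+ n * p n a) by apply: csnZ => //; rewrite exprn_ge0.
  exists (fun a => 2 ^+ n * p n a), (q n); split=> //.
  apply: (@bilinear_seminorm_scale _ _ _ _ (D : A -> X -> R[i]^o)) => //.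
  - by split=> [a|x]; [exact: lDa | exact: linear_eval].
  - exact: csn_seminorm c2.
  - exact: seminorm_cabs.
apply: contrapT => /forallNP nb.
have /choice[z zP] : forall n, exists z : A * X,
    [/\ 2 ^+ n * p n z.1 < 1, q n z.2 < 1 & 1 < cabs (D z.1 z.2)].
  move=> n; apply: contrapT => nz; apply: (nb n) => a x pa qx.
  by rewrite leNgt; apply/negP => lt; apply: nz; exists (a, x).
pose B := [set (z n).2 | n in setT].
have bB : tvs_bounded B.
  move=> U /csn_gauge[s cs sU]; have [m sm] := dq _ cs.
  (* The sum covers the first [m] points, the 1 all later ones. *)
  pose M := \sum_(i < m) q m (z i).2 + 1.
  have sum0 : 0 <= \sum_(i < m) q m (z i).2.
    by apply: sumr_ge0 => i _; exact: seminorm_ge0.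
  have M0 : 0 < M by rewrite /M; lra.
  have qM n : q m (z n).2 <= M.
    have [nm|mn] := ltnP n m.
      rewrite /M (bigD1 (Ordinal nm)) //= -addrA lerDl addr_ge0 //.
      by apply: sumr_ge0 => i _; exact: seminorm_ge0.
    have [_ h _] := zP n; have := mq _ _ mn (z n).2; rewrite /M; lra.
  exists (2 * M)%:C => [|t]; first by rewrite ltcR mulr_gt0.
  rewrite cabsE lecR => tM _ [n _ <-].
  have t0 : t != 0 by rewrite -cabs_gt0; lra.
  exists (t^-1 *: (z n).2); last by rewrite scalerA divff // scale1r.
  apply: sU; rewrite (csn_seminorm cs).2 cabsV mulrC ltr_pdivrMr ?cabs_gt0// mul1r.
  have := qM n; have := sm (z n).2; lra.
have D0 : D 0 = 0 by exact: (lin0 lD).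
pose E : set (R[i]^o * R[i]^o) := [set zw | ball zw.1 (1 : R[i]) zw.2].
have entE : entourage E by rewrite -entourage_ballE; exists 1 => //=; exact: ltr01.
have := cD 0 _ (fam_nbhs (D 0 : strong_space X) entE bB).
move=> /nbhs_csn[s cs sD].
have [m sm] := dp _ cs.
have [pm _ Dm] := zP m.
have p0 := seminorm_ge0 (sp m) (z m).1.
have : s ((z m).1 - 0) < 1.
  rewrite subr0; apply: le_lt_trans (sm _) _; apply: le_lt_trans pm.
  by rewrite ler_peMl // exprn_ege1 //; lra.
move=> /sD /= /(_ (z m).2); rewrite /E /ball /= D0 => h.
have /h : B (z m).2 by exists m.
by rewrite sub0r normrN cabsE (ltcR _ 1) => /(lt_trans Dm); rewrite ltxx.
Qed.

End StrongContinuity.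

(** * Unitizations and bimodules *)

Section UnitizationActions.
Variables (R : realType) (A : tvsType R[i]) (mul : A -> A -> A).
Hypotheses (bmul : bilinear_map mul) (amul : associative mul).

Lemma unitization_mulA : associative (unitization_mul mul).
Proof.
have [ll lr] := bmul.
move=> [a x] [b y] [c z]; rewrite /unitization_mul /=; congr (_, _); last exact: mulrA.
rewrite !(linD (ll _)) !(linD (lr _)) !(linZ (ll _)) !(linZ (lr _)) amul.
rewrite !scalerDr !scalerA (mulrC z x) (mulrC z y).
by rewrite !addrA [LHS](ACl (1*4*2*5*3*6*7)).
Qed.

Lemma unitization_mul_bilinear : bilinear_map (unitization_mul mul).
Proof.
have [ll lr] := bmul; split=> [u a v w|v a u w].
  congr (_, _) => /=.
    rewrite (linD (ll _)) (linZ (ll _)) scalerDl !scalerDr !scalerA.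
    by rewrite (mulrC u.2) !addrA [LHS](ACl (1*3*5*2*4*6)).
  by rewrite mulrDr /GRing.scale /= mulrCA.
congr (_, _) => /=.
  rewrite (linD (lr _)) (linZ (lr _)) scalerDl !scalerDr !scalerA.
  by rewrite (mulrC v.2) !addrA [LHS](ACl (1*3*5*2*4*6)).
by rewrite mulrDl /GRing.scale /= mulrA.
Qed.

Lemma unitization_mul1r : left_id (0, 1) (unitization_mul mul).
Proof.
move=> [a x]; rewrite /unitization_mul /= (lin0 (bmul.2 _)) scaler0.
by rewrite addr0 add0r scale1r mul1r.
Qed.

Lemma unitization_mulr1 : right_id (0, 1) (unitization_mul mul).
Proof.
move=> [a x]; rewrite /unitization_mul /= (lin0 (bmul.1 _)) scaler0.
by rewrite add0r add0r scale1r mulr1.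
Qed.

(** Amenability regards the unitization as a bimodule over [A] and extends the two actions to the
    unitization again; the result is plain multiplication. *)
Lemma unitization_self_action a x b :
  unitization_ract (fun u c => unitization_mul mul u (c, 0))
    (unitization_lact (fun c u => unitization_mul mul (c, 0) u) a x) b =
  unitization_mul mul (unitization_mul mul a x) b.
Proof.
have [bul bur] := unitization_mul_bilinear; rewrite /unitization_ract /unitization_lact.
have split_unit (u : unitization A) : u = (u.1, 0) + u.2 *: (0, 1).
  case: u => u c; congr (_, _); rewrite /= ?scaler0 ?addr0 //.
  by rewrite add0r /GRing.scale /= mulr1.
have Ea y : unitization_mul mul (a.1, 0) y + a.2 *: y = unitization_mul mul a y.
  rewrite [in RHS](split_unit a).
  have /= := linD (bur y) (a.1, 0) (a.2 *: (0, 1)) => ->.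
  have /= := linZ (bur y) a.2 (0, 1) => ->.
  by rewrite unitization_mul1r.
have Eb y : unitization_mul mul y (b.1, 0) + b.2 *: y = unitization_mul mul y b.
  by rewrite [in RHS](split_unit b) (linD (bul y)) (linZ (bul y)) unitization_mulr1.
by rewrite Ea Eb.
Qed.

Variables (X : tvsType R[i]) (l : A -> X -> X) (r : X -> A -> X).
Hypotheses (bl : bilinear_map l) (br : bilinear_map r).
Hypotheses (lA : forall a b x, l (mul a b) x = l a (l b x))
  (rA : forall x a b, r x (mul a b) = r (r x a) b)
  (lrA : forall a x b, r (l a x) b = l a (r x b)).

Local Notation ul := (unitization_lact l).
Local Notation ur := (unitization_ract r).

Lemma unitization_lact_bilinear : bilinear_map ul.
Proof.
have [ll lr] := bl; split=> [u c x y|x c u v]; rewrite /unitization_lact /=.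
  by rewrite (linD (ll _)) (linZ (ll _)) !scalerDr addrACA !scalerA (mulrC c).
by rewrite (linD (lr _)) (linZ (lr _)) scalerDl scalerDr addrACA !scalerA.
Qed.

Lemma unitization_ract_bilinear : bilinear_map ur.
Proof.
have [ll lr] := br; split=> [x c u v|u c x y]; rewrite /unitization_ract /=.
  by rewrite (linD (ll _)) (linZ (ll _)) scalerDl scalerDr addrACA !scalerA.
by rewrite (linD (lr _)) (linZ (lr _)) !scalerDr addrACA !scalerA (mulrC c).
Qed.

Lemma unitization_lactA u v x : ul (unitization_mul mul u v) x = ul u (ul v x).
Proof.
have [ll lr] := bl; rewrite /unitization_lact /=.
rewrite !(linD (lr _)) !(linZ (lr _)) lA (linD (ll _)) (linZ (ll _)) scalerDr scalerA.
by rewrite !addrA [LHS](ACl (1*3*2*4)).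
Qed.

Lemma unitization_ractA x u v : ur x (unitization_mul mul u v) = ur (ur x u) v.
Proof.
have [ll lr] := br; rewrite /unitization_ract /=.
rewrite !(linD (ll _)) !(linZ (ll _)) rA (linD (lr _)) (linZ (lr _)) scalerDr scalerA.
by rewrite !addrA (mulrC u.2).
Qed.

Lemma unitization_lractA u x v : ur (ul u x) v = ul u (ur x v).
Proof.
rewrite /unitization_lact /unitization_ract.
rewrite (linD (br.2 _)) (linZ (br.2 _)) (linD (bl.1 _)) (linZ (bl.1 _)) lrA.
by rewrite !scalerDr addrACA !scalerA (mulrC u.2).
Qed.

Lemma unitization_lact1 x : ul (0, 1) x = x.
Proof. by rewrite /unitization_lact /= (lin0 (bl.2 _)) add0r scale1r. Qed.

Lemma unitization_ract1 x : ur x (0, 1) = x.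
Proof. by rewrite /unitization_ract /= (lin0 (br.1 _)) add0r scale1r. Qed.

Lemma unitization_lact0 a x : ul (a, 0) x = l a x.
Proof. by rewrite /unitization_lact /= scale0r addr0. Qed.

Lemma unitization_ract0 a x : ur x (a, 0) = r x a.
Proof. by rewrite /unitization_ract /= scale0r addr0. Qed.

Lemma unitization_lact_continuous : jointly_continuous l -> jointly_continuous ul.
Proof.
move=> cl; apply: bilinear_continuous_csn; first exact: unitization_lact_bilinear.
move=> q cq; have [p1 [p2 [c1 c2 pq]]] := bilinear_csn bl cl cq.
exists (fun u => p1 u.1 + cabs u.2), (fun x => p2 x + q x); split.
- by apply: csnD; [exact: csn_fst | exact/csn_snd/csn_cabs].
- exact: csnD.
move=> u x; apply: le_trans ((csn_seminorm cq).1 _ _) _.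
rewrite (csn_seminorm cq).2; have := pq u.1 x.
have := seminorm_ge0 (csn_seminorm c1) u.1; have := seminorm_ge0 (csn_seminorm c2) x.
have := seminorm_ge0 (csn_seminorm cq) x; have := cabs_ge0 u.2; nra.
Qed.

Lemma unitization_ract_continuous : jointly_continuous r -> jointly_continuous ur.
Proof.
move=> cr; apply: bilinear_continuous_csn; first exact: unitization_ract_bilinear.
move=> q cq; have [p1 [p2 [c1 c2 pq]]] := bilinear_csn br cr cq.
exists (fun x => p1 x + q x), (fun u => p2 u.1 + cabs u.2); split.
- exact: csnD.
- by apply: csnD; [exact: csn_fst | exact/csn_snd/csn_cabs].
move=> x u; apply: le_trans ((csn_seminorm cq).1 _ _) _.
rewrite (csn_seminorm cq).2; have := pq x u.1.
have := seminorm_ge0 (csn_seminorm c1) x; have := seminorm_ge0 (csn_seminorm c2) u.1.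
have := seminorm_ge0 (csn_seminorm cq) x; have := cabs_ge0 u.2; nra.
Qed.

End UnitizationActions.

Section UnitizationAlgebra.
Variables (R : realType) (A : tvsType R[i]) (mul : A -> A -> A).

Lemma frechet_unitization : frechet_space A -> frechet_space (unitization A).
Proof. by move=> fA; apply: frechet_prod => //; exact: frechet_scalars. Qed.

Lemma unitization_mul_continuous : frechet_algebra mul ->
  jointly_continuous (unitization_mul mul).
Proof.
move=> [_ bm _ cm]; apply: bilinear_continuous_csn.
  exact: unitization_mul_bilinear.
move=> q cq; have [q1 [q2 [cq1 cq2 qq]]] := csn_prod_le cq.
have [p1 [p2 [c1 c2 pq]]] := bilinear_csn bm cm cq1.
(* The summand [q2 1] takes care of the product of the scalar parts, the 1 of the mixed terms
   [x *: b] and [y *: a]. *)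
pose M := 1 + q2 1.
have q21 := seminorm_ge0 (csn_seminorm cq2) 1.
have cM : csn (fun z : R[i]^o => M * cabs z).
  by apply: csnZ; [rewrite /M; lra | exact: csn_cabs].
exists (fun u => p1 u.1 + q1 u.1 + M * cabs u.2),
  (fun u => p2 u.1 + q1 u.1 + M * cabs u.2); split.
- apply: csnD; last exact: (csn_snd A cM).
  by apply: csnD; apply: csn_fst.
- apply: csnD; last exact: (csn_snd A cM).
  by apply: csnD; apply: csn_fst.
move=> [a x] [b y]; apply: le_trans (qq _) _; rewrite /unitization_mul /=.
rewrite (csn_scalar cq2) cabsM.
have := pq a b.
have := (csn_seminorm cq1).1 (mul a b) (x *: b).
have := (csn_seminorm cq1).1 (mul a b + x *: b) (y *: a).
rewrite !(csn_seminorm cq1).2.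
have := seminorm_ge0 (csn_seminorm c1) a; have := seminorm_ge0 (csn_seminorm c2) b.
have := seminorm_ge0 (csn_seminorm cq1) a; have := seminorm_ge0 (csn_seminorm cq1) b.
have := cabs_ge0 x; have := cabs_ge0 y.
move: (p1 a) (p2 b) (q1 a) (q1 b) (cabs x) (cabs y) (q1 (mul a b)).
move=> P P' Q Q' x' y' m y0 x0 Q'0 Q0 P'0 P0 h1 h2 h3.
have e1 := mulr_ge0 P0 Q'0; have e2 := mulr_ge0 Q0 P'0; have e3 := mulr_ge0 Q0 Q'0.
have e4 := mulr_ge0 P0 y0; have e5 := mulr_ge0 x0 P'0.
have e6 := mulr_ge0 x0 y0; have e7 := mulr_ge0 x0 Q'0; have e8 := mulr_ge0 Q0 y0.
have f1 := mulr_ge0 q21 e4; have f2 := mulr_ge0 q21 e5; have f3 := mulr_ge0 q21 e6.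
have f4 := mulr_ge0 q21 e7; have f5 := mulr_ge0 q21 e8; have f6 := mulr_ge0 q21 f3.
rewrite /M; lra.
Qed.

Definition submultiplicative (p : A -> R) := forall a b, p (mul a b) <= p a * p b.

Hypothesis hA : frechet_arens_michael mul.

(** A neighbourhood of 0 involves finitely many of the given seminorms, and their maximum is again
    submultiplicative. *)
Lemma arens_michael_csn (s : A -> R) : csn s ->
  exists p C, [/\ csn p, submultiplicative p, 0 < C & forall a, s a <= C * p a].
Proof.
move=> cs; have [_ [I [p [pS pB]]]] := hA.
pose pr i a := complex.Re (p i a).
have pE i a : p i a = (pr i a)%:C.
  by have [p0 _ _ _] := pS i; rewrite /pr RRe_real // ger0_real.
have pr0 i a : 0 <= pr i a by have [p0 _ _ _] := pS i; rewrite -lecR -pE.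
have spr i : seminorm (pr i).
  have [_ pD pZ _] := pS i; split=> [a b|t a].
    by rewrite -lecR rmorphD /= -!pE.
  by apply: complexI; rewrite rmorphM /= -!pE -cabsE.
have cpr i : csn (pr i).
  split=> // e e0; apply/pB; exists [set i], e%:C; split=> //.
    by rewrite ltcR.
  by move=> a /(_ i erefl); rewrite pE ltcR.
have mpr i : submultiplicative (pr i).
  by have [_ _ _ pM] := pS i; move=> a b; rewrite -lecR rmorphM /= -!pE.
have [J [e0 [fJ /gt0c_real[e e_gt0 ->] JU]]] := (pB _).1 (cs.2 _ ltr01).
have [js jsE] := (@finite_seqP {classic I} J).1 fJ.
have [P [cP mP JP]] : exists P, [/\ csn P, submultiplicative P
    & forall i, i \in js -> forall a, pr i a <= P a].
  elim: js {jsE} => [|i js [P [cP mP JP]]].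
    by exists (fun=> 0); split; [exact: csn0 | by move=> a b; rewrite mulr0 | by []].
  have sP := csn_seminorm cP.
  exists (fun a => Num.max (pr i a) (P a)); split.
  - apply: (csn_le _ (csnD (cpr i) cP)) => [|a]; last first.
      by rewrite ge_max lerDl lerDr pr0 seminorm_ge0.
    split=> [a b|t a]; last by rewrite (spr i).2 sP.2 maxr_pMr ?cabs_ge0.
    rewrite ge_max; apply/andP; split.
      by apply: le_trans ((spr i).1 _ _) _; rewrite lerD // le_max lexx.
    by apply: le_trans (sP.1 _ _) _; rewrite lerD // le_max lexx orbT.
  - move=> a b; rewrite ge_max; apply/andP; split.
      apply: le_trans (mpr i _ _) _.
      by apply: ler_pM; rewrite ?pr0 // le_max lexx.
    apply: le_trans (mP _ _) _.
    by apply: ler_pM; rewrite ?seminorm_ge0 // le_max lexx orbT.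
  - move=> j; rewrite inE => /predU1P[->|/JP jP] a; first by rewrite le_max lexx.
    by rewrite le_max jP orbT.
exists P, e^-1; split=> //; first by rewrite invr_gt0.
have ei0 : 0 <= e^-1 by rewrite invr_ge0 ltW.
apply: (seminorm_le_scale (csn_seminorm cs) (seminormZ ei0 (csn_seminorm cP))).
move=> a; rewrite mulrC ltr_pdivrMr// mul1r => Pa; apply: JU => i Ji.
rewrite pE ltcR; apply: le_lt_trans Pa; apply: (JP (i : {classic I})).
by rewrite jsE in Ji.
Qed.

(** Adding the modulus of the scalar part preserves submultiplicativity and gives the identity the
    value 1. The constant [C] stays outside [p] because rescaling would destroy this
    normalization. *)
Lemma unitization_arens_michael (s : unitization A -> R) : csn s ->
  exists p C, [/\ csn p, 0 < C, forall u, s u <= C * p u, p (0, 1) = 1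
    & forall u v, p (unitization_mul mul u v) <= p u * p v].
Proof.
move=> cs; have [s1 [s2 [c1 c2 sle]]] := csn_prod_le cs.
have [p [C [cp mp C0 pC]]] := arens_michael_csn c1.
have sp := csn_seminorm cp.
have s21 := seminorm_ge0 (csn_seminorm c2) 1.
exists (fun u => p u.1 + cabs u.2), (C + s2 1); split.
- by apply: csnD; [exact: csn_fst | exact/csn_snd/csn_cabs].
- lra.
- move=> u; apply: le_trans (sle u) _; rewrite (csn_scalar c2).
  have := pC u.1; have := cabs_ge0 u.2; have := seminorm_ge0 sp u.1; nra.
- by rewrite /= (seminorm0 sp) cabs1 add0r.
move=> [a x] [b y] /=; rewrite cabsM.
have := sp.1 (mul a b + x *: b) (y *: a); have := sp.1 (mul a b) (x *: b).
rewrite !sp.2; have := mp a b; lra.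
Qed.

End UnitizationAlgebra.

(** * Bimodule structures on Banach duals *)

Section BoundedDualBimodule.
Variables (R : realType) (A : tvsType R[i]) (mul : A -> A -> A).
Variables (V : lmodType R[i]) (l : A -> V -> V) (r : V -> A -> V).
Hypotheses (bl : bilinear_map l) (br : bilinear_map r).
Hypotheses (lA : forall a b x, l (mul a b) x = l a (l b x))
  (rA : forall x a b, r x (mul a b) = r (r x a) b)
  (lrA : forall a x b, r (l a x) b = l a (r x b)).
Variables (q : V -> R) (p : A -> R).
Hypotheses (sq : seminorm q) (cp : csn p).
Hypotheses (lq : forall a x, q (l a x) <= p a * q x)
  (rq : forall x a, q (r x a) <= p a * q x).

Lemma bdual_of (f : V -> R[i]^o) M : linear f ->
  (forall x, cabs (f x) <= M * q x) -> exists g : bdual q, forall x, g x = f x.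
Proof.
move=> lf fM; have fq : f \in q_bounded q.
  by apply/asboolP; split=> //; exists M => x; rewrite ger0_norm ?seminorm_ge0.
by exists (BDual fq).
Qed.

Lemma bdual_rnorm_bound (f : bdual q) x : cabs (f x) <= bdual_rnorm f * q x.
Proof. by have := bdual_rnormP f x; rewrite ger0_norm // seminorm_ge0. Qed.

Lemma bdual_rnorm_ub (f : bdual q) M : 0 <= M ->
  (forall x, cabs (f x) <= M * q x) -> bdual_rnorm f <= M.
Proof.
move=> M0 fM; apply: bdual_rnorm_le => // x.
by rewrite ger0_norm ?seminorm_ge0.
Qed.

(** [V] is only a vector space with a compatible seminorm, so that the construction applies to (X,
    q), then to the resulting dual itself, and to the unitization. The bounds by [p] in the
    conclusion are what allows the iteration. *)
Lemma bdual_bimodule : exists (L : A -> bdual q -> bdual q)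
    (M : bdual q -> A -> bdual q),
  [/\ topological_bimodule mul L M, forall a f x, L a f x = f (r x a),
      forall f a x, M f a x = f (l a x),
      forall a f, bdual_rnorm (L a f) <= p a * bdual_rnorm f
    & forall f a, bdual_rnorm (M f a) <= p a * bdual_rnorm f].
Proof.
have sp := csn_seminorm cp.
have [bl1 bl2] := bl; have [br1 br2] := br.
have /choice[L0 hL0] : forall z : A * bdual q, exists g : bdual q,
    forall x, g x = z.2 (r x z.1).
  move=> [a f] /=; apply: (@bdual_of _ (bdual_rnorm f * p a)) => [c x y|x].
    by rewrite (linD (br2 _)) (linZ (br2 _)) (bdual_linear f).
  apply: le_trans (bdual_rnorm_bound _ _) _; rewrite -mulrA.
  by rewrite ler_wpM2l ?bdual_rnorm_ge0.
have /choice[M0 hM0] : forall z : bdual q * A, exists g : bdual q,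
    forall x, g x = z.1 (l z.2 x).
  move=> [f a] /=; apply: (@bdual_of _ (bdual_rnorm f * p a)) => [c x y|x].
    by rewrite (linD (bl1 _)) (linZ (bl1 _)) (bdual_linear f).
  apply: le_trans (bdual_rnorm_bound _ _) _; rewrite -mulrA.
  by rewrite ler_wpM2l ?bdual_rnorm_ge0.
pose L a f := L0 (a, f); pose M f a := M0 (f, a).
have LE a f x : L a f x = f (r x a) by exact: hL0.
have ME f a x : M f a x = f (l a x) by exact: hM0.
have Lle a f : bdual_rnorm (L a f) <= p a * bdual_rnorm f.
  apply: bdual_rnorm_ub => [|x]; first by rewrite mulr_ge0 ?bdual_rnorm_ge0 ?seminorm_ge0.
  rewrite LE; apply: le_trans (bdual_rnorm_bound _ _) _.
  by rewrite [p a * _]mulrC -mulrA ler_wpM2l ?bdual_rnorm_ge0.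
have Mle f a : bdual_rnorm (M f a) <= p a * bdual_rnorm f.
  apply: bdual_rnorm_ub => [|x]; first by rewrite mulr_ge0 ?bdual_rnorm_ge0 ?seminorm_ge0.
  rewrite ME; apply: le_trans (bdual_rnorm_bound _ _) _.
  by rewrite [p a * _]mulrC -mulrA ler_wpM2l ?bdual_rnorm_ge0.
have bL : bilinear_map L.
  split=> [a c f g|f c a b]; apply: bdual_ext => x.
    by rewrite bdualD bdualZ !LE.
  rewrite bdualD bdualZ !LE (linD (br1 _)) (linZ (br1 _)).
  exact: (bdual_linear f).
have bM : bilinear_map M.
  split=> [f c a b|a c f g]; apply: bdual_ext => x; last first.
    by rewrite bdualD bdualZ !ME.
  rewrite bdualD bdualZ !ME (linD (bl2 _)) (linZ (bl2 _)).
  exact: (bdual_linear f).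
exists L, M; split=> //; split=> //.
- by move=> a b f; apply: bdual_ext => x; rewrite !LE rA.
- by move=> f a b; apply: bdual_ext => x; rewrite !ME lA.
- by move=> a f b; apply: bdual_ext => x; rewrite ME !LE ME lrA.
split; apply: bilinear_continuous_csn => // s /csn_le_rnorm[K K0 sK].
  exists (fun a => K * p a), (@rnorm R (bdual q)); split.
  - by apply: csnZ => //; exact: ltW.
  - exact: csn_rnorm.
  move=> a f; apply: le_trans (sK _) _; rewrite -mulrA; apply: ler_wpM2l.
    exact: ltW.
  exact: Lle.
exists (@rnorm R (bdual q)), (fun a => K * p a); split.
- exact: csn_rnorm.
- by apply: csnZ => //; exact: ltW.
move=> f a; apply: le_trans (sK _) _; rewrite mulrCA; apply: ler_wpM2l.
  exact: ltW.
by rewrite mulrC; exact: Mle.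
Qed.

End BoundedDualBimodule.

(** * Reduction of Fréchet bimodules to Banach bimodules *)

Section BimoduleSeminorms.
Variables (R : realType) (A : tvsType R[i]) (mul : A -> A -> A).
Variables (X : tvsType R[i]) (l : A -> X -> X) (r : X -> A -> X).
Hypotheses (hA : frechet_arens_michael mul) (hX : topological_bimodule mul l r).

(* Over an Arens-Michael algebra the seminorm [q] of a bimodule can be replaced
   by the larger [sup q (b x c) / (p b * p c)] over the unitization, which is
   compatible with a submultiplicative [p]. *)
Lemma bimodule_seminorm (s : A -> R) (q : X -> R) : csn s -> csn q ->
  exists (p : A -> R) (C : R) (q' : X -> R),
    [/\ csn p, 0 < C, forall a, s a <= C * p a, csn q' & forall x, q x <= q' x] /\
    (forall a x, q' (l a x) <= p a * q' x) /\
    (forall x a, q' (r x a) <= p a * q' x).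
Proof.
move=> cs cq; have [[bl br] lA rA lrA [cl cr]] := hX.
have [[_ bm am _] _] := hA.
have bul := unitization_lact_bilinear bl; have bur := unitization_ract_bilinear br.
pose ul := unitization_lact l; pose ur := unitization_ract r.
have [p1 [q1 [cp1 cq1 h1]]] := bilinear_csn bul (unitization_lact_continuous bl cl) cq.
have [q2 [p2 [cq2 cp2 h2]]] := bilinear_csn bur (unitization_ract_continuous br cr) cq1.
have [p [C [cp C0 pC p01 pM]]] :=
  unitization_arens_michael hA (csnD (csn_fst R[i]^o cs) (csnD cp1 cp2)).
have sp := csn_seminorm cp; have sq := csn_seminorm cq.
have p1C u : p1 u <= C * p u.
  apply: le_trans (pC u); have := seminorm_ge0 (csn_seminorm cs) u.1.
  have := seminorm_ge0 (csn_seminorm cp2) u; lra.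
have p2C u : p2 u <= C * p u.
  apply: le_trans (pC u); have := seminorm_ge0 (csn_seminorm cs) u.1.
  have := seminorm_ge0 (csn_seminorm cp1) u; lra.
have sC a : s a <= C * p (a, 0).
  apply: le_trans (pC _); rewrite /=.
  have := seminorm_ge0 (csn_seminorm cp1) ((a, 0) : unitization A).
  have := seminorm_ge0 (csn_seminorm cp2) ((a, 0) : unitization A); lra.
(* The infimum of the admissible constants replaces a supremum of quotients whose denominators may
   vanish. *)
pose S x := [set M | 0 <= M /\ forall b c, q (ul b (ur x c)) <= M * (p b * p c)].
pose q' x := inf (S x).
have p_ge0 u : 0 <= p u by exact: seminorm_ge0.
have pp_ge0 b c : 0 <= p b * p c by rewrite mulr_ge0.
have q20 x : 0 <= q2 x by exact: seminorm_ge0 (csn_seminorm cq2) x.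
have S_q2 x : S x (C * C * q2 x).
  split=> [|b c]; first by rewrite !mulr_ge0 // ltW.
  apply: le_trans (h1 _ _) _.
  apply: le_trans (_ : _ <= C * p b * (q2 x * p2 c)) _.
    apply: ler_pM => //; first exact: seminorm_ge0 (csn_seminorm cp1) b.
    exact: seminorm_ge0 (csn_seminorm cq1) _.
  have -> : C * C * q2 x * (p b * p c) = C * p b * (q2 x * (C * p c)) by ring.
  by rewrite !ler_wpM2l // mulr_ge0 // ltW.
have S_ne x : S x !=set0 by exists (C * C * q2 x).
have S_lb x : has_lbound (S x) by exists 0 => M [].
have q'_le x M : S x M -> q' x <= M by exact: ge_inf.
have q'_ge0 x : 0 <= q' x by apply: lb_le_inf => // M [].
have S_q' x : S x (q' x).
  split=> // b c; apply/ler_addgt0Pr => e e0.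
  have pp1 : 0 < p b * p c + 1 by have := pp_ge0 b c; lra.
  have [|M [M0 hM] Mlt] := @inf_lt _ _ (q' x + e / (p b * p c + 1)) (S_ne x).
    by rewrite ltrDl divr_gt0.
  apply: le_trans (hM b c) _.
  have : e / (p b * p c + 1) * (p b * p c) <= e.
    by rewrite mulrAC ler_pdivrMr //; nra.
  have := pp_ge0 b c; nra.
have sq' : seminorm q'.
  apply: seminorm_subhomogeneous => // [x y|t x].
    apply: q'_le; split=> [|b c]; first by rewrite addr_ge0.
    rewrite /ul /ur (linD (bur.2 _)) (linD (bul.1 _)).
    apply: le_trans (sq.1 _ _) _; rewrite mulrDl.
    by apply: lerD; apply: (S_q' _).2.
  apply: q'_le; split=> [|b c]; first by rewrite mulr_ge0 // cabs_ge0.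
  rewrite /ul /ur (linZ (bur.2 _)) (linZ (bul.1 _)) sq.2 -mulrA.
  by rewrite ler_wpM2l ?cabs_ge0 //; exact: (S_q' x).2.
exists (fun a => p (a, 0)), C, q'; split; [split=> //|split].
- exact: csn_inl cp.
- have CC0 : 0 <= C * C by rewrite mulr_ge0 // ltW.
  exact: csn_le sq' (csnZ CC0 cq2) (fun x => q'_le _ _ (S_q2 x)).
- move=> x; have [_ h] := S_q' x; have := h (0, 1) (0, 1).
  by rewrite p01 !mulr1 /ul /ur (unitization_ract1 br) (unitization_lact1 bl).
- move=> a x; apply: q'_le; split=> [|b c]; first by rewrite mulr_ge0.
  have -> : ul b (ur (l a x) c) = ul (unitization_mul mul b (a, 0)) (ur x c).
    by rewrite /ul /ur -(unitization_lact0 l) (unitization_lractA bl br lrA)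
      (unitization_lactA bl lA).
  apply: le_trans ((S_q' x).2 _ _) _.
  have -> : p (a, 0) * q' x * (p b * p c) = q' x * (p b * p (a, 0) * p c) by ring.
  by rewrite ler_wpM2l // ler_wpM2r.
move=> x a; apply: q'_le; split=> [|b c]; first by rewrite mulr_ge0.
have -> : ul b (ur (r x a) c) = ul b (ur x (unitization_mul mul (a, 0) c)).
  by rewrite /ul /ur -(unitization_ract0 r) (unitization_ractA br rA).
apply: le_trans ((S_q' x).2 _ _) _.
have -> : p (a, 0) * q' x * (p b * p c) = q' x * (p b * (p (a, 0) * p c)) by ring.
by rewrite ler_wpM2l // ler_wpM2l.
Qed.

End BimoduleSeminorms.

(* A derivation into [X^*] factors through [Y^*] for a Banach bimodule [Y]: the
   bidual of [X] with respect to a bimodule seminorm. *)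
Lemma banach_derivations_frechet (R : realType) (A : tvsType R[i]) (mul : A -> A -> A) :
  frechet_arens_michael mul ->
  (forall (X : completeNormedModType R[i]) (l : A -> X -> X) (r : X -> A -> X),
     topological_bimodule mul l r -> continuous_derivations_inner mul l r) ->
  forall (X : tvsType R[i]) (l : A -> X -> X) (r : X -> A -> X),
    frechet_bimodule mul l r -> continuous_derivations_inner mul l r.
Proof.
move=> hA hB X l r [fX hX] D [dD lD DM] cD.
have fA : frechet_space A by have [[]] := hA.
have [s [q0 [cs cq0 Dsq]]] := strong_continuous_bound lD fA fX (fun a => (dD a).1) cD.
have [p [C [q [[cp C0 sC cq q0q] [lq rq]]]]] := bimodule_seminorm hA hX cs cq0.
have [[bl br] lA rA lrA _] := hX.
have sp := csn_seminorm cp; have sq := csn_seminorm cq.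
have Dpq a x : cabs (D a x) <= C * p a * q x.
  apply: le_trans (Dsq a x) _; apply: ler_pM => //.
    exact: seminorm_ge0 (csn_seminorm cs) _.
  exact: seminorm_ge0 (csn_seminorm cq0) _.
have [L [M [[[bL bM] LA MA LMA cLM] LE ME Lle Mle]]] :=
  bdual_bimodule bl br lA rA lrA sq cp lq rq.
have [L' [M' [hX' L'E M'E L'le M'le]]] :=
  bdual_bimodule bL bM LA MA LMA (seminorm_rnorm (bdual q)) cp Lle Mle.
have /choice[D0 D0E] : forall a, exists g : bdual q, forall x, g x = D a x.
  by move=> a; apply: (bdual_of sq (dD a).1 (Dpq a)).
have D0le a : bdual_rnorm (D0 a) <= C * p a.
  apply: (bdual_rnorm_ub sq) => [|x]; last by rewrite D0E.
  by rewrite mulr_ge0 ?seminorm_ge0 // ltW.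
have lD0 : linear D0.
  by move=> c a b; apply: bdual_ext => x; rewrite bdualD bdualZ !D0E lD.
have D0M a b : D0 (mul a b) = L a (D0 b) + M (D0 a) b.
  by apply: bdual_ext => x; rewrite bdualD LE ME !D0E DM.
(* [D a], placed in the dual of [X] as [D0 a], acts on the bidual by evaluation. *)
pose D' a (f : bdual (@rnorm R (bdual q))) : R[i]^o := f (D0 a).
have f_le (f : bdual (@rnorm R (bdual q))) g :
    cabs (f g) <= bdual_rnorm f * bdual_rnorm g.
  exact: bdual_rnorm_bound (seminorm_rnorm _) f g.
have lD' : linear D'.
  by move=> c a b; apply/funext => f; rewrite /D' lD0 (bdual_linear f).
have D'le a f : cabs (D' a f) <= C * p a * rnorm f.
  apply: le_trans (f_le _ _) _; rewrite mulrC ler_wpM2r ?D0le //.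
  exact: bdual_rnorm_ge0.
have [||f df fE] := hB _ L' M' hX' D'.
- split=> //.
    move=> a; apply: (@csn_dual _ _ _ (fun f => C * p a * rnorm f)) => //.
    apply: csnZ; first by rewrite mulr_ge0 ?seminorm_ge0 // ltW.
    exact: csn_rnorm.
  move=> a b; apply/funext => f.
  by rewrite !fctE /dual_lact /dual_ract /D' L'E M'E D0M (linD (bdual_linear f)).
- apply: (continuous_strong lD' (csnZ (ltW C0) cp) (csn_rnorm _)) => a f.
  exact: D'le.
(* The canonical map of [X] into the bidual. It intertwines the actions, so the functional [f]
   implementing [D'] pulls back to one implementing [D]. *)
have /choice[ev evE] : forall x, exists g : bdual (@rnorm R (bdual q)),
    forall h, g h = h x.
  move=> x; apply: (bdual_of (seminorm_rnorm _) (M := q x)) => // h.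
  by rewrite mulrC; exact: bdual_rnorm_bound.
have evle x : bdual_rnorm (ev x) <= q x.
  apply: (bdual_rnorm_ub (seminorm_rnorm _)) => [|h]; first exact: seminorm_ge0.
  by rewrite evE mulrC; exact: bdual_rnorm_bound.
have lev : linear ev.
  move=> c x y; apply: bdual_ext => h.
  by rewrite bdualD bdualZ !evE (bdual_linear h).
have [K K0 fK] := csn_le_rnorm (dual_csn df).
exists (f \o ev).
  apply: (@csn_dual _ _ _ (fun x => K * q x)).
  - by move=> c x y /=; rewrite lev (df.1 c).
  - by apply: csnZ => //; exact: ltW.
  - move=> x; apply: le_trans (fK _) _; apply: ler_wpM2l (evle x).
    exact: ltW.
move=> a; apply/funext => x.
have := congr1 (@^~ (ev x)) (fE a).
rewrite !fctE /dual_lact /dual_ract /D' evE D0E => ->; congr (f _ - f _).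
  by apply: bdual_ext => h; rewrite M'E !evE LE.
by apply: bdual_ext => h; rewrite L'E !evE ME.
Qed.

(** * Functionals on balanced tensor products *)

Section ClosedRange.
Variables (R : realType) (T1 T2 : tvsType R[i]) (F : T1 -> T2).
Variables (N1 : set T1) (N2 : set T2).
Hypotheses (fT1 : frechet_space T1) (fT2 : frechet_space T2).
Hypotheses (lF : linear F) (cF : continuous F).
Hypotheses (sN1 : subspace N1) (sN2 : subspace N2).
Hypothesis FN : forall u, N1 u -> N2 (F u).
Hypothesis dual_onto : forall H, dual T1 H -> (forall u, N1 u -> H u = 0) ->
  exists H2, [/\ dual T2 H2, forall v, N2 v -> H2 v = 0 & forall u, H2 (F u) = H u].

(* By the uniform boundedness principle the hypothesis makes the map induced by
   [F] on the quotients an embedding. *)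
Lemma quotient_embedding (q : T1 -> R) : csn q -> exists2 rho : T2 -> R, csn rho &
  forall u m, N2 m -> quotient_seminorm q N1 u <= rho (F u + m).
Proof.
move=> cq; have cqq := csn_quotient cq sN1; set qq := quotient_seminorm q N1 in cqq *.
have sqq := csn_seminorm cqq; have qq0 u : 0 <= qq u by exact: seminorm_ge0.
have [q2 [c2 m2 d2]] := frechet_basis fT2.
have s2 n := csn_seminorm (c2 n).
apply: contrapT => nrho.
(* If no bound holds, even [n%:R * q2 n] fails; normalization gives vectors of quotient seminorm [n]
   whose images stay within 1 of [N2] for [q2 n]. *)
have /choice[w wP] : forall n : nat, exists w : T1, qq w = n%:R /\
    exists2 m, N2 m & q2 n (F w + m) <= 1.
  move=> n; apply: contrapT => nw; apply: nrho.
  exists (fun v => n%:R * q2 n v); first exact: csnZ.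
  move=> u m Nm; rewrite leNgt; apply/negP => lt; apply: nw.
  have q2_0 := seminorm_ge0 (s2 n) (F u + m).
  have qu : 0 < qq u by apply: le_lt_trans lt; rewrite mulr_ge0.
  have c0 : 0 <= n%:R / qq u by rewrite divr_ge0.
  exists ((n%:R / qq u)%:C *: u); split.
    by rewrite (seminorm_scale_real sqq) // divfK // gt_eqF.
  exists ((n%:R / qq u)%:C *: m); first exact: subspaceZ.
  rewrite (linZ lF) -scalerDr (seminorm_scale_real (s2 n)) //.
  by rewrite mulrAC ler_pdivrMr // mul1r ltW.
(* Every functional in the dual for [qq] extends through [F] and is therefore bounded along [w]. The
   sets [C j] thus cover this Banach space, and Baire makes the bound uniform on a ball. *)
pose C (j : nat) := [set H : bdual qq | forall n, cabs (H (w n)) <= j%:R].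
have qqE u : `|qq u| = qq u by rewrite ger0_norm.
have Hle (H : bdual qq) u : cabs (H u) <= bdual_rnorm H * qq u.
  by have := bdual_rnormP H u; rewrite qqE.
have [|||j [H0 [p [e [cp e0 _ ball]]]]] :=
    @frechet_baire R _ (bdual_frechet qq) setT C 0.
- by [].
- by [].
- move=> H _; have dH : dual T1 H.
    apply: (@csn_dual _ _ _ (fun u => bdual_rnorm H * qq u)) => //.
      exact: bdual_linear.
    by apply: csnZ => //; exact: bdual_rnorm_ge0.
  have [|H2 [dH2 H2N H2F]] := dual_onto dH.
    move=> u Nu; apply/cabs0_eq0/eqP; rewrite eq_le cabs_ge0 andbT.
    apply: le_trans (Hle _ _) _.
    by rewrite /qq (quotient_seminorm_sub (csn_seminorm cq) sN1.1 sN1.2) // mulr0.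
  have [k H2k] := d2 _ (dual_csn dH2).
  pose M : R := \sum_(i < k) cabs (H (w i)) + 1.
  have M0 : 0 <= M by rewrite addr_ge0 // sumr_ge0 // => i _; exact: cabs_ge0.
  exists (Num.bound M) => // n; apply: le_trans (ltW (archi_boundP M0)).
  have [nk|kn] := ltnP n k.
    rewrite /M (bigD1 (Ordinal nk)) //= -addrA lerDl addr_ge0 //.
    by apply: sumr_ge0 => i _; exact: cabs_ge0.
  have [_ [m Nm qm]] := wP n.
  have -> : H (w n) = H2 (F (w n) + m) by rewrite (linD dH2.1) (H2N m) // addr0 H2F.
  apply: le_trans (H2k _) _; apply: le_trans (m2 _ _ kn _) _; apply: le_trans qm _.
  by rewrite /M lerDr sumr_ge0 // => i _; exact: cabs_ge0.
have clC H n : closure (C j) H -> cabs (H (w n)) <= j%:R.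
  move=> /closure_csn clH; apply/ler_addgt0Pr => d d0.
  have cev : csn (fun H : bdual qq => cabs (H (w n))).
    apply: (csn_le _ (csnZ (qq0 (w n)) (csn_rnorm (bdual qq)))) => [|H'].
      by split=> [f g|t f]; rewrite ?bdualD ?bdualZ ?cabsM ?cabsD.
    by rewrite mulrC; exact: Hle.
  have [H' CH' lt] := clH _ _ cev d0.
  rewrite -[H (w n)](subrK (H' (w n))); apply: le_trans (cabsD _ _) _.
  by rewrite addrC lerD ?CH' // -bdualB ltW.
have [K K0 pK] := csn_le_rnorm cp.
have small (H : bdual qq) n : rnorm H < e / K -> cabs (H (w n)) <= 2 * j%:R.
  move=> HK.
  have h1 : cabs ((H + H0) (w n)) <= j%:R.
    apply: clC; apply: ball => //; rewrite addrK; apply: le_lt_trans (pK _) _.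
    by rewrite mulrC -ltr_pdivlMr.
  have h2 : cabs (H0 (w n)) <= j%:R.
    by apply: clC; apply: ball => //; rewrite subrr (seminorm0 (csn_seminorm cp)).
  have -> : H (w n) = (H + H0) (w n) - H0 (w n) by rewrite bdualD addrK.
  by apply: le_trans (cabsD _ _) _; rewrite cabsN; lra.
pose c := e / K / 2.
have c0 : 0 < c by rewrite !divr_gt0.
(* A functional of norm at most [c] lies in the ball and takes the value [c * n%:R] at [w n] by
   Hahn-Banach, which for this [n] exceeds the uniform bound [2 * j%:R]. *)
pose n := Num.bound (2 * j%:R / c).
have nj : 2 * j%:R < c * n%:R.
  by rewrite [c * _]mulrC -ltr_pdivrMr // /n; apply: archi_boundP;
    rewrite divr_ge0 ?(ltW c0) // mulr_ge0 ?ler0n.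
have [f [lf fq fw]] := hahn_banach_point (w n) sqq.
have [h hE] : exists h : bdual qq, forall u, h u = c%:C *: f u.
  apply: (bdual_of (M := c) sqq) => [a u v|u].
    by rewrite lf scalerDr !scalerA mulrC.
  by rewrite cabsM cabs_real ?(ltW c0) // ler_wpM2l // ltW.
have hc : rnorm h <= c.
  apply: (bdual_rnorm_ub sqq) => [|u]; first exact: ltW.
  by rewrite hE cabsM cabs_real ?(ltW c0) // ler_wpM2l // ltW.
have hlt : rnorm h < e / K.
  by apply: le_lt_trans hc _; rewrite /c; have := divr_gt0 e0 K0; lra.
have := small h n hlt; rewrite hE fw (wP n).1 cabsM !cabs_real ?ler0n ?(ltW c0) //.
lra.
Qed.

(** By [quotient_embedding], approximants F (u k) + m k of [v] have parameters [u k] that are Cauchy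
    modulo [N1]. Correcting the increments by elements of [N1] makes their series converge in [T1],
    and [FN] carries the corrections into [N2]. *)
Lemma closed_range v : closure [set x | exists u m, N2 m /\ x = F u + m] v ->
  exists u, closure N2 (v - F u).
Proof.
move=> clv.
have [q1 [c1 m1 d1]] := frechet_basis fT1.
have [q2 [c2 m2 d2]] := frechet_basis fT2.
have s2 n := csn_seminorm (c2 n).
have /choice[rho rhoP] : forall k, exists rho : T2 -> R, csn rho /\
    forall u m, N2 m -> quotient_seminorm (q1 k) N1 u <= rho (F u + m).
  by move=> k; have [rho ? ?] := quotient_embedding (c1 k); exists rho.
have crho k : csn (rho k) := (rhoP k).1.
have srho k := csn_seminorm (crho k).
have g0 n : 0 <= (2 : R) ^+ n by rewrite exprn_ge0.
pose sg k x := 2 ^+ k * (rho k x + q2 k x).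
have csg k : csn (sg k) by apply: csnZ => //; exact: csnD.
have ssg k := csn_seminorm (csg k).
(* The k-th approximant is also measured by the previous seminorm, since the increment from [u k] to
   [u k.+1] is estimated by [sg k] at both ends. The two errors of 1/4 leave room for 2^-k. *)
have /choice[z zP] : forall k, exists z : T1 * T2, N2 z.2 /\
    sg k (v - (F z.1 + z.2)) + sg k.-1 (v - (F z.1 + z.2)) < 4^-1.
  move=> k; have /closure_csn clv' := clv.
  have [|_ [u [m [Nm ->]]] lt] := clv' _ _ (csnD (csg k) (csg k.-1)) (_ : 0 < 4^-1).
    by rewrite invr_gt0.
  by exists (u, m).
pose u k := (z k).1; pose m k := (z k).2.
have Nm k : N2 (m k) by exact: (zP k).1.
have h1 k : sg k (v - (F (u k) + m k)) < 4^-1.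
  have [_] := zP k; have := seminorm_ge0 (ssg k.-1) (v - (F (u k) + m k)).
  rewrite -/(u k) -/(m k); lra.
have h2 k : sg k (v - (F (u k.+1) + m k.+1)) < 4^-1.
  have [_] := zP k.+1; have := seminorm_ge0 (ssg k.+1) (v - (F (u k.+1) + m k.+1)).
  rewrite -/(u k.+1) -/(m k.+1) /=; lra.
have pow2 k (x : R) : 2 ^+ k * x < 1 -> x < (2^-1) ^+ k.
  by rewrite exprVn -ltr_pdivlMl ?exprn_gt0// mulr1.
have step k : exists n, N1 n /\ q1 k (u k.+1 - u k + n) <= (2^-1) ^+ k.
  have : quotient_seminorm (q1 k) N1 (u k.+1 - u k) < (2^-1) ^+ k.
    apply: le_lt_trans ((rhoP k).2 _ _ (subspaceB sN2 (Nm k.+1) (Nm k))) _.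
    have -> : F (u k.+1 - u k) + (m k.+1 - m k) =
        (v - (F (u k) + m k)) - (v - (F (u k.+1) + m k.+1)).
      by rewrite (linB lF) addrACA -opprD opprB [RHS]addrC subrKA.
    apply: pow2.
    set x := v - (F (u k) + m k); set y := v - (F (u k.+1) + m k.+1).
    have q2x := seminorm_ge0 (s2 k) x; have q2y := seminorm_ge0 (s2 k) y.
    have := h1 k; have := h2 k; rewrite /sg -/x -/y.
    have := seminormB (srho k) x y.
    have : 0 <= 2 ^+ k * q2 k x by rewrite mulr_ge0.
    have : 0 <= 2 ^+ k * q2 k y by rewrite mulr_ge0.
    rewrite !mulrDr => a1 a2 a3 a4 a5.
    apply: le_lt_trans (ler_wpM2l (g0 k) a3) _; rewrite mulrDr; lra.
  by move=> /(quotient_seminorm_lt sN1.1)[n Nn lt]; exists n; split=> //; exact: ltW.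
have /choice[n nP] := step.
have [U dU] := frechet_cauchy_cvg fT1
  (seminorm_cauchy_series c1 m1 d1 (fun k => (nP k).2)).
exists (u 0%N + U); apply/closure_csn => p e cp e0.
have e20 : 0 < e / 2 by rewrite divr_gt0.
have [K hK] := dU _ _ (csn_comp cp lF cF) e20.
have [k0 pk0] := d2 p cp.
have [k1 hk1] := expr_half_lt e20.
pose k := maxn K (maxn k0 k1).
have [Kk k0k k1k] : [/\ (K <= k)%N, (k0 <= k)%N & (k1 <= k)%N] by rewrite /k; split; lia.
pose dk := \sum_(i < k) (u i.+1 - u i + n i); pose nk := \sum_(i < k) n i.
have dkE : dk = u k - u 0%N + nk.
  rewrite /dk /nk big_split /=; congr (_ + _).
  by elim: (k) => [|i ih]; rewrite ?big_ord0 ?subrr // big_ord_recr /= ih addrC subrKA.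
exists (m k - F nk).
  by apply: subspaceB => //; apply: FN; apply: subspace_sum => // i; exact: (nP i).1.
have -> : v - F (u 0%N + U) - (m k - F nk) = (v - (F (u k) + m k)) + F (dk - U).
  rewrite dkE !(linB lF, linD lF) !opprD !opprK !addrA.
  by rewrite [RHS](ACl (1*5*7*3*6*2*4)) /= subrK.
have := hK k Kk; rewrite /= -/dk => hd.
have : p (v - (F (u k) + m k)) < e / 2.
  apply: le_lt_trans (pk0 _) _; apply: le_lt_trans (m2 _ _ k0k _) _.
  apply: lt_trans (pow2 k _ _) _; last first.
    by apply: le_lt_trans hk1; apply: ler_wiXn2l => //; lra.
  have := h1 k; rewrite /sg mulrDr.
  have : 0 <= 2 ^+ k * rho k (v - (F (u k) + m k)) by rewrite mulr_ge0 // seminorm_ge0.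
  lra.
have := (csn_seminorm cp).1 (v - (F (u k) + m k)) (F (dk - U)); lra.
Qed.

End ClosedRange.

Section BilinearComposition.
Variables (R : realType) (U V W U' V' W' : tvsType R[i]).
Variables (b : U -> V -> W) (f : U' -> U) (g : V' -> V) (h : W -> W').
Hypotheses (bb : bilinear_map b) (cb : jointly_continuous b).
Hypotheses (lf : linear f) (cf : continuous f) (lg : linear g) (cg : continuous g).
Hypotheses (lh : linear h) (ch : continuous h).

Lemma bilinear_comp : bilinear_map (fun x y => h (b (f x) (g y))).
Proof.
split=> [x|y] a u v.
  by rewrite lg (bilinear_linear_l _ bb) lh.
have := bilinear_linear_r (g y) bb a (f u) (f v); rewrite lf /= => ->.
by rewrite lh.
Qed.

Lemma bilinear_comp_continuous :
  jointly_continuous (fun x y => h (b (f x) (g y))).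
Proof.
apply: bilinear_continuous_csn; first exact: bilinear_comp.
move=> q cq; have [p1 [p2 [c1 c2 le]]] := bilinear_csn bb cb (csn_comp cq lh ch).
exists (p1 \o f), (p2 \o g); split=> [||x y]; [exact: csn_comp | exact: csn_comp |].
exact: le.
Qed.

End BilinearComposition.

Section ProjectiveTensor.
Variables (R : realType) (E F T : tvsType R[i]) (tau : E -> F -> T).

(** [P] acts as the projective tensor seminorm of [p1] and [p2]. The universal property speaks of
    single maps; here one [P] serves all of them, which yields bounds that are uniform over families
    of lifts. *)
Definition tensor_estimates := forall (p1 : E -> R) (p2 : F -> R), csn p1 -> csn p2 ->
  exists2 P : T -> R, csn P & forall (G : tvsType R[i]) (phi : T -> G) (r : G -> R) C,
    linear phi -> continuous phi -> csn r -> 0 <= C ->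
    (forall x z, r (phi (tau x z)) <= C * (p1 x * p2 z)) ->
    forall t, r (phi t) <= C * P t.

Hypothesis hT : projective_tensor tau.

Lemma tensor_ext (G : tvsType R[i]) (phi psi : T -> G) : frechet_space G ->
  linear phi -> continuous phi -> linear psi -> continuous psi ->
  (forall x y, phi (tau x y) = psi (tau x y)) -> phi =1 psi.
Proof.
move=> fG lphi cphi lpsi cpsi eq_tau.
have [fT bt ct univ] := hT.
have [||chi [_ uniq]] := univ G (fun x y => phi (tau x y)) fG.
- exact: (bilinear_comp (f := idfun) (g := idfun) bt).
- by apply: (bilinear_comp_continuous (f := idfun) (g := idfun) bt ct) => //;
    move=> x; exact: cvg_id.
have chi_phi : chi = phi by apply: uniq.
have chi_psi : chi = psi by apply: uniq; split=> // x y; rewrite eq_tau.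
by move=> t; rewrite -chi_phi chi_psi.
Qed.

Lemma tensor_lift (G : tvsType R[i]) (b : E -> F -> G) : frechet_space G ->
  bilinear_map b -> jointly_continuous b ->
  exists phi : T -> G, [/\ linear phi, continuous phi
    & forall x y, phi (tau x y) = b x y].
Proof.
move=> fG bb cb; have [_ _ _ univ] := hT.
by have [phi [hphi _]] := univ G b fG bb cb; exists phi.
Qed.

End ProjectiveTensor.

Lemma linear_continuous_add (R : realType) (V W : tvsType R[i]) (f g : V -> W) :
  linear f -> continuous f -> linear g -> continuous g ->
  linear (fun x => f x + g x) /\ continuous (fun x => f x + g x).
Proof.
move=> lf cf lg cg.
have l : linear (fun x => f x + g x).
  by move=> a x y; rewrite lf lg scalerDr addrACA.
split=> //; apply: linear_continuous_csn => // q cq.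
exists (fun x => q (f x) + q (g x)); first by apply: csnD; apply: csn_comp.
by move=> x; exact: (csn_seminorm cq).1.
Qed.

Lemma linear_cst0 (R : realType) (V W : lmodType R[i]) : linear (fun _ : V => 0 : W).
Proof. by move=> a x y; rewrite scaler0 addr0. Qed.

Section BalancedTensor.
Variables (R : realType) (A : tvsType R[i]) (mul : A -> A -> A).
Hypothesis fA : frechet_algebra mul.
Local Notation Ap := (unitization A).
Local Notation "x ** y" := (unitization_mul mul x y) (at level 40).
Local Notation e1 := ((0, 1) : Ap).
Variables (E : tvsType R[i]) (tau : Ap -> Ap -> E) (mulE : E -> E -> E).
Hypothesis hE : enveloping_algebra mul tau mulE.
Variable act : E -> Ap -> Ap.
Hypothesis hact : left_frechet_module mulE act.
Hypothesis actE : forall a b x, act (tau a b) x = a ** x ** b.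

Let mul1 x : e1 ** x = x.
Proof. by case: fA => _ bm _ _; exact: unitization_mul1r. Qed.

Let mulx1 x : x ** e1 = x.
Proof. by case: fA => _ bm _ _; exact: unitization_mulr1. Qed.

Let tauM a b c d : mulE (tau a b) (tau c d) = tau (a ** c) (d ** b).
Proof. by case: hE. Qed.

Let hT : projective_tensor tau. Proof. by case: hE. Qed.
Let btau : bilinear_map tau. Proof. by case: hT. Qed.
Let ctau : jointly_continuous tau. Proof. by case: hT. Qed.

(** A right module over [E] is a bimodule with y (a ⊗ b) = b y a, so the identity compares h (y a)
    with h (a y). *)
Definition central_functional (Y : tvsType R[i]) (r : Y -> E -> Y)
    (h : Y -> R[i]^o) :=
  dual Y h /\ forall y a, h (r y (tau a e1)) = h (r y (tau e1 a)).

Section OneModule.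
Variables (Y : tvsType R[i]) (r : Y -> E -> Y).
Hypothesis hY : right_frechet_module mulE r.
Variables (T : tvsType R[i]) (tauT : Y -> Ap -> T).
Hypothesis hTT : projective_tensor tauT.

Let br : bilinear_map r. Proof. by case: hY. Qed.
Let cr : jointly_continuous r. Proof. by case: hY. Qed.
Let rM y a b : r y (mulE a b) = r (r y a) b. Proof. by case: hY. Qed.

Lemma subspace_balancing : subspace (balancing_subspace r act tauT).
Proof. by apply: subspace_closure; exact: subspace_linear_span. Qed.

Lemma closure_balancing :
  closure (balancing_subspace r act tauT) `<=` balancing_subspace r act tauT.
Proof. exact: closed_closure. Qed.

Lemma balancing_generator y e x :
  balancing_subspace r act tauT (tauT (r y e) x - tauT y (act e x)).
Proof. by apply/subset_closure/sub_linear_span; exists y, e, x. Qed.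

Lemma dual_balancing (H : T -> R[i]^o) : dual T H ->
  (forall y e x, H (tauT (r y e) x) = H (tauT y (act e x))) ->
  forall v, balancing_subspace r act tauT v -> H v = 0.
Proof.
move=> dH HE v; apply: (closure_min_dual dH) => w.
have sK : subspace [set w | H w = 0].
  split=> [|a x y /= Hx Hy] /=; first exact: lin0 dH.1.
  by rewrite dH.1 Hx Hy scaler0 addr0.
apply: (linear_span_min sK) => _ [y [e [x ->]]].
by rewrite /= (linB dH.1) HE subrr.
Qed.

(** Both a ⊗ 1 and 1 ⊗ a send the identity to [a]. Balancing therefore moves every [x] to the left
    factor and makes the functional at the identity central. *)
Lemma central_of_balanced (H : T -> R[i]^o) : dual T H ->
  (forall v, balancing_subspace r act tauT v -> H v = 0) ->
  central_functional r (fun y => H (tauT y e1)) /\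
  forall y x, H (tauT y x) = H (tauT (r y (tau x e1)) e1).
Proof.
move=> dH HN; have [_ bT cT _] := hTT.
have HE y e x : H (tauT (r y e) x) = H (tauT y (act e x)).
  by apply/eqP; rewrite -subr_eq0 -(linB dH.1) HN //; exact: balancing_generator.
have Hx y x : H (tauT y x) = H (tauT (r y (tau x e1)) e1).
  by rewrite HE actE !mulx1.
split=> //; split=> [|y a]; last by rewrite -Hx HE actE !mul1.
split.
  have := bilinear_linear_r e1 bT => lT a x y.
  by rewrite (lT a x y) dH.1.
by move=> y; apply: continuous_comp; [exact: (bilinear_continuous_r cT) | exact: dH.2].
Qed.

(** Inverse to the passage from [H] to its values at the identity, up to unitality: the modules may
    be non-unital, so at x = 1 the functional [H] returns h (y (1 ⊗ 1)) instead of h y. *)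
Lemma balanced_of_central (h : Y -> R[i]^o) : central_functional r h ->
  exists H : T -> R[i]^o, [/\ dual T H,
    forall v, balancing_subspace r act tauT v -> H v = 0
    & forall y x, H (tauT y x) = h (r y (tau x e1))].
Proof.
move=> [dh hc]; have [_ bT cT _] := hTT.
have lt1 : linear (tau^~ e1) by case: btau.
have ct1 : continuous (tau^~ e1) by exact: bilinear_continuous_r.
have cid : continuous (idfun : Y -> Y) by move=> x; exact: cvg_id.
have [|H [lH cH HE]] := tensor_lift hTT (frechet_scalars R)
    (bilinear_comp br (f := idfun) (fun _ _ _ => erefl) lt1 dh.1).
  exact: (bilinear_comp_continuous br cr (fun _ _ _ => erefl) cid lt1 ct1 dh.1 dh.2).
have dH : dual T H by split.
exists H; split=> //; apply: dual_balancing => // y e x.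
have [_ bact _ cact] := hact.
have lT y' := bilinear_linear_l y' bT.
have := @tensor_ext _ _ _ _ _ hT R[i]^o (fun e => H (tauT (r y e) x))
  (fun e => H (tauT y (act e x))) (frechet_scalars R); apply.
- move=> a e' e''; rewrite (bilinear_linear_l y br).
  by have := bilinear_linear_r x bT a (r y e') (r y e'') => /= ->; rewrite lH.
- move=> e'; apply: (@continuous_comp _ _ _ (r y) (fun y => H (tauT y x))).
    exact: bilinear_continuous_l.
  apply: (@continuous_comp _ _ _ (tauT^~ x) H); first exact: bilinear_continuous_r.
  exact: cH.
- move=> a e' e''; have := bilinear_linear_r x bact a e' e'' => /= ->.
  by rewrite lT lH.
- move=> e'; apply: (@continuous_comp _ _ _ (act^~ x) (fun u => H (tauT y u))).
    exact: bilinear_continuous_r.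
  apply: (@continuous_comp _ _ _ (tauT y) H); first exact: bilinear_continuous_l.
  exact: cH.
(* On e = a ⊗ b the left side is h (y (ax ⊗ b)). Splitting off 1 ⊗ b and replacing it by b ⊗ 1, as
   centrality permits, gives h (y (axb ⊗ 1)). *)
move=> a b; rewrite !HE /= actE -rM tauM mul1.
have -> : tau (a ** x) b = mulE (tau (a ** x) e1) (tau e1 b).
  by rewrite tauM !mulx1.
by rewrite rM -hc -rM tauM mul1.
Qed.

End OneModule.

(** Tested on functionals, for which being balanced is a condition on elementary tensors that pulls
    back along [F]. *)
Lemma balancing_map (Y Z T T' : tvsType R[i]) (rY : Y -> E -> Y) (rZ : Z -> E -> Z)
    (tY : Y -> Ap -> T) (tZ : Z -> Ap -> T') (f : Y -> Z) (F : T -> T') :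
  linear F -> continuous F -> (forall y x, F (tY y x) = tZ (f y) x) ->
  (forall y e, f (rY y e) = rZ (f y) e) ->
  forall u, balancing_subspace rY act tY u -> balancing_subspace rZ act tZ (F u).
Proof.
move=> lF cF FE fr u Nu; apply: closure_balancing.
apply/closure_dualP; first exact: subspace_balancing.
move=> H dH HN.
have dHF : dual T (fun u => H (F u)).
  split=> [a x y|x]; first by rewrite lF dH.1.
  by apply: continuous_comp; [exact: cF | exact: dH.2].
apply: (dual_balancing dHF) Nu => y e x.
rewrite !FE fr; apply/eqP; rewrite -subr_eq0 -(linB dH.1) HN //.
exact: balancing_generator.
Qed.

End BalancedTensor.

(** * From inner derivations to flatness *)

Section CentralExtension.
Variables (R : realType) (A : tvsType R[i]) (mul : A -> A -> A).
Hypothesis fA : frechet_algebra mul.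
Local Notation Ap := (unitization A).
Local Notation e1 := ((0, 1) : Ap).
Hypothesis inner : forall (X : tvsType R[i]) (l : A -> X -> X) (r : X -> A -> X),
  frechet_bimodule mul l r -> continuous_derivations_inner mul l r.
Variables (E : tvsType R[i]) (tau : Ap -> Ap -> E) (mulE : E -> E -> E).
Hypothesis hE : enveloping_algebra mul tau mulE.
Variables (Y1 Y2 Y3 : tvsType R[i]).
Variables (r1 : Y1 -> E -> Y1) (r2 : Y2 -> E -> Y2) (r3 : Y3 -> E -> Y3).
Variables (f : Y1 -> Y2) (g : Y2 -> Y3).
Hypotheses (h1 : right_frechet_module mulE r1) (h2 : right_frechet_module mulE r2)
  (h3 : right_frechet_module mulE r3).
Hypotheses (hf : right_module_map r1 r2 f) (hg : right_module_map r2 r3 g).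
Hypothesis hsplit : continuous_split f g.

(* Extending a central functional along the splitting costs centrality by a
   derivation into the dual of the quotient module [Y3]; a functional
   implementing this derivation is the required correction. *)
Lemma central_functional_extends (h : Y1 -> R[i]^o) : central_functional tau r1 h ->
  exists2 h' : Y2 -> R[i]^o, central_functional tau r2 h' & forall y, h' (f y) = h y.
Proof.
move=> [dh hc].
have [hT _ tauM] := hE; have [_ [btl btr] ct _] := hT.
have [fY2 br2 r2M cr2] := h2; have [fY3 br3 r3M cr3] := h3; have [_ br1 _ _] := h1.
have [lf cf fr] := hf; have [lg cg gr] := hg.
have [p [s [[lp cp] [ls cs] pf gs fpsg]]] := hsplit.
have [_ bm _ _] := fA.
(* Commuting copies in [E] of [A] and of its opposite; through them a right module over [E] becomes
   an [A]-bimodule. *)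
pose e0 a : E := tau (a, 0) e1; pose e0' a : E := tau e1 (a, 0).
have le0 : linear e0.
  move=> c a b; have := btr e1 c (a, 0) (b, 0).
  by rewrite -/(e0 a) -/(e0 b) => <-; congr (tau (_, _) _); rewrite /= scaler0 addr0.
have le0' : linear e0'.
  move=> c a b; have := btl e1 c (a, 0) (b, 0).
  by rewrite -/(e0' a) -/(e0' b) => <-; congr (tau _ (_, _)); rewrite /= scaler0 addr0.
have cin : continuous (fun a : A => (a, 0) : Ap).
  apply: linear_continuous_csn => [c a b|q /csn_inl cq]; last first.
    by exists (fun a => q (a, 0)).
  by congr (_, _); rewrite /= scaler0 addr0.
have ce0 : continuous e0.
  move=> a; apply: (@continuous_comp _ _ _ (fun a => (a, 0) : Ap) (tau^~ e1)).
    exact: cin.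
  exact: bilinear_continuous_r.
have ce0' : continuous e0'.
  move=> a; apply: (@continuous_comp _ _ _ (fun a => (a, 0) : Ap) (tau e1)).
    exact: cin.
  exact: bilinear_continuous_l.
have e0M a b : e0 (mul a b) = mulE (e0 a) (e0 b).
  rewrite /e0 tauM (unitization_mul1r bm); congr (tau (_, _) _).
    by rewrite /= !scale0r !addr0.
  by rewrite /= mul0r.
have e0'M a b : e0' (mul a b) = mulE (e0' b) (e0' a).
  rewrite /e0' tauM (unitization_mul1r bm); congr (tau _ (_, _)).
    by rewrite /= !scale0r !addr0.
  by rewrite /= mul0r.
have e0C a b : mulE (e0' a) (e0 b) = mulE (e0 b) (e0' a).
  rewrite /e0 /e0' !tauM (unitization_mul1r bm) (unitization_mul1r bm).
  by rewrite !(unitization_mulr1 bm).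
pose l3 a z := r3 z (e0' a); pose rr3 z a := r3 z (e0 a).
have cid (V : tvsType R[i]) : continuous (idfun : V -> V) by move=> x; exact: cvg_id.
have lid (V : tvsType R[i]) : linear (idfun : V -> V) by [].
have brr3 : bilinear_map rr3 := bilinear_comp br3 (lid Y3) le0 (lid Y3).
have crr3 : jointly_continuous rr3 :=
  bilinear_comp_continuous br3 cr3 (lid Y3) (cid Y3) le0 ce0 (lid Y3) (cid Y3).
have bl3' := bilinear_comp br3 (lid Y3) le0' (lid Y3).
have cl3' := bilinear_comp_continuous br3 cr3 (lid Y3) (cid Y3) le0' ce0' (lid Y3) (cid Y3).
have bl3 : bilinear_map l3 by split=> [a|z]; [exact: bl3'.2 | exact: bl3'.1].
have cl3 : jointly_continuous l3.
  apply: bilinear_continuous_csn => // q cq.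
  have [p1 [p2 [c1 c2 le]]] := bilinear_csn bl3' cl3' cq.
  by exists p2, p1; split=> // a z; rewrite mulrC; exact: le.
have bim3 : frechet_bimodule mul l3 rr3.
  split=> //; split=> //.
  - by move=> a b z; rewrite /l3 e0'M r3M.
  - by move=> z a b; rewrite /rr3 e0M r3M.
  - by move=> a z b; rewrite /l3 /rr3 -!r3M e0C.
pose hh y := h (p y).
have dhh : dual Y2 hh.
  split; first by move=> c x y; rewrite /hh lp dh.1.
  by move=> y; apply: continuous_comp; [exact: cp | exact: dh.2].
(* The defect of centrality of [hh]. It vanishes on the range of [f], where [hh] restricts to [h],
   and so descends along [g]. *)
pose w a y := hh (r2 y (e0 a)) - hh (r2 y (e0' a)).
have lw y : linear (w^~ y : A -> R[i]^o).
  move=> c a b; rewrite /w le0 le0' !(br2.1 y) !dhh.1.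
  by rewrite scalerBr opprD addrACA.
have lw' a : linear (w a : Y2 -> R[i]^o).
  move=> c x y; rewrite /w.
  have /= -> := br2.2 (e0 a) c x y; have /= -> := br2.2 (e0' a) c x y.
  by rewrite !dhh.1 scalerBr opprD addrACA.
have wf a u : w a (f u) = 0.
  by rewrite /w /hh -!fr !pf hc subrr.
have wg a y : w a y = w a (s (g y)).
  by rewrite -{1}(fpsg y) (linD (lw' a)) wf add0r.
pose D a z : R[i]^o := w a (s z).
have lD : linear D.
  by move=> c a b; apply/funext => z; rewrite /D (lw (s z)).
have [q1 [q2 [c1 c2 le1]]] := bilinear_csn br2 cr2 (dual_csn dhh).
pose P a := q2 (e0 a) + q2 (e0' a).
have cP : csn P by apply: csnD; [exact: (csn_comp c2 le0) | exact: (csn_comp c2 le0')].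
have Dle a z : cabs (D a z) <= P a * q1 (s z).
  rewrite /D /w /P; apply: le_trans (cabsD _ _) _; rewrite cabsN mulrDl.
  by rewrite ![_ * q1 _]mulrC; apply: lerD; exact: le1.
have [||d dd dE] := inner bim3 (D := D).
- split=> //.
    move=> a; apply: (@csn_dual _ _ _ (fun z => P a * q1 (s z))) => //.
      by move=> c x y; rewrite /D ls (lw' a).
    apply: csnZ; first exact: seminorm_ge0 (csn_seminorm cP) a.
    exact: (csn_comp c1).
  move=> a b; apply/funext => z; rewrite !fctE /dual_lact /dual_ract /D.
  rewrite /rr3 /l3.
  have -> : r3 z (e0 a) = g (r2 (s z) (e0 a)) by rewrite gr gs.
  have -> : r3 z (e0' b) = g (r2 (s z) (e0' b)) by rewrite gr gs.
  (* The Leibniz rule telescopes through the value of [hh] at y (e0 a) (e0' b), where the order of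
     the two commuting factors is immaterial. *)
  by rewrite -!wg /w e0M e0'M !r2M -(r2M _ (e0 a) (e0' b)) -e0C r2M subrKA.
- exact: (continuous_strong lD cP (csn_comp c1 ls cs)).
pose h' y := hh y - d (g y).
have dh' : dual Y2 h'.
  apply: (@csn_dual _ _ _ (fun y => cabs (hh y) + cabs (d (g y)))).
  - move=> c x y; rewrite /h' dhh.1 lg dd.1 scalerBr opprD addrACA.
    by [].
  - by apply: csnD; [exact: dual_csn | exact: (csn_comp (dual_csn dd))].
  - by move=> y; apply: le_trans (cabsD _ _) _; rewrite cabsN.
exists h'; last first.
  move=> y; rewrite /h' /hh pf.
  have -> : g (f y) = 0.
    have := congr1 g (fpsg (f y)); rewrite pf (linD lg) gs.
    by move=> /(congr1 (fun x => x - g (f y))); rewrite addrK subrr.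
  by rewrite (lin0 dd.1) subr0.
split=> // y [a c].
have acE : (a, c) = c *: e1 + (a, 0) :> Ap.
  by congr (_, _); rewrite /= ?scaler0 ?add0r // addr0 /GRing.scale /= mulr1.
have -> : tau (a, c) e1 = c *: tau e1 e1 + e0 a by rewrite acE (btr e1).
have -> : tau e1 (a, c) = c *: tau e1 e1 + e0' a by rewrite acE (btl e1).
rewrite !(br2.1 y) !dh'.1; congr (_ + _).
apply/eqP; rewrite -subr_eq0 /h' !gr opprB (addrC (d _)) addrACA -/(w a y) wg.
have /(congr1 (@^~ (g y))) := dE a; rewrite /D !fctE => ->.
rewrite /dual_lact /dual_ract /rr3 /l3 [- _ + _]addrC.
by rewrite -opprB addNr.
Qed.

End CentralExtension.

(** The splitting survives tensoring as [P] and [S], which settles surjectivity. Injectivity and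
    closedness of the range modulo the balancing subspaces are dual to the extension of central
    functionals. *)
Lemma amenable_of_derivations (R : realType) (A : tvsType R[i]) (mul : A -> A -> A) :
  frechet_algebra mul ->
  (forall (X : tvsType R[i]) (l : A -> X -> X) (r : X -> A -> X),
     frechet_bimodule mul l r -> continuous_derivations_inner mul l r) ->
  amenable mul.
Proof.
move=> fA inner E tau mulE act hE hact actE0.
have actE a b x : act (tau a b) x =
    unitization_mul mul (unitization_mul mul a x) b.
  by rewrite actE0 unitization_self_action //; case: fA.
move=> Y1 Y2 Y3 r1 r2 r3 f g h1 h2 h3 hf hg fgex hsplit T1 T2 T3 t1 t2 t3 F G.
move=> hT1 hT2 hT3 [lF cF FE] [lG cG GE].
have [fT1 bt1 ct1 _] := hT1; have [fT2 bt2 ct2 _] := hT2; have [fT3 bt3 ct3 _] := hT3.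
have [lf cf fr] := hf; have [lg cg gr] := hg.
have [p [s [[lp cp] [ls cs] pf gs fpsg]]] := hsplit.
set N1 := balancing_subspace r1 act t1; set N2 := balancing_subspace r2 act t2.
set N3 := balancing_subspace r3 act t3.
have sN1 : subspace N1 by exact: subspace_balancing.
have sN2 : subspace N2 by exact: subspace_balancing.
have clN1 : closure N1 `<=` N1 by exact: closure_balancing.
have clN2 : closure N2 `<=` N2 by exact: closure_balancing.
have gf y : g (f y) = 0.
  have := congr1 g (fpsg (f y)); rewrite pf (linD lg) gs.
  by move=> /(congr1 (fun x => x - g (f y))); rewrite addrK subrr.
have dual_onto H : dual T1 H -> (forall u, N1 u -> H u = 0) ->
    exists H2, [/\ dual T2 H2, forall v, N2 v -> H2 v = 0 & forall u, H2 (F u) = H u].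
  move=> dH HN1.
  have [ch HE] := central_of_balanced fA actE hT1 dH HN1.
  have [k ck kf] := central_functional_extends fA inner hE h1 h2 h3 hf hg hsplit ch.
  have [H2 [dH2 H2N H2E]] := balanced_of_central fA hE hact actE h2 hT2 ck.
  exists H2; split=> //.
  apply: (tensor_ext hT1 (frechet_scalars R) (phi := fun u => H2 (F u))) => //.
  - by move=> a x y; rewrite lF dH2.1.
  - by move=> x; apply: continuous_comp; [exact: cF | exact: dH2.2].
  - exact: dH.1.
  - exact: dH.2.
  - by move=> y x; rewrite FE H2E -fr kf -HE.
have FN u : N1 u -> N2 (F u) by exact: balancing_map.
have GN v : N2 v -> N3 (G v) by exact: balancing_map.
have cid : continuous (idfun : unitization A -> unitization A).
  by move=> x; exact: cvg_id.
have lid (V : lmodType R[i]) : linear (idfun : V -> V) by [].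
have cidT (V : tvsType R[i]) : continuous (idfun : V -> V) by move=> x; exact: cvg_id.
have [P [lP cP PE]] := tensor_lift hT2 fT1 (bilinear_comp bt1 lp (lid _) (lid _))
  (bilinear_comp_continuous bt1 ct1 lp cp (lid _) cid (lid _) (cidT _)).
have [S [lS cS SE]] := tensor_lift hT3 fT2 (bilinear_comp bt2 ls (lid _) (lid _))
  (bilinear_comp_continuous bt2 ct2 ls cs (lid _) cid (lid _) (cidT _)).
have GF u : G (F u) = 0.
  apply: (tensor_ext hT1 fT3 (phi := G \o F) (psi := fun=> 0)) => //.
  - by move=> a x y /=; rewrite lF lG.
  - by move=> x; apply: continuous_comp; [exact: cF | exact: cG].
  - exact: linear_cst0.
  - by move=> x; exact: cvg_cst.
  - by move=> y x /=; rewrite FE GE gf; exact: (lin0 (bt3.2 x)).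
have GS w : G (S w) = w.
  apply: (tensor_ext hT3 fT3 (phi := G \o S) (psi := idfun)) => //.
  - by move=> a x y /=; rewrite lS lG.
  - by move=> x; apply: continuous_comp; [exact: cS | exact: cG].
  - by move=> y x /=; rewrite SE /= GE gs.
have FPSG v : F (P v) + S (G v) = v.
  have lFP : linear (F \o P) by move=> a x y /=; rewrite lP lF.
  have cFP : continuous (F \o P).
    by move=> x; apply: continuous_comp; [exact: cP | exact: cF].
  have lSG : linear (S \o G) by move=> a x y /=; rewrite lG lS.
  have cSG : continuous (S \o G).
    by move=> x; apply: continuous_comp; [exact: cG | exact: cS].
  have [lFS cFS] := linear_continuous_add lFP cFP lSG cSG.
  apply: (tensor_ext hT2 fT2 (psi := idfun) lFS cFS) => //.
  move=> y x /=; rewrite PE /= FE GE SE /=.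
  by have /= <- := linD (bt2.2 x) (f (p y)) (s (g y)); rewrite fpsg.
split.
- move=> u; split=> [N2Fu|]; last exact: FN.
  apply/clN1/closure_dualP => // H dH HN.
  have [H2 [_ H2N <-]] := dual_onto H dH HN; exact: H2N.
- move=> v; split=> [N3Gv|[u N2vu]]; last first.
    by rewrite -[v](subrK (F u)) (linD lG) GF addr0; exact: GN.
  have [|u N2u] := closed_range fT1 fT2 lF cF sN1 sN2 FN dual_onto (v := v).
    apply/closure_csn => q e cq e0.
    have [n3 n3S n3e] := (closure_csn _ _).1 N3Gv _ _ (csn_comp cq lS cS) e0.
    (* Generators of the balancing subspace of [T3] lift to generators in [T2] through [s], because
       [g] is a module map with [g (s y) = y]. *)
    have [n2 n2S n2E] : exists2 n2, N2 n2 & G n2 = n3.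
      have sK : subspace [set n3 | exists2 n2, N2 n2 & G n2 = n3].
        split=> [|a _ _ [x Nx <-] [y Ny <-]].
          by exists 0; [exact: sN2.1 | rewrite (lin0 lG)].
        by exists (a *: x + y); [exact: sN2.2 | rewrite lG].
      apply: (linear_span_min sK _ n3S) => _ [y [a [x ->]]].
      exists (t2 (r2 (s y) a) x - t2 (s y) (act a x)).
        exact: balancing_generator.
      by rewrite (linB lG) !GE gr gs.
    (* Removing the part of [v - n2] that comes from [T1] leaves [S (G v - n3)], small by the choice
       of [n3]. *)
    exists (F (P (v - n2)) + n2); first by exists (P (v - n2)), n2.
    have <- : S (G v - n3) = v - (F (P (v - n2)) + n2).
      rewrite -n2E -(linB lG); apply/eqP; rewrite eq_sym subr_eq addrC addrAC.
      by rewrite FPSG subrK.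
    exact: n3e.
  by exists u; apply: clN2.
- move=> w; exists (S w); rewrite GS subrr.
  by have [] : subspace N3 by exact: subspace_balancing.
Qed.

(** * Existence of projective tensor products *)

(** An alias of [V] whose type records the seminorms, so that the topology they generate can be
    attached to it canonically. *)
Definition seminorm_tvs (R : realType) (V : lmodType R[i]) (p : nat -> V -> R)
  & (forall n, seminorm (p n)) : Type := V.

Section SeminormTvs.
Variables (R : realType) (V : lmodType R[i]) (p : nat -> V -> R).
Hypothesis sp : forall n, seminorm (p n).
Local Notation T := (seminorm_tvs sp).

HB.instance Definition _ := GRing.Lmodule.on T.

(** Partial sums turn an arbitrary family into an increasing one, so that single balls form a
    base. *)
Let Q n (x : V) := \sum_(k < n.+1) p k x.

Let sQ n : seminorm (Q n).
Proof.
rewrite /Q; elim: n.+1 => [|m ih].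
  by split=> [x y|t x]; rewrite !big_ord0 ?addr0 ?mulr0.
by under eq_fun do rewrite big_ord_recr /=; exact: seminormD.
Qed.

Let Qmono n m x : (n <= m)%N -> Q n x <= Q m x.
Proof.
move=> nm; rewrite /Q -!(big_mkord xpredT (fun i => p i x)) /=.
rewrite (@big_cat_nat _ _ _ n.+1 0 m.+1) //=.
by rewrite lerDl; apply: sumr_ge0 => i _; exact: seminorm_ge0.
Qed.

Definition seminorm_nbhs (x : T) : set_system T :=
  [set U | exists n e, 0 < e /\ forall y : V, Q n (y - x) < e -> U y].

HB.instance Definition _ := hasNbhs.Build T seminorm_nbhs.

Lemma seminorm_nbhsP (x : T) U : nbhs x U <->
  exists n e, 0 < e /\ forall y : V, Q n (y - x) < e -> U y.
Proof. by []. Qed.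

Fact seminorm_nbhs_filter (x : T) : ProperFilter (nbhs x).
Proof.
apply: Build_ProperFilter_ex.
  move=> U /seminorm_nbhsP[n [e [e0 eU]]]; exists x; apply: eU.
  by rewrite subrr (seminorm0 (sQ n)).
split.
- by exists 0%N, 1.
- move=> U U' [n [e [e0 eU]]] [n' [e' [e'0 eU']]].
  exists (maxn n n'), (Num.min e e'); split; first by rewrite lt_min e0.
  move=> y; rewrite lt_min => /andP[h1 h2]; split.
    by apply: eU; exact: le_lt_trans (Qmono _ (leq_maxl _ _)) h1.
  by apply: eU'; exact: le_lt_trans (Qmono _ (leq_maxr _ _)) h2.
by move=> U U' UU' [n [e [e0 eU]]]; exists n, e; split=> // y /eU /UU'.
Qed.

Fact seminorm_nbhs_singleton (x : T) U : nbhs x U -> U x.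
Proof.
move=> /seminorm_nbhsP[n [e [e0 eU]]]; apply: eU.
by rewrite subrr (seminorm0 (sQ n)).
Qed.

Let seminorm_ball_nbhs n e (x y : V) : Q n (y - x) < e ->
  nbhs (y : T) [set z : T | Q n ((z : V) - x) < e].
Proof.
move=> lt; apply/seminorm_nbhsP; exists n, (e - Q n (y - x)); split.
  by rewrite subr_gt0.
move=> z; have := seminorm_dist_trans (sQ n) y z x; rewrite /=; lra.
Qed.

Fact seminorm_nbhs_nbhs (x : T) U : nbhs x U -> nbhs x (nbhs^~ U).
Proof.
move=> /seminorm_nbhsP[n [e [e0 eU]]]; exists n, e; split=> // y lt.
have [m [d [d0 dU]]] := seminorm_ball_nbhs lt.
by exists m, d; split=> // z /dU; exact: eU.
Qed.

HB.instance Definition _ := Nbhs_isNbhsTopological.Build T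
  seminorm_nbhs_filter seminorm_nbhs_singleton seminorm_nbhs_nbhs.

Fact seminorm_add_continuous : continuous (fun z : T * T => z.1 + z.2).
Proof.
move=> [x y] U /= /seminorm_nbhsP[n [e [e0 eU]]].
have e20 : 0 < e / 2 by rewrite divr_gt0.
exists ([set x' : T | Q n ((x' : V) - x) < e / 2],
        [set y' : T | Q n ((y' : V) - y) < e / 2]).
  by split; apply: seminorm_ball_nbhs; rewrite subrr (seminorm0 (sQ n)).
move=> [x' y'] /= [h1 h2]; apply: eU.
rewrite opprD addrACA; apply: le_lt_trans ((sQ n).1 _ _) _; lra.
Qed.

Fact seminorm_scale_continuous : continuous (fun z : R[i]^o * T => z.1 *: z.2).
Proof.
move=> [t x] U /= /seminorm_nbhsP[n [e [e0 eU]]].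
have t0 := cabs_ge0 t; have x0 : 0 <= Q n x := seminorm_ge0 (sQ n) x.
have t1 : 0 < cabs t + 1 by lra.
have d10 : 0 < e / 2 / (cabs t + 1) by rewrite !divr_gt0.
(* The minimum with 1 gives [cabs t' <= cabs t + 1]; then t' (x' - x) and (t' - t) x each stay below
   half of [e]. *)
have d20 : 0 < Num.min 1 (e / 2 / (Q n x + 1)).
  by rewrite lt_min ltr01 !divr_gt0 //; lra.
exists ([set t' : R[i]^o | cabs (t' - t) < Num.min 1 (e / 2 / (Q n x + 1))],
        [set x' : T | Q n ((x' : V) - x) < e / 2 / (cabs t + 1)]).
  split; last by apply: seminorm_ball_nbhs; rewrite subrr (seminorm0 (sQ n)).
  apply/nbhs_csn; exists (fun z => (Num.min 1 (e / 2 / (Q n x + 1)))^-1 * cabs z).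
    by apply: csnZ; [rewrite invr_ge0 ltW | exact: csn_cabs].
  by move=> t'; rewrite mulrC ltr_pdivrMr // mul1r.
move=> [t' x'] /= []; rewrite lt_min => /andP[ht1 ht2] hx; apply: eU.
have -> : t' *: (x' : V) - t *: x = t' *: ((x' : V) - x) + (t' - t) *: (x : V).
  by rewrite scalerBr scalerBl subrKA.
apply: le_lt_trans ((sQ n).1 _ _) _; rewrite !(sQ n).2.
have tt' : cabs t' <= cabs t + 1.
  rewrite -[t'](subrK t); apply: le_trans (cabsD _ _) _; lra.
have := seminorm_ge0 (sQ n) ((x' : V) - x).
have := cabs_ge0 t'; have := cabs_ge0 (t' - t).
move: hx; rewrite ltr_pdivlMr // => hx.
move: ht2; rewrite ltr_pdivlMr; last lra.
move=> ht2 c1 c2 c3.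
have : cabs t' * Q n ((x' : V) - x) <= (cabs t + 1) * Q n ((x' : V) - x).
  by rewrite ler_wpM2r.
nra.
Qed.

Fact seminorm_locally_convex :
  exists2 B : set_system T, (forall b, b \in B -> convex_set b) & basis B.
Proof.
exists [set U : set T | exists (x : V) n e, U = [set y : T | Q n ((y : V) - x) < e]].
  move=> _ /set_mem[x [n [e ->]]] y z k /set_mem /= hy /set_mem /= hz.
  have k0 : 0 <= k%:num by []; have k1 : k%:num <= 1 by [].
  have kr : k%:num \is Num.real by rewrite ger0_real.
  set a := complex.Re k%:num.
  have ka : k%:num = a%:C by rewrite /a RRe_real.
  have k'a : 1 - k%:num = (1 - a)%:C by rewrite ka rmorphB rmorph1.
  have a0 : 0 <= a by rewrite -lecR -ka.
  have a1 : a <= 1 by rewrite -(lecR a 1) -ka.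
  apply/mem_set => /=.
  have -> : conv k y z - x = a%:C *: ((y : V) - x) + (1 - a)%:C *: ((z : V) - x).
    rewrite !scalerBr addrACA -opprD -scalerDl -rmorphD [a + _]addrC subrK scale1r.
    by rewrite -k'a -ka.
  apply: le_lt_trans ((sQ n).1 _ _) _.
  rewrite !(seminorm_scale_real (sQ n)) ?subr_ge0 //.
  have [a_gt|a_le] := ltP 0 a; first by nra.
  have -> : a = 0 by lra.
  by rewrite mul0r add0r subr0 mul1r.
split.
  move=> _ [x [n [e ->]]]; rewrite openE => y /= lt.
  exact: seminorm_ball_nbhs.
move=> x U /seminorm_nbhsP[n [e [e0 eU]]].
exists [set y : T | Q n ((y : V) - x) < e]; last by move=> y /=; exact: eU.
split; first by exists x, n, e.
by rewrite /= subrr (seminorm0 (sQ n)).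
Qed.

HB.instance Definition _ := PreTopologicalLmod_isTvs.Build R[i] T
  seminorm_add_continuous seminorm_scale_continuous seminorm_locally_convex.
HB.instance Definition _ := PreTopologicalNmodule_isTopologicalNmodule.Build T
  seminorm_add_continuous.
HB.instance Definition _ := TopologicalNmodule_isTopologicalLmodule.Build R[i] T
  seminorm_scale_continuous.
HB.instance Definition _ := Uniform_isTvs.Build R[i] T seminorm_locally_convex.

Lemma seminorm_tvs_csn n : @csn R T (p n).
Proof.
split=> [|e e0]; first exact: sp.
apply/seminorm_nbhsP; exists n, e; split=> // y; rewrite subr0 => lt.
apply: le_lt_trans lt; rewrite /Q big_ord_recr /= lerDr.
by apply: sumr_ge0 => i _; exact: seminorm_ge0.
Qed.

Lemma seminorm_tvs_nbhs0 (U : set T) :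
  (forall n m x, (n <= m)%N -> p n x <= p m x) ->
  nbhs (0 : T) U -> exists n e, 0 < e /\ [set x : T | p n x < e] `<=` U.
Proof.
move=> mp /seminorm_nbhsP[n [e [e0 eU]]].
exists n, (e / n.+1%:R); split=> [|x /= lt]; first by rewrite divr_gt0.
apply: eU; rewrite subr0; apply: le_lt_trans (_ : _ <= \sum_(k < n.+1) p n x) _.
  by apply: ler_sum => k _; apply: mp; rewrite -ltnS.
by rewrite sumr_const card_ord -mulr_natr -ltr_pdivlMr.
Qed.

End SeminormTvs.

Section TensorConstruction.
Variables (R : realType) (E F : tvsType R[i]).
Variables (qE : nat -> E -> R) (qF : nat -> F -> R).

Definition bilinear_ball n (b : E -> F -> R[i]^o) :=
  bilinear_map b /\ forall x z, cabs (b x z) <= qE n x * qF n z.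

(** Once the sequences [qE] and [qF] are cofinal among the continuous seminorms, these are the
    jointly continuous bilinear forms. *)
Definition bounded_bilinear := {b : E -> F -> R[i]^o | exists n, bilinear_ball n b}.

Definition elementary_tensor (x : E) (z : F) : bounded_bilinear -> R[i]^o :=
  fun s => sval s x z.

Let elementary := [set t | exists x z, t = elementary_tensor x z].

(* The completed tensor product is realized inside the functions on bounded
   bilinear forms, as the closure of the span of the elementary tensors for
   uniform convergence on each [bilinear_ball n]. *)
Definition tensor_pred : {pred (bounded_bilinear -> R[i]^o)} := fun t =>
  `[< forall n e, 0 < e -> exists2 v, linear_span elementary v &
      forall s, bilinear_ball n (sval s) -> cabs (t s - v s) <= e >].

Fact tensor_submod_closed : submod_closed tensor_pred.
Proof.
have [span0 spanL] := subspace_linear_span elementary.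
split=> [|a t u /asboolP ht /asboolP hu]; apply/asboolP => n e e0.
  by exists 0 => // s _; rewrite subrr cabs0 ltW.
have a1 : 0 < cabs a + 1 by have := cabs_ge0 a; lra.
have [|v Sv hv] := ht n (e / 2 / (cabs a + 1)); first by rewrite !divr_gt0.
have [|w Sw hw] := hu n (e / 2); first by rewrite divr_gt0.
exists (a *: v + w); first exact: spanL.
move=> s bs; rewrite !fctE opprD addrACA -scalerBr.
apply: le_trans (cabsD _ _) _; rewrite cabsM.
have := hw s bs; have := hv s bs; rewrite ler_pdivlMr // => h1 h2.
have := cabs_ge0 (t s - v s); have := cabs_ge0 a; nra.
Qed.

HB.instance Definition _ := GRing.isSubmodClosed.Build R[i]
  (bounded_bilinear -> R[i]^o) tensor_pred tensor_submod_closed.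

Record tensor := Tensor
  { tensor_val :> bounded_bilinear -> R[i]^o; _ : tensor_val \in tensor_pred }.

HB.instance Definition _ := [isSub for tensor_val].
HB.instance Definition _ := [Choice of tensor by <:].
HB.instance Definition _ := [SubChoice_isSubLmodule of tensor by <:].

Implicit Types (t u : tensor) (s : bounded_bilinear).

Lemma tensor_val_inj t u : (forall s, t s = u s) -> t = u.
Proof. by move=> tu; apply: val_inj; apply/funext. Qed.

Lemma tensorD t u s : (t + u) s = t s + u s. Proof. by []. Qed.

Lemma tensorZ a t s : (a *: t) s = a *: t s. Proof. by []. Qed.

Lemma tensorB t u s : (t - u) s = t s - u s. Proof. by []. Qed.

Lemma tensor_sum n (w : 'I_n -> tensor) s :
  (\sum_(i < n) w i) s = \sum_(i < n) w i s.
Proof. by rewrite (@lin_sum _ _ R[i]^o (fun t : tensor => t s)). Qed.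

Fact tau_subproof x z : elementary_tensor x z \in tensor_pred.
Proof.
apply/asboolP => n e e0; exists (elementary_tensor x z).
  by apply: sub_linear_span; exists x, z.
by move=> s _; rewrite subrr cabs0 ltW.
Qed.

Definition tensor_of x z : tensor := Tensor (tau_subproof x z).

Definition tensor_bounds n t :=
  [set M | 0 <= M /\ forall s, bilinear_ball n (sval s) -> cabs (t s) <= M].

Definition tensor_seminorm n t : R := inf (tensor_bounds n t).

Hypotheses (cE : forall n, csn (qE n)) (cF : forall n, csn (qF n)).
Let sE n := csn_seminorm (cE n).
Let sF n := csn_seminorm (cF n).

Let bounds_ne n t : tensor_bounds n t !=set0.
Proof.
have /asboolP ht := valP t.
have [v [m [c [w [Sw ->]]]] hv] := ht n 1 ltr01.
have /choice[xz xzE] : forall i, exists xz : E * F, w i = elementary_tensor xz.1 xz.2.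
  by move=> i; have [x [z ->]] := Sw i; exists (x, z).
pose B := \sum_(i < m) cabs (c i) * (qE n (xz i).1 * qF n (xz i).2).
have B0 : 0 <= B.
  by apply: sumr_ge0 => i _; rewrite !mulr_ge0 ?cabs_ge0 ?seminorm_ge0.
exists (1 + B); split=> [|s bs]; first by rewrite addr_ge0.
rewrite -[X in cabs X](subrK ((\sum_(i < m) c i *: w i) s)).
apply: le_trans (cabsD _ _) _; apply: lerD; first exact: hv.
rewrite /B; elim: (m) c w xz xzE {Sw hv B B0} => [|k ih] c w xz xzE.
  by rewrite !big_ord0 cabs0.
rewrite !big_ord_recr /= fctE; apply: le_trans (cabsD _ _) _; apply: lerD.
  by apply: ih => i; exact: xzE.
rewrite fctE cabsM ler_wpM2l ?cabs_ge0 // xzE; exact: bs.2.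
Qed.

Let bounds_lb n t : has_lbound (tensor_bounds n t).
Proof. by exists 0 => M []. Qed.

Lemma tensor_seminorm_le n t M : 0 <= M ->
  (forall s, bilinear_ball n (sval s) -> cabs (t s) <= M) -> tensor_seminorm n t <= M.
Proof. by move=> M0 tM; apply: ge_inf. Qed.

Lemma tensor_seminormP n t s : bilinear_ball n (sval s) ->
  cabs (t s) <= tensor_seminorm n t.
Proof.
by move=> bs; apply: lb_le_inf => // M [_]; apply.
Qed.

Lemma tensor_seminorm_ge0 n t : 0 <= tensor_seminorm n t.
Proof. by apply: lb_le_inf => // M []. Qed.

Lemma seminorm_tensor n : seminorm (tensor_seminorm n).
Proof.
apply: seminorm_subhomogeneous => [|t u|a t]; first exact: tensor_seminorm_ge0.
  apply: tensor_seminorm_le => [|s bs]; first by rewrite addr_ge0 ?tensor_seminorm_ge0.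
  by rewrite tensorD; apply: le_trans (cabsD _ _) _; rewrite lerD ?tensor_seminormP.
apply: tensor_seminorm_le => [|s bs].
  by rewrite mulr_ge0 ?cabs_ge0 ?tensor_seminorm_ge0.
by rewrite tensorZ cabsM ler_wpM2l ?cabs_ge0 ?tensor_seminormP.
Qed.

Local Notation T := (seminorm_tvs seminorm_tensor).
Local Notation tau := (tensor_of : E -> F -> T).

Hypotheses (mE : forall n m, (n <= m)%N -> forall x, qE n x <= qE m x)
  (mF : forall n m, (n <= m)%N -> forall x, qF n x <= qF m x).

Let ball_mono n m b : (n <= m)%N -> bilinear_ball n b -> bilinear_ball m b.
Proof.
move=> nm [bb hb]; split=> // x z; apply: le_trans (hb x z) _.
by apply: ler_pM; rewrite ?seminorm_ge0 ?mE ?mF.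
Qed.

Let csn_tensor n : @csn R T (tensor_seminorm n) := seminorm_tvs_csn seminorm_tensor n.

Let nbhs_tensor (U : set T) : nbhs (0 : T) U ->
  exists n e, 0 < e /\ [set x : T | tensor_seminorm n x < e] `<=` U.
Proof.
apply: seminorm_tvs_nbhs0 => n m t nm; apply: tensor_seminorm_le => [|s bs].
  exact: tensor_seminorm_ge0.
by apply: tensor_seminormP; exact: ball_mono bs.
Qed.

Let csn_le_tensor (q : T -> R) : csn q ->
  exists n C, 0 < C /\ forall t, q t <= C * tensor_seminorm n t.
Proof.
move=> [sq nq]; have [n [e [e0 eU]]] := nbhs_tensor (nq 1 ltr01).
exists n, e^-1; split=> [|t]; first by rewrite invr_gt0.
have ei0 : 0 <= e^-1 by rewrite invr_ge0 ltW.
apply: (seminorm_le_scale sq (seminormZ ei0 (seminorm_tensor n))) => u.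
by rewrite mulrC ltr_pdivrMr// mul1r => /eU.
Qed.

Lemma tensor_frechet : frechet_space T.
Proof.
apply: (@frechet_space_seminorms R T tensor_seminorm csn_tensor nbhs_tensor).
  move=> t t0; apply: tensor_val_inj => -[b [n bn]]; apply: cabs0_eq0.
  apply/eqP; rewrite eq_le cabs_ge0 andbT -(t0 n); exact: tensor_seminormP.
move=> u cu.
have pt s : exists z : R[i]^o, seminorm_cvg (fun n => (u n : tensor) s) z.
  apply: frechet_cauchy_cvg; first exact: frechet_scalars.
  move=> q e cq e0; have [n bs] := svalP s.
  have q1 := seminorm_ge0 (csn_seminorm cq) 1.
  have c0 : 0 < q 1 + 1 by lra.
  have [N uN] := cu n _ (divr_gt0 e0 c0); exists N => i j Ni Nj.
  have := uN i j Ni Nj; rewrite ltr_pdivlMr // => lt.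
  rewrite (csn_scalar cq); have := tensor_seminormP (u i - u j : tensor) bs.
  rewrite tensorB; have := cabs_ge0 ((u i : tensor) s - (u j : tensor) s); nra.
have {pt} /choice[g gP] := pt.
have gN n e : 0 < e -> exists N, forall i, (N <= i)%N -> forall s,
    bilinear_ball n (sval s) -> cabs ((u i : tensor) s - g s) <= e.
  move=> e0; have [N uN] := cu n e e0; exists N => i Ni s bs.
  have := seminorm_cvg_le (csn_cabs R) (seminorm_cvgB ((u i : tensor) s) (gP s)).
  rewrite (seminorm_distC (@seminorm_cabs R)); apply; exists N => j Nj.
  rewrite -tensorB; apply: le_trans (tensor_seminormP _ bs) _.
  by apply: ltW; exact: uN.
have gT : (g : bounded_bilinear -> R[i]^o) \in tensor_pred.
  apply/asboolP => n e e0; have e20 : 0 < e / 2 by rewrite divr_gt0.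
  have [N hN] := gN n _ e20; have /asboolP/(_ n _ e20)[v Sv hv] := valP (u N : tensor).
  exists v => // s bs.
  have -> : g s - v s = ((u N : tensor) s - v s) - ((u N : tensor) s - g s).
    by rewrite opprB [RHS]addrC subrKA.
  apply: le_trans (cabsD _ _) _; rewrite cabsN.
  have := hv s bs; have := hN N (leqnn _) s bs; rewrite /=; lra.
exists (Tensor gT : T) => n e e0; have e20 : 0 < e / 2 by rewrite divr_gt0.
have [N hN] := gN n _ e20; exists N => i Ni.
apply: le_lt_trans (_ : _ <= e / 2) _; last by lra.
by apply: tensor_seminorm_le => [|s bs]; [exact: ltW | rewrite tensorB; exact: hN].
Qed.

Lemma tensor_of_bilinear : bilinear_map tau.
Proof.
split=> [x|z] a u v; apply: tensor_val_inj => s.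
  have [n [[bl _] _]] := svalP s; exact: bl.
have [n [[_ br] _]] := svalP s; exact: br.
Qed.

Lemma tensor_of_continuous : jointly_continuous tau.
Proof.
apply: (bilinear_continuous_csn tensor_of_bilinear) => q /csn_le_tensor[n [C [C0 qC]]].
exists (fun x => C * qE n x), (qF n); split=> //.
  by apply: csnZ => //; exact: ltW.
move=> x z; apply: le_trans (qC _) _; rewrite -mulrA ler_wpM2l ?(ltW C0) //.
apply: tensor_seminorm_le => [|s bs]; first by rewrite mulr_ge0 ?seminorm_ge0.
exact: bs.2.
Qed.

Lemma tensor_dense t : closure (linear_span [set v : T | exists x z, v = tau x z]) (t : T).
Proof.
apply/closure_csn => q e /csn_le_tensor[n [C [C0 qC]]] e0.
have e1 : 0 < e / C / 2 by rewrite !divr_gt0.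
have /asboolP/(_ n _ e1)[v [m [c [w [Sw ->]]]] hv] := valP t.
have /choice[xz xzE] : forall i, exists xz : E * F, w i = elementary_tensor xz.1 xz.2.
  by move=> i; have [x [z ->]] := Sw i; exists (x, z).
exists (\sum_(i < m) c i *: tau (xz i).1 (xz i).2).
  exists m, c, (fun i => tau (xz i).1 (xz i).2); split=> // i.
  by exists (xz i).1, (xz i).2.
apply: le_lt_trans (qC _) _; rewrite mulrC -ltr_pdivlMr //.
apply: le_lt_trans (_ : _ <= e / C / 2) _; last first.
  by have := divr_gt0 e0 C0; lra.
apply: tensor_seminorm_le => [|s bs]; first exact: ltW.
rewrite tensorB; have -> : (\sum_(i < m) c i *: tau (xz i).1 (xz i).2 : tensor) s =
    (\sum_(i < m) c i *: w i) s.
  rewrite tensor_sum fct_sumE; apply: eq_bigr => i _.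
  by rewrite tensorZ fctE xzE.
exact: hv.
Qed.

Hypothesis dE : forall p : E -> R, csn p -> exists n, forall x, p x <= qE n x.
Hypothesis dF : forall p : F -> R, csn p -> exists n, forall x, p x <= qF n x.

Let bilinear_ball_csn (p1 : E -> R) (p2 : F -> R) : csn p1 -> csn p2 ->
  exists n, forall b, bilinear_map b ->
    (forall x z, cabs (b x z) <= p1 x * p2 z) -> bilinear_ball n b.
Proof.
move=> c1 c2; have [n1 h1] := dE c1; have [n2 h2] := dF c2.
exists (maxn n1 n2) => b bb hb; split=> // x z; apply: le_trans (hb x z) _.
apply: ler_pM; rewrite ?(seminorm_ge0 (csn_seminorm c1)) //.
- exact: seminorm_ge0 (csn_seminorm c2) _.
- by apply: le_trans (h1 x) _; apply: mE; rewrite leq_maxl.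
- by apply: le_trans (h2 z) _; apply: mF; rewrite leq_maxr.
Qed.

Section Lift.
Variables (G : tvsType R[i]) (b : E -> F -> G).
Hypotheses (fG : frechet_space G) (bb : bilinear_map b) (cb : jointly_continuous b).

Let gb (g : G -> R[i]^o) := fun x z => g (b x z).

Let bilinear_gb g : linear g -> bilinear_map (gb g).
Proof.
have [bl br] := bb; move=> lg; split=> [x|z] a u v; rewrite /gb.
  by rewrite (bl x) lg.
by have /= -> := br z a u v; rewrite lg.
Qed.

Let ball_gb (r : G -> R) : csn r -> exists n, forall g, linear g ->
  (forall y, cabs (g y) <= r y) -> bilinear_ball n (gb g).
Proof.
move=> cr; have [p1 [p2 [c1 c2 le]]] := bilinear_csn bb cb cr.
have [n hn] := bilinear_ball_csn c1 c2; exists n => g lg gr.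
apply: hn => [|x z]; first exact: bilinear_gb.
exact: le_trans (gr _) (le x z).
Qed.

(* The image of [t] is the vector representing [g |-> t (g \o b)]. *)
Let represents (t : bounded_bilinear -> R[i]^o) (y : G) :=
  forall g s, dual G g -> sval s = gb g -> g y = t s.

Let represents_span v : linear_span elementary v -> exists y, represents v y.
Proof.
move=> [m [c [w [Sw ->]]]].
elim: m c w Sw => [|m ih] c w Sw.
  by exists 0 => g s dg _; rewrite big_ord0 (lin0 dg.1).
have [|y hy] := ih (fun i => c (widen_ord (leqnSn m) i)) (fun i => w (widen_ord (leqnSn m) i)).
  by move=> i; exact: Sw.
have [x [z wE]] := Sw ord_max.
exists (y + c ord_max *: b x z) => g s dg sgE.
rewrite (linD dg.1) (linZ dg.1) (hy g s dg sgE) big_ord_recr /= fctE; congr (_ + _).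
by rewrite fctE wE /elementary_tensor sgE.
Qed.

(** Approximants of [t] in the span are represented by explicit sums. A functional norming the
    difference of two representatives gives a form in a fixed [bilinear_ball], on which the
    approximants converge uniformly; so the representatives are Cauchy in [G]. *)
Let represents_ex (t : tensor) : exists y, represents t y.
Proof.
have /asboolP ht := valP t.
have /choice[v hv] : forall k, exists v, linear_span elementary v /\
    forall s, bilinear_ball k (sval s) -> cabs (t s - v s) <= (2^-1) ^+ k.
  by move=> k; have [v Sv hv] := ht k _ (expr_half_gt0 R k); exists v.
have /choice[y hy] : forall k, exists y, represents (v k) y.
  by move=> k; exact: represents_span (hv k).1.
have [|z yz] := frechet_cauchy_cvg fG (u := y).
  move=> r e cr e0; have [n hn] := ball_gb cr.
  have e20 : 0 < e / 2 by rewrite divr_gt0.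
  have [m me] := expr_half_lt e20.
  exists (maxn n m) => i j hi hj.
  have [g [lg gr gE]] := hahn_banach_point (y i - y j) (csn_seminorm cr).
  have dg : dual G g := csn_dual lg cr gr.
  have bg := hn g lg gr.
  pose s : bounded_bilinear := exist _ (gb g) (ex_intro _ n bg).
  have near k : (maxn n m <= k)%N -> cabs (t s - v k s) < e / 2.
    move=> hk; apply: le_lt_trans ((hv k).2 s _) _.
      by apply: (ball_mono _ bg); apply: leq_trans hk; exact: leq_maxl.
    apply: le_lt_trans me; apply: ler_wiXn2l; rewrite ?(leq_trans (leq_maxr n m)) //; lra.
  have -> : r (y i - y j) = cabs (g (y i - y j)).
    by rewrite gE cabs_real // seminorm_ge0 //; exact: csn_seminorm.
  rewrite (linB lg) (hy i g s) // (hy j g s) //.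
  have -> : v i s - v j s = (t s - v j s) - (t s - v i s).
    by rewrite opprB [RHS]addrC subrKA.
  apply: le_lt_trans (cabsD _ _) _; rewrite cabsN.
  have := near i hi; have := near j hj; lra.
exists z => g s dg sgE.
have [n hn] := ball_gb (dual_csn dg).
have bs : bilinear_ball n (sval s) by rewrite sgE; apply: hn => //; exact: dg.1.
apply/eqP; rewrite -subr_eq0; apply/eqP/cabs0_eq0/eqP.
rewrite eq_le cabs_ge0 andbT; apply/ler_addgt0Pr => e e0; rewrite add0r.
have e20 : 0 < e / 2 by rewrite divr_gt0.
have [N hN] := yz _ _ (dual_csn dg) e20; have [m me] := expr_half_lt e20.
pose k := maxn N (maxn n m).
have [Nk nk mk] : [/\ (N <= k)%N, (n <= k)%N & (m <= k)%N] by rewrite /k; split; lia.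
have := hN k Nk; rewrite (linB dg.1) (hy k g s) // => h1.
have h2 : cabs (t s - v k s) <= (2^-1) ^+ m.
  apply: le_trans ((hv k).2 s (ball_mono nk bs)) _.
  by apply: ler_wiXn2l => //; lra.
have -> : g z - t s = - (v k s - g z) - (t s - v k s).
  by rewrite !opprB subrKA.
apply: le_trans (cabsD _ _) _; rewrite !cabsN; lra.
Qed.

Lemma tensor_lift_exists : exists! phi : T -> G,
  [/\ linear phi, continuous phi & forall x z, phi (tau x z) = b x z].
Proof.
have /choice[phi hphi] := represents_ex.
have hG : hausdorff_space G by case: fG.
have dual_s g : dual G g -> exists n s, bilinear_ball n (sval s) /\ sval s = gb g.
  move=> dg; have [n hn] := ball_gb (dual_csn dg).
  have bg : bilinear_ball n (gb g) by apply: hn => //; exact: dg.1.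
  by exists n, (exist _ (gb g) (ex_intro _ n bg)).
have lphi : linear (phi : T -> G).
  move=> a t u; apply/eqP; rewrite -subr_eq0; apply/eqP/dual_separates => // g dg.
  have [n [s [bs sgE]]] := dual_s g dg.
  rewrite (linB dg.1) dg.1 !(hphi _ g s) // tensorD tensorZ.
  by rewrite subrr.
have cphi : continuous (phi : T -> G).
  apply: (@linear_continuous_csn R T) => // r cr; have [n hn] := ball_gb cr.
  exists (tensor_seminorm n); first exact: csn_tensor.
  move=> t; have [g [lg gr gE]] := hahn_banach_point (phi t) (csn_seminorm cr).
  pose s : bounded_bilinear := exist _ (gb g) (ex_intro _ n (hn g lg gr)).
  have -> : r (phi t) = cabs (t s).
    rewrite -(hphi t g s) //; last exact: csn_dual lg cr gr.
    by rewrite gE cabs_real // seminorm_ge0 //; exact: csn_seminorm.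
  by apply: tensor_seminormP; exact: (hn g lg gr).
have phiE x z : phi (tau x z) = b x z.
  apply/eqP; rewrite -subr_eq0; apply/eqP/dual_separates => // g dg.
  have [n [s [bs sgE]]] := dual_s g dg.
  by rewrite (linB dg.1) (hphi _ g s) //= /elementary_tensor sgE subrr.
exists phi; split=> // psi [lpsi cpsi psiE]; apply/funext => t.
apply/eqP; rewrite -subr_eq0; apply/eqP/dual_separates => // g dg.
pose f u : R[i]^o := g (phi u) - g (psi u).
have lf : linear (f : T -> R[i]^o).
  by move=> a u v; rewrite /f lphi lpsi !dg.1 scalerBr opprD addrACA.
have df : dual T (f : T -> R[i]^o).
  apply: (@csn_dual R T _ (fun u => cabs (g (phi u)) + cabs (g (psi u)))) => //.
    by apply: csnD;
      [exact: (csn_comp (dual_csn dg) lphi cphi)|exact: (csn_comp (dual_csn dg) lpsi cpsi)].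
  by move=> u; apply: le_trans (cabsD _ _) _; rewrite cabsN.
rewrite (linB dg.1) -/(f t).
apply: (closure_min_dual df _ (@tensor_dense t)) => u.
have sK : subspace [set u : T | f u = 0].
  split=> [|a x y /= Hx Hy] /=; first exact: lin0 lf.
  by rewrite lf Hx Hy scaler0 addr0.
apply: (linear_span_min sK) => _ [x [z ->]].
by rewrite /= /f phiE psiE subrr.
Qed.

End Lift.

Lemma tensor_projective : projective_tensor tau.
Proof.
split; [exact: tensor_frechet|exact: tensor_of_bilinear|exact: tensor_of_continuous|].
by move=> G b fG bb cb; exact: tensor_lift_exists.
Qed.

(** A functional norming [phi t] turns the hypothesis on [phi] into membership of a scalar form in
    one [bilinear_ball n], where the n-th tensor seminorm bounds [t]. *)
Lemma tensor_of_estimates : tensor_estimates tau.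
Proof.
move=> p1 p2 c1 c2; have [n hn] := bilinear_ball_csn c1 c2.
exists (tensor_seminorm n) => [|G phi r C lphi cphi cr C0 hr t].
  exact: csn_tensor.
have [g [lg gr gE]] := hahn_banach_point (phi t) (csn_seminorm cr).
have -> : r (phi t) = cabs (g (phi t)).
  by rewrite gE cabs_real // seminorm_ge0 //; exact: csn_seminorm.
have p10 x : 0 <= p1 x by exact: seminorm_ge0 (csn_seminorm c1) x.
have p20 x : 0 <= p2 x by exact: seminorm_ge0 (csn_seminorm c2) x.
(* [C] may be 0, so the form is divided by a slightly larger [D]. *)
suff pos D : 0 < D -> C <= D -> cabs (g (phi t)) <= D * tensor_seminorm n t.
  apply/ler_addgt0Pr => e e0; have P0 := tensor_seminorm_ge0 n t.
  have P1 : 0 < tensor_seminorm n t + 1 by lra.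
  have d0 : 0 < e / (tensor_seminorm n t + 1) by rewrite divr_gt0.
  apply: le_trans (pos (C + e / (tensor_seminorm n t + 1)) _ _) _; try lra.
  rewrite mulrDl lerD2l mulrAC ler_pdivrMr //; nra.
move=> D0 CD.
pose c x z : R[i]^o := D^-1%:C *: g (phi (tau x z)).
have [btl btr] := tensor_of_bilinear.
have bc : bilinear_ball n c.
  apply: hn => [|x z].
    split=> [x|z] a u v; rewrite /c.
      by rewrite (btl x) lphi lg scalerDr !scalerA (mulrC a).
    by have /= -> := btr z a u v; rewrite lphi lg scalerDr !scalerA (mulrC a).
  rewrite cabsM cabs_real ?invr_ge0 ?(ltW D0) // ler_pdivrMl //.
  apply: le_trans (gr _) _; apply: le_trans (hr _ _) _.
  by rewrite ler_wpM2r // mulr_ge0.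
pose s : bounded_bilinear := exist _ c (ex_intro _ n bc).
have -> : g (phi t) = D%:C *: (t : tensor) s.
  have lgphi : linear (fun t => g (phi t)) by move=> a u v; rewrite lphi lg.
  apply: (tensor_ext tensor_projective (frechet_scalars R) (phi := fun t => g (phi t))
    (psi := fun t : T => D%:C *: (t : tensor) s)) => //.
  - by move=> u; apply: continuous_comp; [exact: cphi | exact: (csn_dual lg cr gr).2].
  - by move=> a u v; rewrite tensorD tensorZ scalerDr !scalerA (mulrC a).
  - apply: (@linear_continuous_csn R T) => [a u v|q cq].
      by rewrite tensorD tensorZ scalerDr !scalerA (mulrC a).
    exists (fun u => q 1 * D * tensor_seminorm n u).
      apply: csnZ; last exact: csn_tensor.
      by rewrite mulr_ge0 ?(ltW D0) // seminorm_ge0 //; exact: csn_seminorm.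
    move=> u; rewrite (csn_scalar cq) cabsM cabs_real ?(ltW D0) // -mulrA.
    apply: ler_wpM2l; first by apply: seminorm_ge0; exact: csn_seminorm.
    by apply: ler_wpM2l; [exact: ltW | exact: tensor_seminormP].
  - move=> x z; rewrite /= /elementary_tensor /= /c scalerA -rmorphM.
    by rewrite divff ?gt_eqF // scale1r.
rewrite cabsM cabs_real ?(ltW D0) // ler_wpM2l ?(ltW D0) //.
exact: tensor_seminormP.
Qed.

End TensorConstruction.

Lemma projective_tensor_exists (R : realType) (E F : tvsType R[i]) :
  frechet_space E -> frechet_space F ->
  exists (T : tvsType R[i]) (tau : E -> F -> T), projective_tensor tau /\
    tensor_estimates tau.
Proof.
move=> /frechet_basis[qE [cE mE dE]] /frechet_basis[qF [cF mF dF]].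
exists (seminorm_tvs (seminorm_tensor cE cF)), (@tensor_of R E F qE qF).
by split; [exact: tensor_projective | exact: tensor_of_estimates].
Qed.

(** * The enveloping algebra and its modules *)

Section LinearContinuous.
Variable R : realType.

Definition lincont (V W : tvsType R[i]) (f : V -> W) := linear f /\ continuous f.

Lemma lincont_comp (U V W : tvsType R[i]) (f : U -> V) (g : V -> W) :
  lincont f -> lincont g -> lincont (fun x => g (f x)).
Proof.
move=> [lf cf] [lg cg]; split=> [a x y|x]; first by rewrite lf lg.
by apply: continuous_comp; [exact: cf | exact: cg].
Qed.

Lemma lincont_csn (V W : tvsType R[i]) (f : V -> W) : linear f ->
  (forall q, csn q -> exists2 p, csn p & forall x, q (f x) <= p x) -> lincont f.
Proof. by move=> lf hf; split=> //; exact: linear_continuous_csn. Qed.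

Lemma lincontDZ (V W : tvsType R[i]) (a : R[i]) (f g : V -> W) :
  lincont f -> lincont g -> lincont (fun x => a *: f x + g x).
Proof.
move=> [lf cf] [lg cg]; apply: lincont_csn => [c x y|q cq].
  rewrite lf lg !scalerDr addrACA; congr (_ + _ + _).
  by rewrite !scalerA mulrC.
exists (fun x => cabs a * q (f x) + q (g x)).
  apply: csnD; last exact: (csn_comp cq lg cg).
  by apply: csnZ; [exact: cabs_ge0 | exact: (csn_comp cq lf cf)].
by move=> x; apply: le_trans ((csn_seminorm cq).1 _ _) _; rewrite (csn_seminorm cq).2.
Qed.

Lemma lincont_bilinear_l (U V W : tvsType R[i]) (b : U -> V -> W) x :
  bilinear_map b -> jointly_continuous b -> lincont (b x).
Proof. by move=> [bl _] cb; split=> //; exact: bilinear_continuous_l. Qed.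

Lemma lincont_bilinear_r (U V W : tvsType R[i]) (b : U -> V -> W) y :
  bilinear_map b -> jointly_continuous b -> lincont (b^~ y).
Proof. by move=> [_ br] cb; split=> //; exact: bilinear_continuous_r. Qed.

Lemma bilinear_flip (U V W : tvsType R[i]) (b : U -> V -> W) :
  bilinear_map b -> jointly_continuous b ->
  bilinear_map (fun y x => b x y) /\ jointly_continuous (fun y x => b x y).
Proof.
move=> bb cb; have bf : bilinear_map (fun y x => b x y) by case: bb => ? ?; split.
split=> //; apply: bilinear_continuous_csn => // q cq.
have [p1 [p2 [c1 c2 le]]] := bilinear_csn bb cb cq.
by exists p2, p1; split=> // y x; rewrite mulrC; exact: le.
Qed.

End LinearContinuous.

Section TensorLift.
Variables (R : realType) (E F T : tvsType R[i]) (tau : E -> F -> T).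

Hypotheses (hT : projective_tensor tau) (hest : tensor_estimates tau).
Variable G : tvsType R[i].
Hypothesis fG : frechet_space G.

Lemma tensor_ext_lincont (phi psi : T -> G) : lincont phi -> lincont psi ->
  (forall x y, phi (tau x y) = psi (tau x y)) -> forall t, phi t = psi t.
Proof. by move=> [? ?] [? ?] h; exact: (tensor_ext hT fG). Qed.

(** The parameter enters the bound of the lifts only through [K i], with one [P] for all; this is
    how dependence on a further variable is controlled. *)
Lemma tensor_lift_family (I : Type) (m : I -> E -> F -> G) :
  (forall i, bilinear_map (m i)) ->
  (forall q, csn q -> exists K p1 p2, [/\ forall i, 0 <= K i, csn p1, csn p2
     & forall i x z, q (m i x z) <= K i * (p1 x * p2 z)]) ->
  exists M : I -> T -> G, [/\ forall i, lincont (M i),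
    forall i x z, M i (tau x z) = m i x z
    & forall q K p1 p2, csn q -> (forall i, 0 <= K i) -> csn p1 -> csn p2 ->
      (forall i x z, q (m i x z) <= K i * (p1 x * p2 z)) ->
      exists2 P, csn P & forall i t, q (M i t) <= K i * P t].
Proof.
move=> bm hm.
have /choice[M hM] : forall i, exists phi : T -> G, lincont phi /\
    forall x z, phi (tau x z) = m i x z.
  move=> i; have [|phi [lphi cphi phiE]] := tensor_lift hT fG (bm i).
    apply: bilinear_continuous_csn => // q /hm[K [p1 [p2 [K0 c1 c2 le]]]].
    exists (fun x => K i * p1 x), p2; split=> //; first exact: csnZ.
    by move=> x z; rewrite -mulrA; exact: le.
  by exists phi; do 2?split.
exists M; split=> [i|i x z|q K p1 p2 cq K0 c1 c2 le].
- exact: (hM i).1.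
- exact: (hM i).2.
have [P cP hP] := hest c1 c2; exists P => // i t.
have [[lM cM] ME] := hM i.
by apply: (hP G (M i) q (K i)) => // x z; rewrite ME; exact: le.
Qed.

(** [Y] serves as the index type of a family; with [q0] as the constants, the uniform estimate
    becomes joint continuity in [Y] and [T]. *)
Lemma tensor_lift_trilinear (Y : tvsType R[i]) (m : Y -> E -> F -> G) :
  (forall y, bilinear_map (m y)) -> (forall x z, linear (fun y => m y x z)) ->
  (forall q, csn q -> exists q0 p1 p2, [/\ csn q0, csn p1, csn p2
     & forall y x z, q (m y x z) <= q0 y * (p1 x * p2 z)]) ->
  exists M : Y -> T -> G, [/\ bilinear_map M, jointly_continuous M
    & forall y x z, M y (tau x z) = m y x z].
Proof.
move=> bm lm hm.
have [||M [lcM ME Mle]] := @tensor_lift_family Y m.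
- exact: bm.
- move=> q /hm[q0 [p1 [p2 [c0 c1 c2 le]]]]; exists q0, p1, p2; split=> // y.
  exact: seminorm_ge0 (csn_seminorm c0) y.
have bM : bilinear_map M.
  split=> [y|t a y y']; first by case: (lcM y).
  apply: (tensor_ext_lincont (phi := M (a *: y + y'))
    (psi := fun t => a *: M y t + M y' t)) => [||x z].
  - exact: lcM.
  - exact: lincontDZ.
  - by rewrite !ME lm.
exists M; split=> //; apply: bilinear_continuous_csn => // q cq.
have [q0 [p1 [p2 [c0 c1 c2 le]]]] := hm q cq.
have [|P cP hP] := Mle q q0 p1 p2 cq _ c1 c2 le.
  by move=> y; exact: seminorm_ge0 (csn_seminorm c0) y.
by exists q0, P.
Qed.

End TensorLift.

Section EnvelopingAlgebra.
Variables (R : realType) (A : tvsType R[i]) (mul : A -> A -> A).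
Hypothesis fA : frechet_algebra mul.
Local Notation Ap := (unitization A).
Local Notation "x ** y" := (unitization_mul mul x y) (at level 40).
Variables (E : tvsType R[i]) (tau : Ap -> Ap -> E).
Hypotheses (hT : projective_tensor tau) (hest : tensor_estimates tau).

Let fsA : frechet_space A. Proof. by case: fA. Qed.
Let bm : bilinear_map mul. Proof. by case: fA. Qed.
Let am : associative mul. Proof. by case: fA. Qed.
Let bum : bilinear_map (unitization_mul mul) := unitization_mul_bilinear bm.
Let cum : jointly_continuous (unitization_mul mul) := unitization_mul_continuous fA.
Let mulA : associative (unitization_mul mul) := unitization_mulA bm am.
Let fE : frechet_space E. Proof. by case: hT. Qed.
Let btau : bilinear_map tau. Proof. by case: hT. Qed.
Let ctau : jointly_continuous tau. Proof. by case: hT. Qed.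

(** The product is lifted one factor at a time: [M (c, d)] is right multiplication by c ⊗ d, and the
    dependence on (c, d) is lifted next. Associativity is reduced to elementary tensors in one
    variable after the other. *)
Lemma enveloping_algebra_exists : exists mulE : E -> E -> E,
  enveloping_algebra mul tau mulE.
Proof.
have [buml bumr] := bum; have [btl btr] := btau.
have [||M [lM ME Mle]] := @tensor_lift_family _ _ _ _ _ hT hest E fE (Ap * Ap)%type
    (fun cd a b => tau (a ** cd.1) (cd.2 ** b)).
- move=> [c d]; split=> [a|b] t u v /=; first by rewrite (buml d) (btl _).
  by have /= -> := bumr c t u v; exact: btr.
- move=> q cq; have [p1 [p2 [c1 c2 le]]] := bilinear_csn btau ctau cq.
  have [p11 [p12 [c11 c12 le1]]] := bilinear_csn bum cum c1.
  have [p21 [p22 [c21 c22 le2]]] := bilinear_csn bum cum c2.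
  exists (fun cd => p12 cd.1 * p21 cd.2), p11, p22; split=> // [[c d]|[c d] a b] /=.
    by rewrite mulr_ge0 ?(seminorm_ge0 (csn_seminorm c12)) ?(seminorm_ge0 (csn_seminorm c21)).
  apply: le_trans (le _ _) _.
  have -> : p12 c * p21 d * (p11 a * p22 b) = (p11 a * p12 c) * (p21 d * p22 b) by ring.
  by apply: ler_pM => //; [exact: seminorm_ge0 (csn_seminorm c1) _ |
    exact: seminorm_ge0 (csn_seminorm c2) _].
have [|||mulE [bM cM mE]] := @tensor_lift_trilinear _ _ _ _ _ hT hest E fE E
    (fun e c d => M (c, d) e).
- move=> e; split=> [c|d] t u v.
    apply: (tensor_ext_lincont hT fE (phi := M (c, t *: u + v))
      (psi := fun e => t *: M (c, u) e + M (c, v) e)) => [||a b].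
    + exact: lM.
    + exact: lincontDZ.
    + rewrite !ME /=; have /= -> := bumr b t u v; exact: btl.
  apply: (tensor_ext_lincont hT fE (phi := M (t *: u + v, d))
      (psi := fun e => t *: M (u, d) e + M (v, d) e)) => [||a b].
  + exact: lM.
  + exact: lincontDZ.
  + by rewrite !ME /= (buml a); exact: btr.
- by move=> c d; case: (lM (c, d)).
- move=> q cq; have [p1 [p2 [c1 c2 le]]] := bilinear_csn btau ctau cq.
  have [p11 [p12 [c11 c12 le1]]] := bilinear_csn bum cum c1.
  have [p21 [p22 [c21 c22 le2]]] := bilinear_csn bum cum c2.
  have [||P cP hP] := Mle q (fun cd => p12 cd.1 * p21 cd.2) p11 p22 cq _ c11 c22.
  + by move=> [c d]; rewrite mulr_ge0 ?(seminorm_ge0 (csn_seminorm c12))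
      ?(seminorm_ge0 (csn_seminorm c21)).
  + move=> [c d] a b /=; apply: le_trans (le _ _) _.
    have -> : p12 c * p21 d * (p11 a * p22 b) = (p11 a * p12 c) * (p21 d * p22 b) by ring.
    by apply: ler_pM => //; [exact: seminorm_ge0 (csn_seminorm c1) _ |
      exact: seminorm_ge0 (csn_seminorm c2) _].
  exists P, p12, p21; split=> // e c d; rewrite mulrC; exact: hP.
have mtau a b c d : mulE (tau a b) (tau c d) = tau (a ** c) (d ** b).
  by rewrite mE ME.
exists mulE; split=> //; split=> //.
have lr e := lincont_bilinear_r e bM cM; have ll e := lincont_bilinear_l e bM cM.
move=> e e' e''.
apply: (tensor_ext_lincont hT fE (phi := fun e'' => mulE e (mulE e' e''))
  (psi := fun e'' => mulE (mulE e e') e'')) => [||a3 b3].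
- by apply: (@lincont_comp _ _ _ _ (mulE e') (mulE e)).
- exact: ll.
apply: (tensor_ext_lincont hT fE (phi := fun e' => mulE e (mulE e' (tau a3 b3)))
  (psi := fun e' => mulE (mulE e e') (tau a3 b3))) => [||a2 b2].
- by apply: (@lincont_comp _ _ _ _ (mulE^~ (tau a3 b3)) (mulE e)).
- by apply: (@lincont_comp _ _ _ _ (mulE e) (mulE^~ (tau a3 b3))).
apply: (tensor_ext_lincont hT fE (phi := fun e => mulE e (mulE (tau a2 b2) (tau a3 b3)))
  (psi := fun e => mulE (mulE e (tau a2 b2)) (tau a3 b3))) => [||a1 b1].
- exact: lr.
- by apply: (@lincont_comp _ _ _ _ (mulE^~ (tau a2 b2)) (mulE^~ (tau a3 b3))).
by rewrite !mtau !mulA.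
Qed.

Variable mulE : E -> E -> E.
Hypothesis hE : enveloping_algebra mul tau mulE.

Let bmE : bilinear_map mulE. Proof. by case: hE => _ []. Qed.
Let cmE : jointly_continuous mulE. Proof. by case: hE => _ []. Qed.
Let mtau a b c d : mulE (tau a b) (tau c d) = tau (a ** c) (d ** b).
Proof. by case: hE. Qed.

(** Amenability is a statement about all enveloping algebras and all actions of this form; to draw a
    consequence from it, one action has to exist. *)
Lemma left_module_unitization : exists act : E -> Ap -> Ap,
  left_frechet_module mulE act /\
  forall a b x, act (tau a b) x = a ** x ** b.
Proof.
have [buml bumr] := bum; have fAp := frechet_unitization fsA.
have [|||M [bM cM ME]] := @tensor_lift_trilinear _ _ _ _ _ hT hest Ap fAp Ap
    (fun x a b => a ** x ** b).
- move=> x; split=> [a|b] t u v; first exact: buml.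
  by have /= -> := bumr x t u v; exact: bumr.
- by move=> a b t u v; rewrite (buml a); exact: bumr.
- move=> q cq; have [p1 [p2 [c1 c2 le]]] := bilinear_csn bum cum cq.
  have [p11 [p12 [c11 c12 le1]]] := bilinear_csn bum cum c1.
  exists p12, p11, p2; split=> // x a b; apply: le_trans (le _ _) _.
  have -> : p12 x * (p11 a * p2 b) = p11 a * p12 x * p2 b by ring.
  by rewrite ler_wpM2r // (seminorm_ge0 (csn_seminorm c2)).
have [bM' cM'] := bilinear_flip bM cM.
exists (fun e x => M x e); split=> [|a b x]; last by rewrite ME.
split=> // e e' x.
apply: (tensor_ext_lincont hT fAp (phi := fun e' => M x (mulE e e'))
  (psi := fun e' => M (M x e') e)) => [||a2 b2].
- apply: (@lincont_comp _ _ _ _ (mulE e) (M x)); exact: lincont_bilinear_l.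
- apply: (@lincont_comp _ _ _ _ (M x) (M^~ e)).
    exact: lincont_bilinear_l.
  exact: lincont_bilinear_r.
apply: (tensor_ext_lincont hT fAp (phi := fun e => M x (mulE e (tau a2 b2)))
  (psi := fun e => M (M x (tau a2 b2)) e)) => [||a1 b1].
- apply: (@lincont_comp _ _ _ _ (mulE^~ (tau a2 b2)) (M x)).
    exact: lincont_bilinear_r.
  exact: lincont_bilinear_l.
- exact: lincont_bilinear_l.
by rewrite mtau !ME !mulA.
Qed.

Lemma right_module_of_bimodule (Y : tvsType R[i]) (l : A -> Y -> Y) (r : Y -> A -> Y) :
  frechet_bimodule mul l r -> exists rE : Y -> E -> Y,
    right_frechet_module mulE rE /\
    forall y a b, rE y (tau a b) = unitization_lact l b (unitization_ract r y a).
Proof.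
move=> [fY [[bl br] lA rA lrA [cl cr]]].
have bul := unitization_lact_bilinear bl; have bur := unitization_ract_bilinear br.
have cul := unitization_lact_continuous bl cl.
have cur := unitization_ract_continuous br cr.
have [bull bulr] := bul; have [burl burr] := bur.
have [|||M [bM cM ME]] := @tensor_lift_trilinear _ _ _ _ _ hT hest Y fY Y
    (fun y a b => unitization_lact l b (unitization_ract r y a)).
- move=> y; split=> [a|b] t u v; first exact: bulr.
  by rewrite (burl y); exact: bull.
- by move=> a b t u v; have /= -> := burr a t u v; exact: bull.
- move=> q cq; have [p1 [p2 [c1 c2 le]]] := bilinear_csn bul cul cq.
  have [p21 [p22 [c21 c22 le2]]] := bilinear_csn bur cur c2.
  exists p21, p22, p1; split=> // y a b; apply: le_trans (le _ _) _.
  rewrite mulrA [_ * p1 b]mulrC ler_wpM2l //.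
  exact: seminorm_ge0 (csn_seminorm c1) b.
exists M; split=> //; split=> // y e e'.
apply: (tensor_ext_lincont hT fY (phi := fun e' => M y (mulE e e'))
  (psi := fun e' => M (M y e) e')) => [||a2 b2].
- apply: (@lincont_comp _ _ _ _ (mulE e) (M y)); exact: lincont_bilinear_l.
- exact: lincont_bilinear_l.
apply: (tensor_ext_lincont hT fY (phi := fun e => M y (mulE e (tau a2 b2)))
  (psi := fun e => M (M y e) (tau a2 b2))) => [||a1 b1].
- apply: (@lincont_comp _ _ _ _ (mulE^~ (tau a2 b2)) (M y)).
    exact: lincont_bilinear_r.
  exact: lincont_bilinear_l.
- apply: (@lincont_comp _ _ _ _ (M y) (M^~ (tau a2 b2))).
    exact: lincont_bilinear_l.
  exact: lincont_bilinear_r.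
rewrite mtau !ME (unitization_lactA bl lA) (unitization_ractA br rA).
by rewrite (unitization_lractA bl br lrA).
Qed.

Lemma right_module_map_of_bimodule_map (Y Z : tvsType R[i])
    (lY : A -> Y -> Y) (rY : Y -> A -> Y) (lZ : A -> Z -> Z) (rZ : Z -> A -> Z)
    (rYE : Y -> E -> Y) (rZE : Z -> E -> Z) (f : Y -> Z) :
  right_frechet_module mulE rYE -> right_frechet_module mulE rZE ->
  (forall y a b, rYE y (tau a b) = unitization_lact lY b (unitization_ract rY y a)) ->
  (forall y a b, rZE y (tau a b) = unitization_lact lZ b (unitization_ract rZ y a)) ->
  lincont f -> (forall a y, f (lY a y) = lZ a (f y)) ->
  (forall y a, f (rY y a) = rZ (f y) a) -> right_module_map rYE rZE f.
Proof.
move=> [_ bY _ cY] [fZ bZ _ cZ] YE ZE lcf fl fr; have [lf cf] := lcf.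
split=> // y e.
apply: (tensor_ext_lincont hT fZ (phi := fun e => f (rYE y e))
  (psi := fun e => rZE (f y) e)) => [||a b].
- by apply: (@lincont_comp _ _ _ _ (rYE y) f) => //; exact: lincont_bilinear_l.
- exact: lincont_bilinear_l.
rewrite YE ZE /unitization_lact /unitization_ract.
by rewrite (linD lf) (linZ lf) fl (linD lf) (linZ lf) fr.
Qed.

End EnvelopingAlgebra.

(* Flatness makes the map induced on the quotients by the balancing subspaces
   injective with closed range, hence by the open mapping theorem a topological
   embedding, along which functionals extend. *)
Lemma flat_central_functional_extends (R : realType) (A : tvsType R[i])
    (mul : A -> A -> A) (E : tvsType R[i])
    (tau : unitization A -> unitization A -> E) (mulE : E -> E -> E)
    (act : E -> unitization A -> unitization A)
    (Y1 Y2 Y3 : tvsType R[i]) (r1 : Y1 -> E -> Y1) (r2 : Y2 -> E -> Y2)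
    (r3 : Y3 -> E -> Y3) (f : Y1 -> Y2) (g : Y2 -> Y3) :
  frechet_algebra mul -> enveloping_algebra mul tau mulE ->
  left_frechet_module mulE act ->
  (forall a b x, act (tau a b) x =
     unitization_mul mul (unitization_mul mul a x) b) ->
  flat_module mulE act ->
  right_frechet_module mulE r1 -> right_frechet_module mulE r2 ->
  right_frechet_module mulE r3 -> right_module_map r1 r2 f ->
  right_module_map r2 r3 g -> short_exact f g -> continuous_split f g ->
  forall h : Y1 -> R[i]^o, central_functional tau r1 h ->
  exists2 h' : Y2 -> R[i]^o, central_functional tau r2 h'
    & forall y, h' (f y) = h (r1 y (tau (0, 1) (0, 1))).
Proof.
move=> fA hE hact actE hflat h1 h2 h3 hf hg hex hsplit h hc.
have fAp : frechet_space (unitization A) by apply: frechet_unitization; case: fA.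
have [fY1 _ _ _] := h1; have [fY2 _ _ _] := h2; have [fY3 _ _ _] := h3.
have [lf cf fr] := hf; have [lg cg gr] := hg.
have [T1 [t1 [hT1 _]]] := projective_tensor_exists fY1 fAp.
have [T2 [t2 [hT2 _]]] := projective_tensor_exists fY2 fAp.
have [T3 [t3 [hT3 _]]] := projective_tensor_exists fY3 fAp.
have [fT1 bt1 ct1 _] := hT1; have [fT2 bt2 ct2 _] := hT2; have [fT3 bt3 ct3 _] := hT3.
have lid (V : lmodType R[i]) : linear (idfun : V -> V) by [].
have cid (V : tvsType R[i]) : continuous (idfun : V -> V) by move=> x; exact: cvg_id.
have [F [lF cF FE]] := tensor_lift hT1 fT2 (bilinear_comp bt2 lf (lid _) (lid _))
  (bilinear_comp_continuous bt2 ct2 lf cf (lid _) (cid _) (lid _) (cid _)).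
have [G [lG cG GE]] := tensor_lift hT2 fT3 (bilinear_comp bt3 lg (lid _) (lid _))
  (bilinear_comp_continuous bt3 ct3 lg cg (lid _) (cid _) (lid _) (cid _)).
set N1 := balancing_subspace r1 act t1; set N2 := balancing_subspace r2 act t2.
set N3 := balancing_subspace r3 act t3.
have [NF NG _] : short_exact_mod N1 N2 N3 F G.
  by apply: (hflat _ _ _ r1 r2 r3 f g).
have sN2 : subspace N2 by exact: subspace_balancing.
have clN2 : closure N2 `<=` N2 by exact: closure_balancing.
have [H1 [dH1 H1N H1E]] := balanced_of_central fA hE hact actE h1 hT1 hc.
(* By exactness the range of [F] plus [N2] is the preimage under [G] of the closed subspace [N3]. *)
have clW : closure [set w | exists u m, N2 m /\ w = F u + m] `<=`
    [set w | exists u m, N2 m /\ w = F u + m].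
  move=> w clw; have [u N2u] : exists u, N2 (w - F u).
    apply/NG/(closure_balancing (tauT := t3))/closure_dualP.
      exact: subspace_balancing.
    move=> H3 dH3 H3N.
    apply: (closure_min_dual (f := fun v => H3 (G v)) _ _ clw).
      split; first by move=> a x y; rewrite lG dH3.1.
      by move=> x; apply: continuous_comp; [exact: cG | exact: dH3.2].
    move=> _ [u [m [N2m ->]]]; apply: H3N; apply/NG; exists u.
    by rewrite addrC addrA addNr add0r.
  by exists u, (w - F u); split=> //; rewrite addrC subrK.
have [|p cp H1p] := open_mapping_functional fT1 fT2 lF cF sN2 clN2 clW dH1.
  by move=> u /NF; exact: H1N.
have sp := csn_seminorm cp; have cpq := csn_quotient cp sN2.
(* Domination by the quotient of [p] by [N2], rather than by [p], makes the extension vanish on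
   [N2]. *)
have [H2 [lH2 H2p H2F]] := hahn_banach (csn_seminorm cpq) lF dH1.1
  (fun u => quotient_seminorm_ge sN2.1 (fun m => H1p u m)).
have dH2 : dual T2 H2 by exact: csn_dual lH2 cpq H2p.
have H2N v : N2 v -> H2 v = 0.
  move=> Nv; apply/cabs0_eq0/eqP; rewrite eq_le cabs_ge0 andbT.
  by apply: le_trans (H2p v) _; rewrite (quotient_seminorm_sub sp sN2.1 sN2.2).
have [ch' _] := central_of_balanced fA actE hT2 dH2 H2N.
exists (fun y => H2 (t2 y (0, 1))) => // y.
by rewrite -[t2 (f y) _]FE H2F H1E.
Qed.

(** * From amenability to derivations into Banach duals *)

Section DualExtension.
Variables (R : realType) (A : tvsType R[i]) (mul : A -> A -> A).
Hypothesis hA : frechet_arens_michael mul.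
Local Notation Ap := (unitization A).
Local Notation "x ** y" := (unitization_mul mul x y) (at level 40).
Variables (X : completeNormedModType R[i]) (l : A -> X -> X) (r : X -> A -> X).
Hypothesis hX : topological_bimodule mul l r.
Variable D : A -> (X -> R[i]^o).
Hypothesis hD : derivation_to_dual mul l r D.

(* The middle term of the extension of [X] by the dual of the unitization that
   corresponds to [D]: the left action is twisted by the cocycle
   [beta a x : c |-> D a (x c)]. *)
Lemma derivation_extension (p : A -> R) (q : X -> R) : csn p -> csn q ->
  (forall a x, cabs (D a x) <= p a * q x) ->
  exists (Y : completeNormedModType R[i]) (L : A -> Y -> Y) (M : Y -> A -> Y)
    (beta : A -> X -> Y) (ev : Y -> R[i]^o),
  let l2 a (z : X * Y) : X * Y := (l a z.1, L a z.2 + beta a z.1) in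
  let r2 (z : X * Y) a : X * Y := (r z.1 a, M z.2 a) in
  [/\ topological_bimodule mul L M, topological_bimodule mul l2 r2,
      bilinear_map beta, dual Y ev
    & (forall a x, ev (beta a x) = D a x) /\ forall a y, ev (L a y) = ev (M y a)].
Proof.
move=> cp cq Dpq.
have [[bl br] lA rA lrA [cl cr]] := hX.
have [[fsA bm am cm] _] := hA.
have bum := unitization_mul_bilinear bm.
have mulA := unitization_mulA bm am.
have bur := unitization_ract_bilinear br.
have cur := unitization_ract_continuous br cr.
have [burl burr] := bur.
have [p1 [p2 [c1 c2 hur]]] := bilinear_csn bur cur cq.
(* [s] has to dominate [p] and also [p2], which controls the dependence of q (x c) on [c]; then each
   [beta a x] is bounded relative to [s]. *)
have [s [C [cs C0 sC s1 sM]]] :=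
  unitization_arens_michael hA (csnD (csn_fst R[i]^o cp) c2).
have ss := csn_seminorm cs.
have pC a : p a <= C * s (a, 0).
  apply: le_trans (sC _); rewrite /= lerDl; exact: seminorm_ge0 (csn_seminorm c2) _.
have p2C u : p2 u <= C * s u.
  apply: le_trans (sC _); rewrite lerDr; exact: seminorm_ge0 (csn_seminorm cp) _.
have s0 u : 0 <= s u by exact: seminorm_ge0.
have p10 x : 0 <= p1 x by exact: seminorm_ge0 (csn_seminorm c1) x.
pose lA0 (a : A) (u : Ap) : Ap := (a, 0) ** u.
pose rA0 (u : Ap) (a : A) : Ap := u ** (a, 0).
have in_lin (c : R[i]) (a b : A) : ((c *: a + b, 0) : Ap) = c *: ((a, 0) : Ap) + (b, 0).
  by congr (_, _); rewrite /= scaler0 addr0.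
have blA0 : bilinear_map lA0.
  split=> [a|u c a b]; first exact: bum.1.
  by rewrite /lA0 in_lin; exact: bum.2.
have brA0 : bilinear_map rA0.
  split=> [u c a b|a]; last exact: bum.2.
  by rewrite /rA0 in_lin; exact: bum.1.
have in_mul a b : ((mul a b, 0) : Ap) = (a, 0) ** (b, 0).
  by congr (_, _); rewrite /= ?mul0r // !scale0r !addr0.
have lA0A a b u : lA0 (mul a b) u = lA0 a (lA0 b u) by rewrite /lA0 in_mul mulA.
have rA0A u a b : rA0 u (mul a b) = rA0 (rA0 u a) b by rewrite /rA0 in_mul mulA.
have lrA0 a u b : rA0 (lA0 a u) b = lA0 a (rA0 u b) by rewrite /lA0 /rA0 mulA.
have lA0s a u : s (lA0 a u) <= s (a, 0) * s u by exact: sM.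
have rA0s u a : s (rA0 u a) <= s (a, 0) * s u by rewrite mulrC; exact: sM.
have [L [M [hY LE ME Lle Mle]]] :=
  bdual_bimodule blA0 brA0 lA0A rA0A lrA0 ss (csn_inl cs) lA0s rA0s.
have [[bL bM] LA MA LMA [cL cM]] := hY.
have [dD lD DM] := hD.
pose ur := unitization_ract r.
have Dle a x c : cabs (D a (ur x c)) <= C * s (a, 0) * (p1 x * C) * s c.
  apply: le_trans (Dpq _ _) _; rewrite -[leRHS]mulrA; apply: ler_pM => //.
  - exact: seminorm_ge0 (csn_seminorm cp) _.
  - exact: seminorm_ge0 (csn_seminorm cq) _.
  - by apply: le_trans (hur _ _) _; rewrite -mulrA ler_wpM2l.
have /choice[beta0 beta0E] : forall z : A * X, exists g : bdual s,
    forall c, g c = D z.1 (ur z.2 c).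
  move=> [a x] /=; apply: (bdual_of ss) (Dle a x) => t u v.
  by rewrite /ur (burl x) (dD a).1.
pose beta a x := beta0 (a, x).
have betaE a x c : beta a x c = D a (ur x c) by exact: beta0E.
have beta_le a x : bdual_rnorm (beta a x) <= C * s (a, 0) * (p1 x * C).
  apply: (bdual_rnorm_ub ss) => [|c]; last by rewrite betaE.
  by rewrite !mulr_ge0 // ltW.
have bbeta : bilinear_map beta.
  split=> [a|x] t u v; apply: bdual_ext => c; rewrite bdualD bdualZ !betaE.
    rewrite /ur; have /= -> := burr c t u v; exact: (dD a).1.
  by rewrite lD.
have ur0 x a : ur x (a, 0) = r x a by exact: unitization_ract0.
have urM x u v : ur x (u ** v) = ur (ur x u) v by exact: unitization_ractA.
have url a x c : ur (l a x) c = l a (ur x c).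
  by rewrite -!(unitization_lact0 l); exact: unitization_lractA.
(* The Leibniz rule of [D], read as the cocycle identity that makes the twisted left action [l2]
   associative. *)
have betaM a b x : beta (mul a b) x = L a (beta b x) + beta a (l b x).
  apply: bdual_ext => c; rewrite bdualD LE !betaE url DM.
  by rewrite !fctE /dual_lact /dual_ract /rA0 urM ur0.
have betaMr a x b : M (beta a x) b = beta a (r x b).
  by apply: bdual_ext => c; rewrite ME !betaE /lA0 urM ur0.
exists (bdual s), L, M, beta, (fun f : bdual s => f ((0, 1) : Ap)) => l2 r2.
have [bl1 bl2] := bl; have [br1 br2] := br.
have [bL1 bL2] := bL; have [bM1 bM2] := bM; have [bb1 bb2] := bbeta.
have bl2' : bilinear_map l2.
  split=> [a t z w|z t a b]; congr (_, _); rewrite /=.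
  - exact: bl1.
  - by rewrite (bL1 a) (bb1 a) scalerDr addrACA.
  - exact: bl2.
  - have /= -> := bL2 z.2 t a b; have /= -> := bb2 z.1 t a b.
    by rewrite scalerDr addrACA.
have br2' : bilinear_map r2.
  split=> [z t a b|a t z w]; congr (_, _); rewrite /=.
  - exact: br1.
  - exact: bM1.
  - exact: br2.
  - exact: bM2.
split=> //.
- split=> //.
  + move=> a b [x y]; congr (_, _); rewrite /=; first exact: lA.
    by rewrite LA betaM (linD (bL1 a)) addrA.
  + by move=> [x y] a b; congr (_, _); rewrite /=; [exact: rA | exact: MA].
  + move=> a [x y] b; congr (_, _); rewrite /=; first exact: lrA.
    by rewrite (linD (bM2 b)) LMA betaMr.
  split; apply: bilinear_continuous_csn => // q' cq'.
    have [q1 [q2 [cq1 cq2 q'le]]] := csn_prod_le cq'.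
    have [a1 [a2 [ca1 ca2 h1]]] := bilinear_csn bl cl cq1.
    have [b1 [b2 [cb1 cb2 h2]]] := bilinear_csn bL cL cq2.
    have [K K0 hK] := csn_le_rnorm cq2.
    have KC0 : 0 <= K * C * C by rewrite !mulr_ge0 // ltW.
    exists (fun a => a1 a + (b1 a + K * C * C * s (a, 0))),
      (fun z => (a2 z.1 + p1 z.1) + b2 z.2); split.
    + apply: csnD => //; apply: csnD => //; apply: csnZ => //; exact: csn_inl cs.
    + by apply: csnD; [exact: (csn_fst (bdual s) (csnD ca2 c1)) | exact: csn_snd].
    move=> a [x y] /=; apply: le_trans (q'le _) _ => /=.
    have hb : q2 (beta a x) <= K * C * C * s (a, 0) * p1 x.
      apply: le_trans (hK _) _.
      have -> : K * C * C * s (a, 0) * p1 x = K * (C * s (a, 0) * (p1 x * C)) by ring.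
      apply: ler_wpM2l; [exact: ltW | exact: beta_le].
    have := (csn_seminorm cq2).1 (L a y) (beta a x).
    have := h1 a x; have := h2 a y; have := p10 x.
    have := mulr_ge0 KC0 (s0 (a, 0)).
    have := seminorm_ge0 (csn_seminorm ca1) a; have := seminorm_ge0 (csn_seminorm ca2) x.
    have := seminorm_ge0 (csn_seminorm cb1) a; have := seminorm_ge0 (csn_seminorm cb2) y.
    move: hb; set S := K * C * C * s (a, 0).
    move: (a1 a) (a2 x) (b1 a) (b2 y) (p1 x) => u1 u2 u3 u4 u5 hb v4 v3 v2 v1 vS v5 w1 w2 w3.
    have := mulr_ge0 v1 v5; have := mulr_ge0 v1 v4; have := mulr_ge0 v3 v2.
    have := mulr_ge0 v3 v5; have := mulr_ge0 vS v2; have := mulr_ge0 vS v4.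
    lra.
  have [q1 [q2 [cq1 cq2 q'le]]] := csn_prod_le cq'.
  have [a1 [a2 [ca1 ca2 h1]]] := bilinear_csn br cr cq1.
  have [b1 [b2 [cb1 cb2 h2]]] := bilinear_csn bM cM cq2.
  exists (fun z => a1 z.1 + b1 z.2), (fun a => a2 a + b2 a); split.
  + by apply: csnD; [exact: csn_fst | exact: csn_snd].
  + exact: csnD.
  move=> [x y] a /=; apply: le_trans (q'le _) _ => /=.
  have := h1 x a; have := h2 y a.
  have v1 := seminorm_ge0 (csn_seminorm ca1) x; have v2 := seminorm_ge0 (csn_seminorm ca2) a.
  have v3 := seminorm_ge0 (csn_seminorm cb1) y; have v4 := seminorm_ge0 (csn_seminorm cb2) a.
  have := mulr_ge0 v1 v4; have := mulr_ge0 v3 v2; lra.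
- apply: (@csn_dual _ _ _ (fun f => 1 * rnorm f)) => //.
  + by apply: csnZ => //; exact: csn_rnorm.
  + move=> f; have := bdual_rnorm_bound ss f (0, 1).
    by rewrite s1 mulr1 mul1r rnorm_bdual.
split=> [a x|a y]; first by rewrite betaE /ur (unitization_ract1 br).
rewrite LE ME /lA0 /rA0; congr (y _).
by rewrite (unitization_mul1r bm) (unitization_mulr1 bm).
Qed.

End DualExtension.

(** The twist changes only the left action on the product, so the extension still splits as a
    sequence of Fréchet spaces and flatness applies to it. *)
Lemma banach_derivations_of_amenable (R : realType) (A : tvsType R[i])
    (mul : A -> A -> A) : frechet_arens_michael mul -> amenable mul ->
  forall (X : completeNormedModType R[i]) (l : A -> X -> X) (r : X -> A -> X),
    topological_bimodule mul l r -> continuous_derivations_inner mul l r.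
Proof.
move=> hA amen X l r hX D hD cD.
have [fA _] := hA; have [fsA bm _ _] := fA; have [dD lD _] := hD.
have fX := frechet_complete_normed X.
have [p [q [cp cq Dpq]]] := strong_continuous_bound lD fsA fX (fun a => (dD a).1) cD.
have [Y [L [M [beta [ev]]]]] := derivation_extension hA hX hD cp cq Dpq.
set l2 := fun a z => _; set r2 := fun z a => _.
move=> [hY hXY bbeta dev [evD evC]].
have fY := frechet_complete_normed Y.
have [[bL bM] _ _ _ _] := hY.
have fAp := frechet_unitization fsA.
have [E [tau [hT hest]]] := projective_tensor_exists fAp fAp.
have [mulE hE] := enveloping_algebra_exists fA hT hest.
have [act [hact actE]] := left_module_unitization fA hT hest hE.
have [rY [hrY rYE]] :=
  right_module_of_bimodule hT hest hE (conj fY hY : frechet_bimodule mul L M).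
have [rXY [hrXY rXYE]] := right_module_of_bimodule hT hest hE
  (conj (frechet_prod fX fY) hXY : frechet_bimodule mul l2 r2).
have [rX [hrX rXE]] :=
  right_module_of_bimodule hT hest hE (conj fX hX : frechet_bimodule mul l r).
pose f (y : Y) : X * Y := (0, y); pose g (z : X * Y) : X := z.1.
have [[bl br] _ _ _ _] := hX.
have lf : lincont f.
  apply: lincont_csn => [a y y'|s /csn_inr cs]; last by exists (fun y => s (0, y)).
  by congr (_, _); rewrite /= scaler0 addr0.
have lg : lincont g by split=> // z; exact: cvg_fst.
have ls : lincont (fun x : X => (x, 0) : X * Y).
  apply: lincont_csn => [a x x'|s /csn_inl cs]; last by exists (fun x => s (x, 0)).
  by congr (_, _); rewrite /= scaler0 addr0.
have lp : lincont (fun z : X * Y => z.2) by split=> // z; exact: cvg_snd.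
have hf : right_module_map rY rXY f.
  apply: (right_module_map_of_bimodule_map hT hrY hrXY rYE rXYE lf) => [a y|y a].
    by congr (_, _); rewrite /= ?(lin0 (bl.1 a)) ?(lin0 (bbeta.1 a)) ?addr0.
  by congr (_, _); rewrite /= (lin0 (br.2 a)).
have hg : right_module_map rXY rX g.
  exact: (right_module_map_of_bimodule_map hT hrXY hrX rXYE rXE lg).
have hex : short_exact f g.
  split=> [y y' []//|[x y]|x]; last by exists (x, 0).
  by split=> [/= ->|[y' [<- _]]]; first by exists y.
have hsplit : continuous_split f g.
  exists (fun z => z.2), (fun x => (x, 0)); split=> // -[x y].
  by congr (_, _); rewrite /= ?addr0 ?add0r.
have hflat : flat_module mulE act.
  by apply: (amen E tau) => // a b x; rewrite actE unitization_self_action.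
have ul1 (V : tvsType R[i]) (lV : A -> V -> V) v :
    bilinear_map lV -> unitization_lact lV (0, 1) v = v.
  by move=> bV; exact: unitization_lact1.
have ur1 (V : tvsType R[i]) (rV : V -> A -> V) v :
    bilinear_map rV -> unitization_ract rV v (0, 1) = v.
  by move=> bV; exact: unitization_ract1.
have hev : central_functional tau rY ev.
  split=> // y a; rewrite !rYE (ul1 _ _ _ bL) (ur1 _ _ _ bM).
  by rewrite /unitization_lact /unitization_ract !(linD dev.1) evC.
have [h [dh hc] hfE] := flat_central_functional_extends fA hE hact actE hflat
  hrY hrXY hrX hf hg hex hsplit hev.
have [[bl2 br2] _ _ _ _] := hXY.
have hev1 y : h (f y) = ev y.
  by rewrite hfE rYE (ul1 _ _ _ bL) (ur1 _ _ _ bM).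
pose g0 x := h ((x, 0) : X * Y).
exists g0.
  apply: csn_dual (csn_inl (dual_csn dh)) _ => // a x x'.
  by rewrite /g0 -dh.1; congr (h (_, _)); rewrite /= scaler0 addr0.
move=> a; apply/funext => x; rewrite !fctE /dual_lact /dual_ract /g0.
(* Centrality of [h] at (x, 0) reads g0 (x a) = g0 (a x) + ev (beta a x), and the last term is
   [D a x]. *)
have := hc ((x, 0) : X * Y) (a, 0).
rewrite !rXYE (ul1 _ _ _ bl2) (ur1 _ _ _ br2) unitization_lact0 unitization_ract0.
rewrite /l2 /r2 /= (lin0 (bM.2 a)) (lin0 (bL.1 a)) add0r => ->.
have -> : ((l a x, beta a x) : X * Y) = (l a x, 0) + f (beta a x).
  by congr (_, _); rewrite /= ?addr0 ?add0r.
by rewrite (linD dh.1) hev1 evD [RHS]addrC addKr.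
Qed.

Theorem theorem9p6 (R : realType) (A : tvsType R[i]) (mul : A -> A -> A)
    (hA : frechet_arens_michael mul) :
  [<-> amenable mul;
       forall (X : completeNormedModType R[i])
         (l : A -> X -> X) (r : X -> A -> X),
         topological_bimodule mul l r -> continuous_derivations_inner mul l r;
       forall (X : tvsType R[i]) (l : A -> X -> X) (r : X -> A -> X),
         frechet_bimodule mul l r -> continuous_derivations_inner mul l r].
Proof.
tfae.
- exact: banach_derivations_of_amenable.
- exact: banach_derivations_frechet.
- by apply: amenable_of_derivations; case: hA.
Qed.
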